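(* Let $\sigma\in\mathcal C$ and consider the vector function on $\mathcal A_0\cup\Gamma$ $$\psi^\sigma(k,\omega)=(\psi^\sigma(\gamma(k),\omega))_{\gamma\in\mathcal C}:=U(k,\omega)\mathbf n_\sigma,\qquad k\ge 0,$$ where $U(k,\omega)$ is the matrix function defined in the context and $\mathbf n_\sigma\in l^2(\mathcal C)$ is the standard basis vector corresponding to $\sigma$. This function satisfies the boundary condition $$\psi^\sigma(0,\omega)=\mathcal R(\lambda(\omega))\,\mathrm{diag}\{\mathfrak b_\nu(0)\}_{\nu\in\mathcal C}\,\psi^\sigma(1,\omega),$$ and, for $\omega\in T_\sigma^+$, it admits along the channels the representation $$\psi^\sigma(\gamma(k),\omega)=\begin{cases}e_\sigma(k,\theta_\sigma(\omega)^{-1})+s_{\sigma\sigma}(\omega)e_\sigma(k,\theta_\sigma(\omega)),&\gamma=\sigma,\\ s_{\gamma\sigma}(\omega)e_\gamma(k,\theta_\gamma(\omega)),&\gamma\ne\sigma,\end{cases}$$ with coefficients $s_{\gamma\sigma}(\omega)$ independent of $k$. Thus, by the formula $$\psi^\sigma(\alpha,\omega)=\sum_{\nu\in\mathcal C}r(\alpha,\nu(0);\lambda(\omega))\,\mathfrak b_\nu(0)\,\psi^\sigma(\nu(1),\omega),\qquad\alpha\in\mathcal A_1,$$ it may be prolongated to a special solution (corresponding to $\sigma$) of the equation $\mathcal L\xi=\lambda\xi$.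
   Context: **System.** $\mathcal A$ is a countable set (''particles'') and $\mathcal L=(L(\alpha,\beta))_{\alpha,\beta\in\mathcal A}$ is a real symmetric matrix with finitely many non-zero entries in each row, such that $\mathcal L>0$ as an operator in $l^2(\mathcal A)$. $\mathcal M(\mathcal X)$ is the space of all functions on $\mathcal X$. Particles $\alpha,\beta$ interact if $L(\alpha,\beta)\ne0$. A channel is a sequence $\sigma=\{\sigma(k)\}_{k\ge0}$ of particles such that for $k>0$ the particle $\sigma(k)$ interacts, apart from possibly itself (external field), only with $\sigma(k-1)$ and $\sigma(k+1)$, while $\sigma(0)$ interacts with $\sigma(1)$ and some other particles not in $\sigma$. The set $\mathcal C$ of all channels is finite, the attachment points $\sigma(0)$ are pairwise distinct, $\Gamma=\{\sigma(0)\}_{\sigma\in\mathcal C}$, $\mathcal A_0=\bigcup_{\sigma\in\mathcal C}\{\sigma(k):k\ge1\}$, and $\mathcal A_1=\mathcal A\setminus\mathcal A_0$ is finite. Put $\mathfrak b_\sigma(k-1)=-L(\sigma(k-1),\sigma(k))$, $\mathfrak a_\sigma(k)=L(\sigma(k),\sigma(k))$, $k\ge1$; it is assumed that $\mathfrak b_\sigma(k)>0$. There are $a_\sigma\in\mathbb R$, $b_\sigma>0$ and $\epsilon>0$ with $\sum_{k\ge1}(1+\epsilon)^k\{|\mathfrak a_\sigma(k)-a_\sigma|+|\mathfrak b_\sigma(k)-b_\sigma|\}<\infty$ for every $\sigma\in\mathcal C$. The set $\bigcup_\sigma(a_\sigma-2b_\sigma,a_\sigma+2b_\sigma)$ is connected,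 and $a,b$ are such that $\bigcup_\sigma[a_\sigma-2b_\sigma,a_\sigma+2b_\sigma]=[a-2b,a+2b]$. **Spectral variables.** $\mathbb D$ is the unit disk, $\mathbb T$ the unit circle, $W(\omega)=a-b(\omega+\omega^{-1})$, $W_\sigma(\theta)=a_\sigma-b_\sigma(\theta+\theta^{-1})$ on $\mathbb D$, $\lambda(\omega)=W(\omega)$, $\theta_\sigma(\omega)=W_\sigma^{-1}\circ W(\omega)\in\mathbb D$ for $\omega\in\mathbb D$, extended to $\overline{\mathbb D}$. $T_\sigma^+=\{\omega\in\mathbb T:|\theta_\sigma(\omega)|=1\}$. **Jost solutions.** For each $\sigma$, $e_\sigma(k,\theta)$, $k\ge0$, is the solution of $-\mathfrak b_\sigma(k-1)e_\sigma(k-1,\theta)+\mathfrak a_\sigma(k)e_\sigma(k,\theta)-\mathfrak b_\sigma(k)e_\sigma(k+1,\theta)=W_\sigma(\theta)e_\sigma(k,\theta)$, $k\ge1$, with $e_\sigma(k,\theta)=\theta^k(1+o(1))$ as $k\to\infty$, holomorphic in $\theta$ in a neighbourhood of $\overline{\mathbb D}$. **Matrix $U$.** $\mathcal L_1=(L(\alpha,\beta))_{\alpha,\beta\in\mathcal A_1}$, $(\mathcal L_1-\lambda I)^{-1}=(r(\alpha,\beta;\lambda))_{\alpha,\beta\in\mathcal A_1}$, $\mathcal R(\lambda)=(r(\sigma(0),\nu(0);\lambda))_{\sigma,\nu\in\mathcal C}$. Put $B=\mathrm{diag}\{b_\sigma\}$, $B(0)=\mathrm{diag}\{\mathfrak b_\sigma(0)\}$,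 $\mathcal E(k,\omega)=\mathrm{diag}\{e_\sigma(k,\theta_\sigma(\omega))\}$, $D(\omega)=\mathrm{diag}\{\theta_\sigma(\omega)^{-1}-\theta_\sigma(\omega)\}$, $P(k,\omega)=\mathrm{diag}\{p_\sigma(k,\omega)\}$, where $p_\sigma$ solves $-\mathfrak b_\sigma(k-1)p_\sigma(k-1)+\mathfrak a_\sigma(k)p_\sigma(k)-\mathfrak b_\sigma(k)p_\sigma(k+1)=\lambda(\omega)p_\sigma(k)$, $k\ge1$, $p_\sigma(0)=1$, $p_\sigma(1)=0$. Let $T(\omega)=\mathcal E(0,\omega)-\mathcal R(\lambda(\omega))B(0)\mathcal E(1,\omega)$ (invertible in $\overline{\mathbb D}$ except at a finite set of points) and $$U(k,\omega)=[-P(k,\omega)+\mathcal E(k,\omega)T(\omega)^{-1}]BB(0)^{-1}D(\omega)\mathcal E(1,\omega)^{-1}.$$ Identities involving $U(k,\omega)$ are understood away from its singularities (removable singularities being filled by continuity). **Special solution.** A special solution corresponding to $\sigma\in\mathcal C$ is a function $\psi^\sigma(\alpha,\omega)$, $\alpha\in\mathcal A$, such that: 1. for each $\alpha\in\mathcal A_0$ the function $\psi^\sigma(\alpha,\cdot)$ is holomorphic in a vicinity of $\overline{\mathbb D}$, except, perhaps, a finite set $\mathcal O\subset\overline{\mathbb D}$ where it has poles; 2. for each $\omega\in\overline{\mathbb D}\setminus\mathcal O$ the function $\psi^\sigma(\cdot,\omega)\in\mathcal M(\mathcal A)$ satisfies $\mathcal L\psi^\sigma(\cdot,\omega)=\lambda\psi^\sigma(\cdot,\omega)$,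 $\lambda=a-b(\omega+\omega^{-1})$; 3. for $\gamma\ne\sigma$ there are functions $s_{\gamma\sigma}(\omega)$ meromorphic in a vicinity of $\overline{\mathbb D}$, and there is a function $s_{\sigma\sigma}(\omega)$ continuous on $T_\sigma^+$, such that for $\omega\in T_\sigma^+$ one has $\psi^\sigma(\sigma(k),\omega)=e_\sigma(k,\theta_\sigma(\omega)^{-1})+s_{\sigma\sigma}(\omega)e_\sigma(k,\theta_\sigma(\omega))$ and $\psi^\sigma(\gamma(k),\omega)=s_{\gamma\sigma}(\omega)e_\gamma(k,\theta_\gamma(\omega))$ for $\gamma\neq\sigma$; and for $\omega\in\overline{\mathbb D}\setminus T_\sigma^+$ one has $\psi^\sigma(\sigma(k),\omega)=\theta_\sigma(\omega)^{-k}(1+o(1))$ as $k\to\infty$ and $\psi^\sigma(\gamma(k),\omega)=s_{\gamma\sigma}(\omega)e_\gamma(k,\theta_\gamma(\omega))$ for $\gamma\ne\sigma$.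
   Formalization: ''Holomorphic/meromorphic in a vicinity of the closed disk'' is false at points ω₀≠±1 of the circle where some θ_γ=±1 (square-root branch, when bands differ); there the functions are only claimed meromorphic in ζ, ω=ω₀(1−ζ²); elsewhere the claim is literal. *)

(* Defs.v *)
From HB Require Import structures.
From mathcomp Require Import all_boot all_order all_algebra.
From mathcomp Require Import finmap.
From mathcomp Require Import complex.
From mathcomp Require Import all_classical all_reals all_analysis.

Set Implicit Arguments.
Unset Strict Implicit.
Unset Printing Implicit Defensive.

Import Order.TTheory GRing.Theory Num.Theory.
Import numFieldNormedType.Exports.

Local Open Scope classical_set_scope.
Local Open Scope ring_scope.
Local Open Scope complex_scope.

(* R[i]^o is R[i] with its topology and its structure of normed space over
   itself: [derivable f z 1] for f : R[i]^o -> R[i]^o is complex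
   differentiability at z. *)

Section ComplexFunctions.
Context {R : realType}.
Local Notation C := (R[i]^o).

Definition closed_disk : set C := [set z | `|z| <= 1].

Definition open_disk : set C := [set z | `|z| < 1].

Definition unit_circle : set C := [set z | `|z| = 1].

Definition holomorphic_on (G : set C) (f : C -> C) : Prop :=
  forall z, G z -> derivable f z 1.

Definition holomorphic_near_disk (f : C -> C) : Prop :=
  exists G : set C, [/\ open G, closed_disk `<=` G & holomorphic_on G f].

(* f has at worst a pole at z0 *)
Definition meromorphic_at (f : C -> C) (z0 : C) : Prop :=
  (\forall z \near z0^', derivable f z 1) /\
  exists (N : nat) (M : C), \forall z \near z0^', `|(z - z0) ^+ N * f z| <= M.

(* f is holomorphic in a vicinity of the closed disk, except for a finite set
   O of points of the disk where it has poles; E is a set of points of the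
   unit circle around which f is only two-valued. Away from E this is literal:
   f is the restriction of a function F meromorphic on an open set containing
   the rest of the closed disk. Every point om of the closed disk other than
   z0 in E is z0 * (1 - zeta ^+ 2) for a unique zeta with 0 < Re zeta, and
   near z0 the function f is required to be meromorphic in zeta. *)
Definition meromorphic_near_disk (E O : set C) (f : C -> C) : Prop :=
  (exists (G : set C) (F : C -> C),
     [/\ open G,
         closed_disk `\` E `<=` G,
         holomorphic_on (G `\` O) F,
         forall z, (O `\` E) z -> meromorphic_at F z &
         forall z, (closed_disk `\` (O `|` E)) z -> f z = F z]) /\
  (forall z0, E z0 ->
     exists g : C -> C, meromorphic_at g 0 /\
       \forall zeta \near (0 : C)^',
         0 < complex.Re zeta -> closed_disk (z0 * (1 - zeta ^+ 2)) ->
         f (z0 * (1 - zeta ^+ 2)) = g zeta).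

(* unconditional convergence of the family f to s *)
Definition has_sum (A : choiceType) (f : A -> R[i]) (s : R[i]) : Prop :=
  forall eps : R[i], 0 < eps ->
    exists F0 : {fset A}, forall F : {fset A}, (F0 `<=` F)%fset ->
      `|\sum_(x <- F) f x - s| < eps.

Definition square_summable (A : choiceType) (u : A -> R[i]) : Prop :=
  exists s, has_sum (fun al => `|u al| ^+ 2) s.

Definition apply_matrix (A : choiceType) (L : A -> A -> R) (u : A -> R[i])
    (al : A) : R[i] :=
  \sum_(be \in [set: A]) (L al be)%:C * u be.

Definition positive_operator (A : choiceType) (L : A -> A -> R) : Prop :=
  forall u : A -> R[i], square_summable u -> (exists al, u al != 0) ->
    exists s, has_sum (fun al => apply_matrix L u al * (u al)^*) s /\ 0 < s.

(* c 0 is the attachment point of the channel c *)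
Definition is_channel (A : Type) (L : A -> A -> R) (c : nat -> A) : Prop :=
  [/\ forall k be, L (c k.+1) be != 0 ->
        [\/ be = c k.+1, be = c k | be = c k.+2],
      L (c 0%N) (c 1%N) != 0 &
      exists be, (forall k, be <> c k) /\ L (c 0%N) be != 0].

Definition zhukovsky (a b : R) (z : R[i]) : R[i] :=
  a%:C - b%:C * (z + z^-1).

End ComplexFunctions.

(* The channels are indexed by 'I_n; core is A_1, the complement of the set
   A_0 of the particles chan s k.+1. *)
Record multichannel_system (R : realType) := MultichannelSystem {
  particle :> countType;
  interaction : particle -> particle -> R;
  nchan : nat;
  chan : 'I_nchan -> nat -> particle;
  core : {fset particle};
  chan_a : 'I_nchan -> R;
  chan_b : 'I_nchan -> R;
  spec_a : R;
  spec_b : R;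
  jacobi_a (s : 'I_nchan) (k : nat) : R :=
    interaction (chan s k) (chan s k);
  jacobi_b (s : 'I_nchan) (k : nat) : R :=
    - interaction (chan s k) (chan s k.+1);
  interaction_sym : forall al be, interaction al be = interaction be al;
  interaction_rows : forall al, finite_set [set be | interaction al be != 0];
  interaction_gt0 : positive_operator interaction;
  chanP : forall s, is_channel interaction (chan s);
  attachment_inj : injective (fun s => chan s 0%N);
  attachment_core : forall s, chan s 0%N \in core;
  coreP : forall al, al \in core <-> ~ exists s k, al = chan s k.+1;
  jacobi_b_gt0 : forall s k, 0 < jacobi_b s k;
  chan_b_gt0 : forall s, 0 < chan_b s;
  coefficients_decay : exists2 eps : R, 0 < eps & forall s,
    cvgn (series (fun k => (1 + eps) ^+ k.+1 *
      (`|jacobi_a s k.+1 - chan_a s| + `|jacobi_b s k.+1 - chan_b s|)));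
  bands_connected : connected (\bigcup_s
    `]chan_a s - 2 * chan_b s, chan_a s + 2 * chan_b s[%classic : set R);
  bands_union : \bigcup_s
    `[chan_a s - 2 * chan_b s, chan_a s + 2 * chan_b s]%classic =
    `[spec_a - 2 * spec_b, spec_a + 2 * spec_b]%classic :> set R }.

Section Scattering.
Context {R : realType} (S : multichannel_system R).
Local Notation C := (R[i]^o).
Local Notation n := (nchan S).
Local Notation fa := (@jacobi_a R S).
Local Notation fb := (@jacobi_b R S).

Definition lambda (om : C) : C := zhukovsky (spec_a S) (spec_b S) om.

(* th s is the map theta_s of the closed disk; W and W_s send 0 to infinity. *)
Definition is_theta (th : 'I_n -> C -> C) : Prop :=
  forall s,
    [/\ th s 0 = 0,
        forall om, open_disk om -> om != 0 ->
          [/\ open_disk (th s om), th s om != 0 &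
              zhukovsky (chan_a s) (chan_b s) (th s om) = lambda om] &
        {within closed_disk, continuous (th s)}].

Definition is_jost (e : 'I_n -> nat -> C -> C) : Prop :=
  forall s,
    [/\ forall k, holomorphic_near_disk (e s k),
        forall k (z : C), closed_disk z -> z != 0 ->
          - (fb s k)%:C * e s k z + (fa s k.+1)%:C * e s k.+1 z
            - (fb s k.+1)%:C * e s k.+2 z
          = zhukovsky (chan_a s) (chan_b s) z * e s k.+1 z &
        forall z : C, closed_disk z -> z != 0 ->
          (fun k => e s k z / z ^+ k : C) @ \oo --> (1 : C)].

(* psol s k om is the solution p_s(k, om) with p_s(0) = 1, p_s(1) = 0. *)
Fixpoint psol (s : 'I_n) (k : nat) (om : C) {struct k} : C :=
  match k with
  | 0 => 1
  | k1.+1 =>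
      match k1 with
      | 0 => 0
      | k2.+1 => (((fa s k1)%:C - lambda om) * psol s k1 om
                   - (fb s k2)%:C * psol s k2 om) / (fb s k1)%:C
      end
  end.

Definition core_mx : 'M[R[i]]_(#|{: core S}|) :=
  \matrix_(i, j) (interaction (fsval (enum_val i)) (fsval (enum_val j)))%:C.

Definition core_regular (l : R[i]) : Prop := core_mx - l%:M \in unitmx.

(* r(al, be; l) for al and be in core, 0 otherwise *)
Definition resolvent (al be : S) (l : R[i]) : R[i] :=
  match (insub al : option (core S)), (insub be : option (core S)) with
  | Some x, Some y => invmx (core_mx - l%:M) (enum_rank x) (enum_rank y)
  | _, _ => 0
  end.

Definition Rmx (l : R[i]) : 'M[R[i]]_n :=
  \matrix_(s, t) resolvent (chan s 0%N) (chan t 0%N) l.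

Definition Bmx : 'M[R[i]]_n := diag_mx (\row_s (chan_b s)%:C).

Definition B0mx : 'M[R[i]]_n := diag_mx (\row_s (fb s 0%N)%:C).

Definition Pmx (k : nat) (om : C) : 'M[R[i]]_n := diag_mx (\row_s psol s k om).

Variables (th : 'I_n -> C -> C) (e : 'I_n -> nat -> C -> C).

Definition Emx (k : nat) (om : C) : 'M[R[i]]_n :=
  diag_mx (\row_s e s k (th s om)).

Definition Dmx (om : C) : 'M[R[i]]_n :=
  diag_mx (\row_s ((th s om)^-1 - th s om)).

Definition Tmx (om : C) : 'M[R[i]]_n :=
  Emx 0 om - Rmx (lambda om) *m B0mx *m Emx 1 om.

Definition Umx (k : nat) (om : C) : 'M[R[i]]_n :=
  (- Pmx k om + Emx k om *m invmx (Tmx om)) *m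
  (Bmx *m invmx B0mx *m Dmx om *m invmx (Emx 1 om)).

(* the points of the closed disk where every factor of U is defined *)
Definition U_domain : set C :=
  [set om | [/\ closed_disk om, om != 0, core_regular (lambda om),
                Tmx om \in unitmx & Emx 1 om \in unitmx]].

(* psiU s k g om is the component g of U(k, om) n_s, completed by continuity
   at the points of the closed disk outside U_domain where the limit exists. *)
Definition Ucol (s : 'I_n) (k : nat) (g : 'I_n) (om : C) : C :=
  (Umx k om *m (delta_mx s 0 : 'cV_n)) g 0.

Definition nonsingular (s : 'I_n) (k : nat) (om : C) : Prop :=
  forall g, cvg (Ucol s k g @ within U_domain (nbhs om)).

Definition psiU (s : 'I_n) (k : nat) (g : 'I_n) (om : C) : C :=
  lim (Ucol s k g @ within U_domain (nbhs om)).

Definition psiU_vec (s : 'I_n) (k : nat) (om : C) : 'cV[R[i]]_n :=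
  \col_g psiU s k g om.

Definition Tplus (s : 'I_n) : set C :=
  [set om | unit_circle om /\ unit_circle (th s om)].

(* The edges of a band which lie strictly inside the spectrum: there th g
   has a square root branch point. There are none if all the bands coincide. *)
Definition inner_edges : set C :=
  [set om | [/\ unit_circle om, om != 1, om != -1 &
                exists g, th g om = 1 \/ th g om = -1]].

Definition channel_representation (s : 'I_n) (sc : 'I_n -> C -> C)
    (om : C) (v : 'I_n -> C) (k : nat) : Prop :=
  forall g, v g = if g == s
    then e s k (th s om)^-1 + sc s om * e s k (th s om)
    else sc g om * e g k (th g om).

(* The limit required of psi (chan s k) om * th s om ^+ k fails at om = 0,
   where th s vanishes, so that 0 always belongs to O and lambda is never used there. *)
Definition special_solution (s : 'I_n) (psi : S -> C -> C) : Prop :=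
  exists O : set C,
    [/\ finite_set O,
        O `<=` closed_disk,
        forall g k, meromorphic_near_disk inner_edges O (psi (chan g k.+1)),
        forall om, (closed_disk `\` O) om -> forall al,
          apply_matrix (@interaction R S) (psi^~ om) al
          = lambda om * psi al om &
        exists sc : 'I_n -> C -> C,
          [/\ forall g, g != s -> exists2 O' : set C,
                finite_set O' /\ O' `<=` closed_disk &
                meromorphic_near_disk inner_edges O' (sc g),
              {within Tplus s, continuous (sc s)},
              forall om, (Tplus s `\` O) om -> forall k,
                channel_representation s sc om
                  (fun g => psi (chan g k) om) k,
              forall om, (closed_disk `\` (Tplus s `|` O)) om ->
                (fun k => psi (chan s k) om * th s om ^+ k : C)
                  @ \oo --> (1 : C) &
              forall om, (closed_disk `\` (Tplus s `|` O)) om ->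
                forall g k, g != s ->
                psi (chan g k) om = sc g om * e g k (th g om)]].

End Scattering.

(* Main.v *)
Require Import Defs.
From mathcomp Require Import all_boot all_order all_algebra.
From mathcomp Require Import finmap complex ring lra zify.
From mathcomp Require Import all_classical all_reals all_analysis.

Set Implicit Arguments.
Unset Strict Implicit.
Unset Printing Implicit Defensive.

Import Order.TTheory GRing.Theory Num.Theory.
Import numFieldNormedType.Exports.

Local Open Scope classical_set_scope.
Local Open Scope ring_scope.
Local Open Scope complex_scope.

(** The column psi(k) = U(k) n_s is a rational expression in lambda, in the
    theta_g and in the Jost solutions. Three identities, which hold where all
    its factors are defined, explain its form.
    - Along a channel it is a combination of the solutions p and e(theta), hence
      a solution of the Jacobi equation of the channel ([wave_solution]).
    - T T^-1 = 1 gives psi(0) = R B(0) psi(1) ([wave_gate]). Since R is made of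
      the entries of the resolvent of the core at the attachment points, the
      prolongation to the core solves the equations there ([core_equation]).
    - The Wronskian of psi with e(theta_g) along the channel g is 0 for g <> s,
      and for g = s it equals the Wronskian of e(theta_s^-1) with e(theta_s)
      ([wave_wronskian]). Two solutions with vanishing Wronskian being
      proportional, this is the representation along the channels.
    The Wronskians, unlike the coefficients, pass to the limit, so the
    representation holds also where U is completed by continuity
    ([psiU_transmitted], [psiU_reflected]).

    The rest of the proof concerns the dependence on the spectral parameter.
    Each theta_g continues across the unit circle by one of the two
    reflections theta (z^-1) and theta (z^-1)^-1, except at the edges of its
    band inside the spectrum, where om = z0 (1 - x^2) resolves the branch point.
    Both cases are charts ([chart_exists]), in which the factors of U are
    meromorphic germs. A meromorphic germ which is nonzero at points
    arbitrarily close to its centre has no zeros nearby ([mero_neq0]). Nonreal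
    points of the open disk are such points: lambda is not real there, so that
    neither the core nor a channel with Dirichlet condition has the eigenvalue
    lambda ([good_nonreal]); for det T one uses the hypothesis of the theorem.
    Hence the exceptional points are isolated, and finite in number by
    compactness of the disk ([bad_finite]).

    The reflection coefficient has to be continuous on all of T_s^+, including
    the exceptional points. Conservation of the flux bounds it by 1
    ([reflection_le1]): the fluxes into the channels add up to 0, the core being
    real symmetric, and the outgoing ones have all the same sign because the
    imaginary parts of the theta_g have. A meromorphic germ which is bounded at
    points accumulating at its centre has a limit ([mero_bounded_cvg]).

    The complex analysis behind this starts from complex differentiability
    alone. Contour integrals are replaced by means over the vertices of regular
    polygons with 2^N sides: a polar grid admits a discrete integral which is
    exactly additive and vanishes exactly on affine functions, so that
    Goursat's bisection applies ([no_bad_sector]) and the mean over a circle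
    does not depend on the radius ([circle_mean_const]). Cauchy's formula, the
    removal of singularities and the finite order of zeros follow
    ([cauchy_formula], [disk_fun_divX], [disk_fun_order]). *)

(** * Complex numbers and complex derivatives *)

Section ComplexModulus.
Context {R : realType}.
Local Notation C := (R[i]^o).
Implicit Types (x y z : C).

(** The norm of R[i] takes its values in R[i]; estimates are carried out with
    this modulus in R, which is an ordered field. *)
Definition cabs (z : C) : R := complex.Re (`|z| : R[i]).

Lemma norm_cabs z : `|z| = (cabs z)%:C.
Proof. by rewrite /cabs RRe_real // normr_real. Qed.

Lemma cabs_ge0 z : 0 <= cabs z.
Proof. by rewrite -ler0c -norm_cabs normr_ge0. Qed.

Lemma cabs0 : cabs 0 = 0.
Proof. by apply: complexI; rewrite -norm_cabs normr0. Qed.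

Lemma cabs1 : cabs 1 = 1.
Proof. by apply: complexI; rewrite -norm_cabs normr1. Qed.

Lemma cabsM x y : cabs (x * y) = cabs x * cabs y.
Proof. by apply: complexI; rewrite rmorphM /= -!norm_cabs normrM. Qed.

Lemma cabsN x : cabs (- x) = cabs x.
Proof. by apply: complexI; rewrite -!norm_cabs normrN. Qed.

Lemma cabsV x : cabs x^-1 = (cabs x)^-1.
Proof. by apply: complexI; rewrite fmorphV /= -!norm_cabs normfV. Qed.

Lemma cabsX x n : cabs (x ^+ n) = cabs x ^+ n.
Proof. by apply: complexI; rewrite rmorphXn /= -!norm_cabs normrX. Qed.

Lemma cabsD x y : cabs (x + y) <= cabs x + cabs y.
Proof. by rewrite -lecR rmorphD /= -!norm_cabs ler_normD. Qed.

Lemma cabsB x y : cabs (x - y) <= cabs x + cabs y.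
Proof. by rewrite -[cabs y]cabsN cabsD. Qed.

Lemma cabs_distC x y : cabs (x - y) = cabs (y - x).
Proof. by rewrite -cabsN opprB. Qed.

Lemma cabs_lb x y : cabs x - cabs y <= cabs (x - y).
Proof. by have := cabsD (x - y) y; rewrite subrK; lra. Qed.

Lemma cabs_tri x y z : cabs (x - z) <= cabs (x - y) + cabs (y - z).
Proof. by have := cabsD (x - y) (y - z); rewrite addrA subrK. Qed.

Lemma cabs_eq0 x : (cabs x == 0) = (x == 0).
Proof. by rewrite -(inj_eq (@complexI _)) -norm_cabs rmorph0 normr_eq0. Qed.

Lemma cabs_gt0 x : (0 < cabs x) = (x != 0).
Proof. by rewrite lt_def cabs_ge0 andbT cabs_eq0. Qed.

Lemma cabs_real (r : R) : cabs (r%:C : R[i]) = `|r|.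
Proof. by rewrite /cabs normc_def /= expr0n addr0 sqrtr_sqr. Qed.

Lemma cabs_sum (I : Type) (s : seq I) (P : pred I) (F : I -> C) :
  cabs (\sum_(i <- s | P i) F i) <= \sum_(i <- s | P i) cabs (F i).
Proof.
elim/big_rec2: _ => [|i a b _ le_ab]; first by rewrite cabs0.
by apply: le_trans (cabsD _ _) _; rewrite lerD2l.
Qed.

Lemma sqr_cabs z : cabs z ^+ 2 = complex.Re z ^+ 2 + complex.Im z ^+ 2.
Proof.
by apply: complexI; rewrite rmorphXn /= -norm_cabs -add_Re2_Im2.
Qed.

Lemma le_Re_cabs z : `|complex.Re z| <= cabs z.
Proof.
rewrite -[leRHS]ger0_norm ?cabs_ge0 // -ler_sqr ?nnegrE // !real_normK ?num_real //.
by rewrite sqr_cabs lerDl sqr_ge0.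
Qed.

Lemma le_Im_cabs z : `|complex.Im z| <= cabs z.
Proof.
rewrite -[leRHS]ger0_norm ?cabs_ge0 // -ler_sqr ?nnegrE // !real_normK ?num_real //.
by rewrite sqr_cabs lerDr sqr_ge0.
Qed.

Lemma cabs_le_ReIm z : cabs z <= `|complex.Re z| + `|complex.Im z|.
Proof.
rewrite -ler_sqr ?nnegrE ?cabs_ge0 ?addr_ge0 // sqr_cabs.
rewrite sqrrD !real_normK ?num_real //.
have := mulr_ge0 (normr_ge0 (complex.Re z)) (normr_ge0 (complex.Im z)); lra.
Qed.

Lemma cabs_conj z : cabs (z^* : R[i]) = cabs z.
Proof. by apply: complexI; rewrite -!norm_cabs normcJ. Qed.

Lemma cabs_le1 z : (`|z| <= 1) = (cabs z <= 1).
Proof. by rewrite norm_cabs -(rmorph1 (real_complex R)) lecR. Qed.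

Lemma cabs_lt1 z : (`|z| < 1) = (cabs z < 1).
Proof. by rewrite norm_cabs -(rmorph1 (real_complex R)) ltcR. Qed.

Lemma cabs_is1 z : `|z| = 1 <-> cabs z = 1.
Proof.
rewrite norm_cabs; split => [|->]; last by rewrite rmorph1.
by rewrite -(rmorph1 (real_complex R)) => /complexI.
Qed.

Lemma ltC_real (e : R[i]) : 0 < e -> exists2 r : R, 0 < r & e = r%:C.
Proof.
move=> e0; exists (complex.Re e); last by rewrite RRe_real // gtr0_real.
by rewrite -ltcR RRe_real // gtr0_real.
Qed.

Lemma nbhsC z (P : set C) :
  nbhs z P <-> exists2 e : R, 0 < e & forall x, cabs (x - z) < e -> P x.
Proof.
split.
  move=> /nbhs_ballP[e /= e0 eP]; have [r r0 er] := ltC_real e0.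
  exists r => // x xz; apply: eP.
  by rewrite -ball_normE /= er norm_cabs ltcR cabs_distC.
move=> [e e0 eP]; apply/nbhs_ballP; exists e%:C => /=; first by rewrite ltcR.
by move=> x; rewrite -ball_normE /= norm_cabs ltcR cabs_distC => /eP.
Qed.

Lemma dnbhsC z (P : set C) :
  z^' P <->
  exists2 e : R, 0 < e & forall x, x != z -> cabs (x - z) < e -> P x.
Proof.
split=> [zP|[e e0 eP]].
  have /nbhsC[e e0 eP] : nbhs z (fun x => x != z -> P x) by [].
  by exists e => // x xz xe; apply: eP.
have /nbhsC : exists2 e : R, 0 < e &
    forall x, cabs (x - z) < e -> x != z -> P x.
  by exists e => // x xe xz; apply: eP.
by [].
Qed.

Lemma cvgC (T : Type) (F : set_system T) (FF : Filter F) (f : T -> C) (l : C) :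
  f @ F --> l <->
  forall e : R, 0 < e -> \forall x \near F, cabs (f x - l) < e.
Proof.
split=> [/cvgrPdist_lt fl e e0|fl].
  have /fl : (0 : R[i]) < e%:C by rewrite ltcR.
  by apply: filterS => x; rewrite norm_cabs ltcR cabs_distC.
apply/cvgrPdist_lt => e /ltC_real[r r0 ->].
by have := fl r r0; apply: filterS => x; rewrite norm_cabs ltcR cabs_distC.
Qed.

Lemma cvg_nbhsC (f : C -> C) z (l : C) : f @ z --> l <->
  forall e : R, 0 < e -> exists2 d : R, 0 < d &
    forall x, cabs (x - z) < d -> cabs (f x - l) < e.
Proof.
split=> [/cvgC h e /h /nbhsC //|h].
by apply/(@cvgC _ (nbhs z) (nbhs_filter z)) => e /h ?; apply/nbhsC.
Qed.

Lemma cvg_dnbhsC (f : C -> C) z (l : C) : f @ z^' --> l <->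
  forall e : R, 0 < e -> exists2 d : R, 0 < d &
    forall x, x != z -> cabs (x - z) < d -> cabs (f x - l) < e.
Proof.
split=> [/cvgC h e /h /dnbhsC //|h].
by apply/(@cvgC _ z^' (dnbhs_filter z)) => e /h ?; apply/dnbhsC.
Qed.

Lemma cvgCD (T : Type) (F : set_system T) {FF : Filter F} (f g : T -> C)
  (a b : C) : f @ F --> a -> g @ F --> b -> (fun t => f t + g t) @ F --> a + b.
Proof. exact: cvgD. Qed.

Lemma cvgCN (T : Type) (F : set_system T) {FF : Filter F} (f : T -> C)
  (a : C) : f @ F --> a -> (fun t => - f t) @ F --> - a.
Proof. exact: cvgN. Qed.

Lemma cvgCB (T : Type) (F : set_system T) {FF : Filter F} (f g : T -> C)
  (a b : C) : f @ F --> a -> g @ F --> b -> (fun t => f t - g t) @ F --> a - b.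
Proof. exact: cvgB. Qed.

Lemma cvgCM (T : Type) (F : set_system T) {FF : Filter F} (f g : T -> C)
  (a b : C) : f @ F --> a -> g @ F --> b -> (fun t => f t * g t) @ F --> a * b.
Proof. exact: cvgM. Qed.

Lemma cvgCV (T : Type) (F : set_system T) {FF : Filter F} (f : T -> C)
  (a : C) : a != 0 -> f @ F --> a -> (fun t => (f t)^-1) @ F --> a^-1.
Proof. exact: cvgV. Qed.

Lemma cvg_nbhs_eq (f g : C -> C) z (l : C) :
  (\forall x \near z, f x = g x) -> f @ z --> l -> g @ z --> l.
Proof.
move=> /nbhsC[d d0 dP] /cvg_nbhsC fl; apply/cvg_nbhsC => e /fl[r r0 rP].
exists (Num.min d r) => [|x]; first by rewrite lt_min d0.
by rewrite lt_min => /andP[xd xr]; rewrite -dP //; exact: rP.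
Qed.

Lemma cvg_dnbhs_eq (f g : C -> C) z (l : C) :
  (\forall x \near z^', f x = g x) -> f @ z^' --> l -> g @ z^' --> l.
Proof.
move=> /dnbhsC[d d0 dP] /cvg_dnbhsC fl; apply/cvg_dnbhsC => e /fl[r r0 rP].
exists (Num.min d r) => [|x xz]; first by rewrite lt_min d0.
by rewrite lt_min => /andP[xd xr]; rewrite -dP //; exact: rP.
Qed.

Lemma cvg_dnbhs_id z : (fun x : C => x) @ z^' --> z.
Proof. by apply/cvg_dnbhsC => e e0; exists e. Qed.

Lemma cvg_nbhs_dnbhs (f : C -> C) z (l : C) : f @ z --> l -> f @ z^' --> l.
Proof.
by move=> /cvg_nbhsC h; apply/cvg_dnbhsC => e /h [d d0 dP]; exists d => // x _; exact: dP.
Qed.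

Lemma derivable_cvgE (f : C -> C) z : derivable f z 1 <->
  exists d : C, (fun x => (f x - f z) / (x - z)) @ z^' --> d.
Proof.
rewrite /derivable; split.
  move=> /cvg_ex[/= d /cvgC fd]; exists d; apply/cvgC => e /fd.
  move=> /dnbhsC[r r0 rP]; apply/dnbhsC; exists r => // x xz xr.
  have := rP (x - z); rewrite subr0 subr_eq0 => /(_ xz xr).
  by rewrite /= /GRing.scale /= mulr1 subrK mulrC.
move=> [d /cvgC fd]; apply/cvg_ex; exists d; apply/cvgC => e /fd.
move=> /dnbhsC[r r0 rP]; apply/dnbhsC; exists r => // x xz xr.
have := rP (x + z); rewrite addrK -subr_eq0 addrK => /(_ xz).
by rewrite subr0 in xr => /(_ xr); rewrite /GRing.scale /= mulr1 mulrC.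
Qed.

Lemma derivable_continuousC (f : C -> C) z : derivable f z 1 -> f @ z --> f z.
Proof. by move=> /derivable1_diffP /differentiable_continuous. Qed.

Lemma derivable_compC (f g : C -> C) z :
  derivable f z 1 -> derivable g (f z) 1 -> derivable (fun x => g (f x)) z 1.
Proof.
move=> /derivable1_diffP df /derivable1_diffP dg; apply/derivable1_diffP.
exact: (differentiable_comp df dg).
Qed.

Lemma derivableCc (c z : C) : derivable (fun=> c) z 1.
Proof. exact: derivable_cst. Qed.

Lemma derivableCid z : derivable (fun x : C => x) z 1.
Proof. exact: derivable_id. Qed.

Lemma derivableCD (f g : C -> C) z : derivable f z 1 -> derivable g z 1 ->
  derivable (fun x => f x + g x) z 1.
Proof. exact: derivableD. Qed.

Lemma derivableCB (f g : C -> C) z : derivable f z 1 -> derivable g z 1 ->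
  derivable (fun x => f x - g x) z 1.
Proof. exact: derivableB. Qed.

Lemma derivableCN (f : C -> C) z : derivable f z 1 ->
  derivable (fun x => - f x) z 1.
Proof. exact: derivableN. Qed.

Lemma derivableCM (f g : C -> C) z : derivable f z 1 -> derivable g z 1 ->
  derivable (fun x => f x * g x) z 1.
Proof. exact: derivableM. Qed.

Lemma derivableCV (f : C -> C) z : f z != 0 -> derivable f z 1 ->
  derivable (fun x => (f x)^-1) z 1.
Proof. exact: derivableV. Qed.

Lemma derivableCinv z : z != 0 -> derivable (fun x : C => x^-1) z 1.
Proof. by move=> z0; apply: derivableCV; [exact: z0|exact: derivableCid]. Qed.

Lemma derivable_near_eq (f g : C -> C) z :
  (\forall x \near z, f x = g x) -> derivable f z 1 -> derivable g z 1.
Proof.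
move=> fg; have /nbhsC[r r0 rfg] := fg.
move=> /derivable_cvgE[d /cvgC fd]; apply/derivable_cvgE; exists d.
apply/cvgC => e /fd /dnbhsC[s s0 sP]; apply/dnbhsC.
exists (Num.min r s) => [|x xz]; first by rewrite lt_min r0.
rewrite lt_min => /andP[xr xs]; rewrite -!rfg //; first exact: sP.
by rewrite subrr cabs0.
Qed.

End ComplexModulus.

Section ComplexCompactness.
Context {R : realType}.
Local Notation C := (R[i]^o).

Lemma cabs_continuous_diff (z : C) (e : R) : 0 < e ->
  \forall x \near z, cabs (x - z) < e.
Proof. by move=> e0; apply/nbhsC; exists e. Qed.

Lemma continuousC_Complex (p : R * R) :
  (fun q : R * R => (Complex q.1 q.2 : C)) @ p --> (Complex p.1 p.2 : C).
Proof.
apply/cvgC => e e0; case: p => a b /=.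
have e2 : 0 < e / 2 by rewrite divr_gt0.
exists (ball a (e / 2), ball b (e / 2)).
  by split; apply: nbhsx_ballx.
move=> [x y] [/=]; rewrite -!ball_normE /= => xa yb.
apply: le_lt_trans (cabs_le_ReIm _) _ => /=.
by rewrite (distrC x) (distrC y); lra.
Qed.

Lemma closed_cabs_le (r : R) : closed [set z : C | cabs z <= r].
Proof.
move=> z zcl; rewrite /= leNgt; apply/negP => rz.
have e0 : 0 < cabs z - r by rewrite subr_gt0.
have [x [/= xr]] := zcl _ (cabs_continuous_diff z e0).
by have := cabs_lb z x; rewrite cabs_distC; lra.
Qed.

Lemma compact_cabs_le (r : R) : compact [set z : C | cabs z <= r].
Proof.
pose K := (fun q : R * R => (Complex q.1 q.2 : C)) @`
  (`[- r, r]%classic `*` `[- r, r]%classic).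
have cK : compact K.
  apply: continuous_compact; last by apply: compact_setX; exact: segment_compact.
  by apply: continuous_subspaceT => p; exact: continuousC_Complex.
suff zK : [set z : C | cabs z <= r] `<=` K.
  exact: (subclosed_compact (@closed_cabs_le r) cK zK).
move=> z /= zr; exists (complex.Re z, complex.Im z) => /=; last by case: (z).
split; rewrite /= in_itv /= -ler_norml.
  exact: le_trans (le_Re_cabs z) zr.
exact: le_trans (le_Im_cabs z) zr.
Qed.

Lemma compact_cabs_eq (s : R) : compact [set z : C | cabs z = s].
Proof.
have sub : [set z : C | cabs z = s] `<=` [set z : C | cabs z <= s].
  by move=> z /= ->.
apply: subclosed_compact (@compact_cabs_le s) sub => z zcl /=.
apply: contrapT => /eqP zs.
have e0 : 0 < `|cabs z - s| by rewrite normr_gt0 subr_eq0.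
have [x [/= xs]] := zcl _ (cabs_continuous_diff z e0).
rewrite -xs; apply/negP; rewrite -leNgt ler_norml.
by have := cabs_lb z x; have := cabs_lb x z; rewrite (cabs_distC z); lra.
Qed.

(** Used in place of nested compact sets: to find the point at which the
    bisection of a region concentrates, and the accumulation point of an
    infinite set of exceptional parameters. *)
Lemma bounded_seq_cluster (u : nat -> C) (r : R) :
  (forall n, cabs (u n) <= r) ->
  exists l : C, forall e : R, 0 < e -> forall N,
    exists2 m, (N <= m)%N & cabs (u m - l) < e.
Proof.
move=> ur; have [|l [_ lcl]] := @compact_cabs_le r (u @ \oo) _.
  by exists 0%N => // m _; exact: ur.
exists l => e e0 N.
have uN : (u @ \oo) (u @` [set m | (N <= m)%N]).
  by exists N => // m Nm; exists m.
have [x [[m /= Nm <-] xl]] := lcl _ _ uN (cabs_continuous_diff l e0).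
by exists m.
Qed.

Lemma dnbhs_nonempty (z : C) (e : R) : 0 < e ->
  exists2 x : C, x != z & cabs (x - z) < e.
Proof.
move=> e0; exists (z + (e / 2)%:C).
  by rewrite -subr_eq0 addrC addKr -cabs_gt0 cabs_real normr_gt0; lra.
by rewrite addrC addKr cabs_real gtr0_norm; lra.
Qed.

Global Instance dnbhsC_proper (z : C) : ProperFilter z^'.
Proof.
split; last exact: dnbhs_filter.
by move=> /dnbhsC[e e0 eP]; have [x xz /(eP _ xz)] := dnbhs_nonempty z e0.
Qed.

Lemma cvg_dnbhs_cauchy (f : C -> C) (z : C) :
  (forall e : R, 0 < e -> exists2 d : R, 0 < d & forall x y,
     x != z -> y != z -> cabs (x - z) < d -> cabs (y - z) < d ->
     cabs (f x - f y) < e) ->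
  cvg (f @ z^').
Proof.
move=> fC; have [d d0 dP] := fC 1 ltr01.
have [x0 x0z x0d] := dnbhs_nonempty z d0.
have [|l [_ lcl]] := @compact_cabs_le (cabs (f x0) + 1) (f @ z^') _.
  apply/dnbhsC; exists d => // x xz xd /=.
  by have := dP _ _ xz x0z xd x0d; have := cabs_lb (f x) (f x0); lra.
apply/cvg_ex; exists l; apply/cvgC => e e0.
have e2 : 0 < e / 2 by rewrite divr_gt0.
have [s s0 sP] := fC _ e2; apply/dnbhsC; exists s => // x xz xs.
have fs : (f @ z^') (f @` [set y | y != z /\ cabs (y - z) < s]).
  by apply/dnbhsC; exists s => // y yz ys; exists y.
have [_ [[y [yz ys] <-] yl]] := lcl _ _ fs (cabs_continuous_diff l e2).
by have := sP _ _ xz yz xs ys; have := cabs_tri (f x) (f y) l; lra.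
Qed.

End ComplexCompactness.

(** * Cauchy's theory by means over polygons *)

Section GridSum.
Context {C : comNzRingType}.

(** The discrete integral of f along the boundary of the sector with corners
    c, c q^n, c w^n and c q^n w^n of a polar grid: the two radial sides carry
    the weight q - 1 and the two circular sides the weight w - 1, so that
    (w - 1) times a sum over a circle centred at 0 stands for the integral of
    f (z) dz / z. *)
Definition grid_sum (f : C -> C) (c q w : C) (n : nat) : C :=
  \sum_(i < n) (q - 1) * (f (c * q ^+ i) - f (c * q ^+ i * w ^+ n)) +
  \sum_(j < n) (w - 1) * (f (c * q ^+ n * w ^+ j) - f (c * w ^+ j)).

(** The contributions of the inner sides cancel in pairs, as for a contour
    integral. *)
Lemma grid_sum_split (f : C -> C) (c q w : C) n :
  grid_sum f c q w (n + n) =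
  grid_sum f c q w n + grid_sum f (c * q ^+ n) q w n +
  (grid_sum f (c * w ^+ n) q w n + grid_sum f (c * q ^+ n * w ^+ n) q w n).
Proof.
rewrite /grid_sum !big_split_ord /= -!big_split /=.
have shuf (a b a' b' d d' e e' g g' h h' : C) :
  a + a' = b + d + e + h -> g + g' = b' + d' + e' + h' ->
  a + a' + (g + g') = b + b' + (d + d') + (e + e' + (h + h')).
  by move=> -> ->; ring.
rewrite !big_split /=; apply: shuf; rewrite -!big_split /=; apply: eq_bigr => i _.
  rewrite !exprD.
  have -> : c * w ^+ n * q ^+ i = c * q ^+ i * w ^+ n by ring.
  have -> : c * q ^+ i * w ^+ n * w ^+ n = c * q ^+ i * (w ^+ n * w ^+ n).
    by ring.
  have -> : c * q ^+ n * w ^+ n * q ^+ i = c * (q ^+ n * q ^+ i) * w ^+ n.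
    by ring.
  have -> : c * q ^+ n * q ^+ i = c * (q ^+ n * q ^+ i) by ring.
  have -> : c * (q ^+ n * q ^+ i) * w ^+ n * w ^+ n =
            c * (q ^+ n * q ^+ i) * (w ^+ n * w ^+ n) by ring.
  by ring.
rewrite !exprD.
have -> : c * w ^+ n * q ^+ n * w ^+ i = c * q ^+ n * (w ^+ n * w ^+ i) by ring.
have -> : c * w ^+ n * w ^+ i = c * (w ^+ n * w ^+ i) by ring.
have -> : c * q ^+ n * q ^+ n * w ^+ i = c * (q ^+ n * q ^+ n) * w ^+ i by ring.
have -> : c * q ^+ n * w ^+ n * q ^+ n * w ^+ i =
          c * (q ^+ n * q ^+ n) * (w ^+ n * w ^+ i) by ring.
have -> : c * q ^+ n * w ^+ n * w ^+ i = c * q ^+ n * (w ^+ n * w ^+ i) by ring.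
by ring.
Qed.

(** The weights are chosen so that the telescoping geometric sums of the radial
    and of the circular sides cancel exactly, and not only up to the mesh:
    affine functions have discrete integral 0 around any sector. *)
Lemma grid_sum_affine (a b c q w : C) n :
  grid_sum (fun z => a + b * z) c q w n = 0.
Proof.
rewrite /grid_sum.
have -> : \sum_(i < n) (q - 1) * (a + b * (c * q ^+ i) -
      (a + b * (c * q ^+ i * w ^+ n))) =
    b * c * (1 - w ^+ n) * ((q - 1) * \sum_(i < n) q ^+ i).
  by rewrite !mulr_sumr; apply: eq_bigr => i _; ring.
have -> : \sum_(j < n) (w - 1) * (a + b * (c * q ^+ n * w ^+ j) -
      (a + b * (c * w ^+ j))) =
    b * c * (q ^+ n - 1) * ((w - 1) * \sum_(i < n) w ^+ i).
  by rewrite !mulr_sumr; apply: eq_bigr => i _; ring.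
by rewrite -!subrX1; ring.
Qed.

End GridSum.

Section PolarGrid.
Context {R : realType}.
Local Notation C := (R[i]^o).

(** By [grid_sum_affine] only the distance of f to an affine function counts;
    this replaces the local estimate in Goursat's argument. *)
Lemma grid_sum_bound (f : C -> C) (a b c q w : C) n (M : R) :
  (forall i j, (i <= n)%N -> (j <= n)%N ->
     cabs (f (c * q ^+ i * w ^+ j) - (a + b * (c * q ^+ i * w ^+ j))) <= M) ->
  cabs (grid_sum f c q w n) <= 2 * M * (n%:R * (cabs (q - 1) + cabs (w - 1))).
Proof.
move=> fM; pose g z := f z - (a + b * z).
have -> : grid_sum f c q w n = grid_sum g c q w n.
  rewrite -[LHS]subr0 -(grid_sum_affine a b c q w n) /grid_sum /g opprD addrACA.
  rewrite -!sumrB; congr (_ + _); apply: eq_bigr => i _; ring.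
have gM i j : (i <= n)%N -> (j <= n)%N -> cabs (g (c * q ^+ i * w ^+ j)) <= M.
  exact: fM.
have term (u x y : C) : cabs x <= M -> cabs y <= M ->
    cabs (u * (x - y)) <= cabs u * (2 * M).
  move=> xM yM; rewrite cabsM ler_wpM2l ?cabs_ge0 //.
  by have := cabsB x y; lra.
have sumB (F : nat -> C) (u : C) : (forall i, (i < n)%N ->
    cabs (F i) <= cabs u * (2 * M)) ->
    cabs (\sum_(i < n) F i) <= n%:R * (cabs u * (2 * M)).
  move=> FB; apply: le_trans (cabs_sum _ _ _) _.
  have -> : n%:R * (cabs u * (2 * M)) = \sum_(i < n) cabs u * (2 * M).
    by rewrite sumr_const card_ord mulr_natl.
  by apply: ler_sum => i _; exact: FB.
apply: le_trans (cabsD _ _) _.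
have -> : 2 * M * (n%:R * (cabs (q - 1) + cabs (w - 1))) =
  n%:R * (cabs (q - 1) * (2 * M)) + n%:R * (cabs (w - 1) * (2 * M)) by ring.
apply: lerD.
  apply: (sumB (fun i => (q - 1) * (g (c * q ^+ i) - g (c * q ^+ i * w ^+ n)))).
  move=> i /ltnW ilen; apply: term; last exact: gM.
  by have := gM i 0%N ilen (leq0n _); rewrite expr0 mulr1.
apply: (sumB (fun j => (w - 1) * (g (c * q ^+ n * w ^+ j) - g (c * w ^+ j)))).
move=> i /ltnW ilen; apply: term; first exact: gM.
by have := gM 0%N i (leq0n _) ilen; rewrite expr0 mulr1.
Qed.

(** A primitive root of unity of order 2 ^ N, obtained by square roots so that
    the angular mesh of one level is half of the previous one. All that is
    needed of it is that the side of the regular polygon is of the exact order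
    2 ^- N, see [dyroot_side_le] and [dyroot_side_ge]. *)
Fixpoint dyroot (N : nat) : C :=
  match N with
  | 0 => 1
  | M.+1 => match M with
    | 0 => -1
    | K.+1 => match K with
      | 0 => 'i
      | _ => sqrtc (dyroot M)
      end
    end
  end.

Lemma dyroot_sqr N : dyroot N.+1 ^+ 2 = dyroot N.
Proof.
case: N => [|[|N]]; last exact: sqr_sqrtc; first by rewrite /= sqrrN expr1n.
by rewrite /= sqr_i.
Qed.

Lemma cabs_dyroot N : cabs (dyroot N) = 1.
Proof.
elim: N => [|N IHN]; first by rewrite cabs1.
apply/eqP; rewrite -(@pexpr_eq1 _ _ 2) ?cabs_ge0 // -cabsX dyroot_sqr.
by rewrite IHN.
Qed.

Lemma dyroot_pow N m : (m <= N)%N -> dyroot N ^+ (2 ^ (N - m)) = dyroot m.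
Proof.
move=> mN; rewrite -{1}(subnK mN); elim: (N - m)%N => [|k IHk]; first by [].
by rewrite expnS exprM addSn dyroot_sqr.
Qed.

Lemma Re_sqrtc_ge0 (z : C) : 0 <= complex.Re (sqrtc z).
Proof. by case: z => a b; rewrite /sqrtc /= sqrtr_ge0. Qed.

Lemma Re_dyroot_ge0 N : 0 <= complex.Re (dyroot N.+2).
Proof.
by case: N => [|N]; [|exact: Re_sqrtc_ge0].
Qed.

Lemma dyroot_step N :
  cabs (dyroot N.+1 - 1) * cabs (dyroot N.+1 + 1) = cabs (dyroot N - 1).
Proof. by rewrite -cabsM -(dyroot_sqr N) -subr_sqr_1. Qed.

(** With z the new vertex, 2 |z - 1| / |z + 1| is at most |z^2 - 1| / |z^2 + 1|
    because |z + 1|^2 = 2 + 2 Re z, |z^2 + 1| = 2 Re z and Re z <= 1: this is the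
    monotonic decrease of 2^N tan (pi / 2^N). *)
Lemma dyroot_side_le N : 2 ^+ N * cabs (dyroot N - 1) <= 8.
Proof.
have sqD (z : C) : cabs z = 1 -> cabs (z + 1) ^+ 2 = 2 + 2 * complex.Re z.
  move=> z1; have := sqr_cabs z; rewrite z1 expr1n sqr_cabs.
  by case: z z1 => a b _ /=; rewrite addr0; nra.
have half_tan k : 2 ^+ k.+2 * cabs (dyroot k.+2 - 1) <=
    4 * cabs (dyroot k.+2 + 1).
  elim: k => [|k IHk].
    have -> : cabs (dyroot 2 - 1) = cabs (dyroot 2 + 1).
      apply/eqP; rewrite -(@eqrXn2 _ 2) ?cabs_ge0 // !sqr_cabs /=.
      by apply/eqP; ring.
    by rewrite -natrX.
  set z := dyroot k.+3 in IHk *.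
  have z1 : cabs z = 1 by exact: cabs_dyroot.
  have Rez : 0 <= complex.Re z by exact: Re_dyroot_ge0.
  have Rez1 : complex.Re z <= 1.
    by have := le_Re_cabs z; rewrite z1 ler_norml => /andP[].
  have zp : 0 < cabs (z + 1).
    have : 0 < cabs (z + 1) ^+ 2 by rewrite sqD //; lra.
    by rewrite exprn_even_gt0 //= => h; rewrite lt_def h cabs_ge0.
  have z2 : cabs (z ^+ 2 + 1) = 2 * complex.Re z.
    apply/eqP; rewrite -(@eqrXn2 _ 2) ?cabs_ge0 ?mulr_ge0 // sqD ?cabsX ?z1 ?expr1n //.
    have := sqr_cabs z; rewrite z1 expr1n; clear.
    by case: (z) => a b /= ab; apply/eqP; rewrite expr2 /=; nra.
  have step : cabs (z - 1) * cabs (z + 1) = cabs (dyroot k.+2 - 1).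
    exact: dyroot_step.
  move: IHk; rewrite -step -(dyroot_sqr k.+2) -/z z2 => IHk.
  rewrite -(ler_pM2r zp); have := sqD z z1; rewrite expr2 => sqz.
  have -> : 2 * 2 ^+ k.+2 * cabs (z - 1) * cabs (z + 1) =
    2 * (2 ^+ k.+2 * (cabs (z - 1) * cabs (z + 1))) by ring.
  by rewrite -(mulrA 4); lra.
case: N => [|[|N]].
- by rewrite subrr cabs0 mulr0.
- by rewrite expr1; have := cabsB (dyroot 1) 1; rewrite cabs_dyroot cabs1; lra.
apply: le_trans (half_tan N) _.
by have := cabsD (dyroot N.+2) 1; rewrite cabs_dyroot cabs1; lra.
Qed.

(** The new side |z - 1| is at least half of |z^2 - 1|, since |z + 1| <= 2. *)
Lemma dyroot_side_ge N : 4 <= 2 ^+ N.+1 * cabs (dyroot N.+1 - 1).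
Proof.
elim: N => [|N IHN].
  have -> : dyroot 1 - 1 = - (2%:R : C) by rewrite /= -[2%:R]/(1 + 1) opprD.
  rewrite cabsN expr1 (_ : (2%:R : C) = (2%:R : R)%:C); last first.
    by rewrite rmorph_nat.
  by rewrite cabs_real ger0_norm //; lra.
have := dyroot_step N.+1; set z := dyroot N.+2 => step.
have : cabs (z + 1) <= 2.
  by have := cabsD z 1; rewrite cabs_dyroot cabs1; lra.
move: IHN; rewrite -step [2 ^+ N.+2]exprS => IHN z2; apply: le_trans IHN _.
have : cabs (z - 1) * cabs (z + 1) <= cabs (z - 1) * 2.
  by rewrite ler_wpM2l ?cabs_ge0.
have : (0 : R) < 2 ^+ N.+1 by rewrite exprn_gt0.
by move=> p /(ler_wpM2l (ltW p)); lra.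
Qed.

(** The radial mesh is refined like the angular one, so that a sector of one
    level splits into four sectors of the next. *)
Definition ratroot (Q : R) (N : nat) : R := iter N Num.sqrt Q.

Lemma ratroot_ge1 Q N : 1 <= Q -> 1 <= ratroot Q N.
Proof.
move=> Q1; elim: N => [|N IHN]; first by [].
by rewrite /ratroot iterS -[leLHS]sqrtr1 ler_wsqrtr.
Qed.

Lemma ratroot_sqr Q N : 1 <= Q -> ratroot Q N.+1 ^+ 2 = ratroot Q N.
Proof.
by move=> Q1; rewrite /= sqr_sqrtr // (le_trans ler01) // ratroot_ge1.
Qed.

Lemma ratroot_pow Q N m : 1 <= Q -> (m <= N)%N ->
  ratroot Q N ^+ (2 ^ (N - m)) = ratroot Q m.
Proof.
move=> Q1 mN; rewrite -{1}(subnK mN); elim: (N - m)%N => [|k IHk]; first by [].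
by rewrite expnS exprM addSn ratroot_sqr.
Qed.

Lemma ratroot_side_le Q N : 1 <= Q -> 2 ^+ N * (ratroot Q N - 1) <= Q - 1.
Proof.
move=> Q1; elim: N => [|N IHN]; first by rewrite mul1r.
apply: le_trans IHN; rewrite exprS -(ratroot_sqr N Q1).
have := ratroot_ge1 N.+1 Q1; set x := ratroot _ _ => x1.
have : (0 : R) < 2 ^+ N by rewrite exprn_gt0.
move=> p; rewrite [2 * _]mulrC -mulrA ler_pM2l // expr2; nra.
Qed.

Lemma cabs_pow_sub1 (w : C) (j : nat) :
  cabs w = 1 -> cabs (w ^+ j - 1) <= j%:R * cabs (w - 1).
Proof.
move=> w1; elim: j => [|j IHj]; first by rewrite expr0 subrr cabs0 mul0r.
have -> : w ^+ j.+1 - 1 = w ^+ j * (w - 1) + (w ^+ j - 1) by rewrite exprSr; ring.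
apply: le_trans (cabsD _ _) _; rewrite cabsM cabsX w1 expr1n mul1r.
by rewrite -natr1 mulrDl mul1r addrC lerD2r.
Qed.

Lemma derivable_linear (f : C -> C) z : derivable f z 1 ->
  exists d : C, forall e : R, 0 < e -> exists2 r : R, 0 < r &
    forall x, cabs (x - z) < r ->
      cabs (f x - f z - d * (x - z)) <= e * cabs (x - z).
Proof.
move=> /derivable_cvgE[d /cvgC fd]; exists d => e /fd /dnbhsC[r r0 rP].
exists r => // x xr; have [->|xz] := eqVneq x z.
  by rewrite !subrr mulr0 subrr cabs0 mulr0.
have xz0 : x - z != 0 by rewrite subr_eq0.
have -> : f x - f z - d * (x - z) = ((f x - f z) / (x - z) - d) * (x - z).
  by rewrite mulrBl divfK.
by rewrite cabsM ler_wpM2r ?cabs_ge0 // ltW // rP.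
Qed.

End PolarGrid.

Lemma pow2_unbounded (R : archiRealFieldType) (x : R) : exists m, x < 2 ^+ m.
Proof.
exists (Num.bound x); apply: le_lt_trans (ler_norm x) _.
apply: lt_le_trans (archi_boundP (normr_ge0 x)) _.
have -> : Num.bound `|x| = Num.bound x by rewrite /Num.bound normr_id.
by rewrite -natrX ler_nat ltnW // ltn_expl.
Qed.

Section Goursat.
Context {R : realType}.
Local Notation C := (R[i]^o).
Variables (f : C -> C) (r1 Q : R).
Hypothesis r1_gt0 : 0 < r1.
Hypothesis Q_ge1 : 1 <= Q.
Hypothesis f_der : forall z : C, r1 <= cabs z -> cabs z <= r1 * Q ->
  derivable f z 1.

Local Notation qq N := ((ratroot Q N)%:C : C).
Local Notation ww N := (dyroot N : C).
Local Notation gsum m N c := (grid_sum f c (qq N) (ww N) (2 ^ (N - m))).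

(** the size of the sector of level m, up to 2 ^- m *)
Let K := r1 * Q * (Q + 7).

(** A sector of level m with corner c whose discrete integrals stay above the
    share eta / 4 ^ m of eta for arbitrarily fine meshes N. *)
Definition bad_sector (eta : R) (m : nat) (c : C) : Prop :=
  [/\ r1 <= cabs c, cabs c * ratroot Q m <= r1 * Q &
      forall N0, exists N, [/\ (N0 <= N)%N, (m <= N)%N &
        eta / 4 ^+ m < cabs (gsum m N c)]].

(** Both meshes have total length of order 2 ^- m in a sector of level m. *)
Lemma sector_diam m N (c : C) (i j : nat) : (m <= N)%N ->
  r1 <= cabs c -> cabs c * ratroot Q m <= r1 * Q ->
  (i <= 2 ^ (N - m))%N -> (j <= 2 ^ (N - m))%N ->
  cabs (c * qq N ^+ i * ww N ^+ j - c) <= K / 2 ^+ m.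
Proof.
move=> mN c1 c2 im jm; have q1 := ratroot_ge1 m Q_ge1.
have qN1 := ratroot_ge1 N Q_ge1.
have cQ : cabs c <= r1 * Q.
  by apply: le_trans c2; rewrite ler_peMr ?cabs_ge0.
have qi1 : 1 <= ratroot Q N ^+ i by rewrite exprn_ege1.
have qi : ratroot Q N ^+ i <= ratroot Q m.
  by rewrite -(ratroot_pow Q_ge1 mN) ler_weXn2l.
have p2 : (0 : R) < 2 ^+ m by rewrite exprn_gt0.
have wj : cabs (ww N ^+ j - 1) <= 8 / 2 ^+ m.
  apply: le_trans (cabs_pow_sub1 _ (cabs_dyroot N)) _.
  rewrite ler_pdivlMr // mulrAC; apply: le_trans (dyroot_side_le N).
  rewrite ler_wpM2r ?cabs_ge0 // -natrX -natrM -natrX ler_nat.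
  by apply: leq_trans (leq_mul jm (leqnn _)) _; rewrite -expnD subnK.
have qm : ratroot Q m - 1 <= (Q - 1) / 2 ^+ m.
  by rewrite ler_pdivlMr // mulrC ratroot_side_le.
have -> : c * qq N ^+ i * ww N ^+ j - c =
    c * qq N ^+ i * (ww N ^+ j - 1) + c * (qq N ^+ i - 1) by ring.
apply: le_trans (cabsD _ _) _.
rewrite !cabsM -(rmorphXn (real_complex R)) /= -(rmorph1 (real_complex R)).
rewrite -(rmorphB (real_complex R)) /= !cabs_real !ger0_norm ?subr_ge0 //; last first.
  exact: le_trans qi1.
have t1 : cabs c * ratroot Q N ^+ i * cabs (ww N ^+ j - (1 : R)%:C) <=
    r1 * Q * (8 / 2 ^+ m).
  rewrite rmorph1; apply: ler_pM => //; rewrite ?cabs_ge0 //.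
    by rewrite mulr_ge0 ?cabs_ge0 // (le_trans _ qi1).
  by apply: le_trans c2; rewrite ler_wpM2l ?cabs_ge0.
have t2 : cabs c * (ratroot Q N ^+ i - 1) <= r1 * Q * ((Q - 1) / 2 ^+ m).
  apply: ler_pM => //; rewrite ?cabs_ge0 ?subr_ge0 //.
  by apply: le_trans qm; rewrite lerD2r.
rewrite /K; apply: le_trans (lerD t1 t2) _.
by rewrite -mulrDr -mulrDl mulrA (_ : 8 + (Q - 1) = Q + 7) //; ring.
Qed.

(** If the four quarters were all good for fine meshes, [grid_sum_split] would
    make the sector good. *)
Lemma bad_sector_step eta m c : bad_sector eta m c ->
  exists c', bad_sector eta m.+1 c' /\ cabs (c' - c) <= K / 2 ^+ m.
Proof.
move=> [c1 c2 cbad].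
have qm1 := ratroot_ge1 m.+1 Q_ge1.
have p2 : (0 : R) < 2 ^+ m by rewrite exprn_gt0.
pose child (i j : bool) : C := c * qq m.+1 ^+ i * ww m.+1 ^+ j.
have childP i j : r1 <= cabs (child i j) /\
    cabs (child i j) * ratroot Q m.+1 <= r1 * Q.
  rewrite /child !cabsM !cabsX cabs_dyroot expr1n mulr1 cabs_real.
  rewrite ger0_norm ?(le_trans ler01) //; split.
    by apply: le_trans c1 _; rewrite ler_peMr ?cabs_ge0 // exprn_ege1.
  apply: le_trans c2; rewrite -mulrA ler_wpM2l ?cabs_ge0 //.
  rewrite -(ratroot_sqr m Q_ge1) expr2 ler_wpM2r //.
    exact: le_trans qm1.
  by case: i; rewrite ?expr1 ?expr0.
have childd i j : cabs (child i j - c) <= K / 2 ^+ m.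
  have := @sector_diam m m.+1 c i j (leqnSn m) c1 c2.
  by rewrite subSnn; apply; [case: i|case: j].
suff [i [j cb]] : exists i j, forall N0, exists N,
    [/\ (N0 <= N)%N, (m.+1 <= N)%N &
        eta / 4 ^+ m.+1 < cabs (gsum m.+1 N (child i j))].
  by exists (child i j); split=> //; have [? ?] := childP i j; split.
apply: contrapT => no.
have {}no i j : exists N0, forall N, (N0 <= N)%N -> (m.+1 <= N)%N ->
    cabs (gsum m.+1 N (child i j)) <= eta / 4 ^+ m.+1.
  apply: contrapT => h; apply: no; exists i, j => N0.
  apply: contrapT => h'; apply: h; exists N0 => N NN0 mN.
  by rewrite leNgt; apply/negP => lt; apply: h'; exists N.
have [N00 P00] := no false false; have [N01 P01] := no false true.
have [N10 P10] := no true false; have [N11 P11] := no true true.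
have [N [NN]] := cbad (maxn m.+1 (maxn (maxn N00 N01) (maxn N10 N11))).
move: NN; rewrite !geq_max => /and3P[mN /andP[l00 l01] /andP[l10 l11]] mN'.
have {P00}P00 := P00 N l00 mN; have {P01}P01 := P01 N l01 mN.
have {P10}P10 := P10 N l10 mN; have {P11}P11 := P11 N l11 mN.
have -> : (2 ^ (N - m) = 2 ^ (N - m.+1) + 2 ^ (N - m.+1))%N.
  by rewrite addnn -mul2n -expnS -subSn.
rewrite grid_sum_split -(rmorphXn (real_complex R)) /= ratroot_pow //.
rewrite dyroot_pow //.
move: P00 P01 P10 P11; rewrite /child !expr0 !expr1 !mulr1 => P00 P01 P10 P11.
apply/negP; rewrite -leNgt.
apply: le_trans (cabsD _ _) _.
apply: le_trans (lerD (cabsD _ _) (cabsD _ _)) _.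
apply: le_trans (lerD (lerD P00 P10) (lerD P01 P11)) _.
rewrite exprS invfM mulrCA [leRHS](_ : _ = 4^-1 * (eta / 4 ^+ m) +
  4^-1 * (eta / 4 ^+ m) + (4^-1 * (eta / 4 ^+ m) + 4^-1 * (eta / 4 ^+ m))) //.
by move: (eta / _) => t; field.
Qed.

(** Goursat's argument: nested bad sectors shrink to a point z; near z the
    function is affine up to o(|x - z|), so the discrete integral of a sector
    of level m is o(4 ^- m), against badness. *)
Lemma no_bad_sector (eta : R) (c : C) : 0 < eta -> ~ bad_sector eta 0 c.
Proof.
move=> eta0 bad0.
have Q0 : 0 <= Q by exact: le_trans Q_ge1.
have Kge0 : 0 <= K by rewrite /K !mulr_ge0 ?addr_ge0 // ltW.
have [g gP] : exists g : nat * C -> C, forall m c, bad_sector eta m c ->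
    bad_sector eta m.+1 (g (m, c)) /\ cabs (g (m, c) - c) <= K / 2 ^+ m.
  have /choice[g gP] : forall p : nat * C, exists c' : C,
      bad_sector eta p.1 p.2 ->
      bad_sector eta p.1.+1 c' /\ cabs (c' - p.2) <= K / 2 ^+ p.1.
    move=> [m d] /=; have [bad|nbad] := pselect (bad_sector eta m d).
      by have [c' h] := bad_sector_step bad; exists c'.
    by exists 0 => /nbad.
  by exists g => m d /(gP (m, d)).
pose u := fix u m : C := if m is k.+1 then g (k, u k) else c.
have ubad m : bad_sector eta m (u m).
  by elim: m => [|m IHm] //=; have [] := gP _ _ IHm.
have ustep m : cabs (u m.+1 - u m) <= K / 2 ^+ m.
  by have [] := gP _ _ (ubad m).
have ufar m k : cabs (u (m + k)%N - u m) <= 2 * K / 2 ^+ m - 2 * K / 2 ^+ (m + k).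
  elim: k => [|k IHk]; first by rewrite addn0 !subrr cabs0.
  have := cabs_tri (u (m + k.+1)%N) (u (m + k)%N) (u m); rewrite addnS.
  have := ustep (m + k)%N; rewrite exprS invfM.
  have : (0 : R) < 2 ^+ (m + k) by rewrite exprn_gt0.
  by move=> p; lra.
have [m|z zP] := @bounded_seq_cluster R u (r1 * Q).
  have [_ h _] := ubad m; apply: le_trans h.
  by rewrite ler_peMr ?cabs_ge0 ?ratroot_ge1.
have uz m : cabs (u m - z) <= 2 * K / 2 ^+ m.
  apply/ler_addgt0Pl => /= e e0; have [m' mm' m'z] := zP e e0 m.
  have := ufar m (m' - m)%N; rewrite subnKC // => h.
  have := cabs_tri (u m) (u m') z; rewrite (cabs_distC (u m) (u m')).
  have : 0 <= 2 * K / 2 ^+ m'.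
    by apply: divr_ge0; [apply: mulr_ge0|apply: exprn_ge0].
  by lra.
have z1 : r1 <= cabs z.
  apply/ler_addgt0Pl => /= e e0; have [m _ mz] := zP e e0 0%N.
  by have [h _ _] := ubad m; have := cabs_lb (u m) z; lra.
have z2 : cabs z <= r1 * Q.
  apply/ler_addgt0Pl => /= e e0; have [m _ mz] := zP e e0 0%N.
  have [_ h _] := ubad m; have := cabs_lb z (u m); rewrite cabs_distC.
  have : cabs (u m) <= cabs (u m) * ratroot Q m.
    by rewrite ler_peMr ?cabs_ge0 ?ratroot_ge1.
  by lra.
have [d dP] := derivable_linear (f_der z1 z2).
pose L := 6 * K * (Q + 7) + 1.
have L0 : 0 < L.
  apply: ltr_wpDl => //; apply: mulr_ge0; last exact: addr_ge0.
  exact: mulr_ge0.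
have [r r0 rP] := dP _ (divr_gt0 eta0 L0).
have [m mr] : exists m, 3 * K / 2 ^+ m < r.
  have [m hm] := pow2_unbounded (3 * K / r).
  by exists m; rewrite ltr_pdivrMr ?exprn_gt0 // [r * _]mulrC -ltr_pdivrMr.
have [b1 b2 b3] := ubad m; have [N [_ mN]] := b3 0%N.
apply/negP; rewrite -leNgt.
have p2 : (0 : R) < 2 ^+ m by rewrite exprn_gt0.
have near_z i j : (i <= 2 ^ (N - m))%N -> (j <= 2 ^ (N - m))%N ->
    cabs (u m * qq N ^+ i * ww N ^+ j - z) <= 3 * K / 2 ^+ m.
  move=> im jm; have := sector_diam mN b1 b2 im jm.
  have := cabs_tri (u m * qq N ^+ i * ww N ^+ j) (u m) z.
  by have := uz m; lra.
have aff i j : (i <= 2 ^ (N - m))%N -> (j <= 2 ^ (N - m))%N ->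
    cabs (f (u m * qq N ^+ i * ww N ^+ j) -
      ((f z - d * z) + d * (u m * qq N ^+ i * ww N ^+ j))) <=
    eta / L * (3 * K / 2 ^+ m).
  move=> im jm; set x := _ * ww N ^+ j.
  have -> : f x - (f z - d * z + d * x) = f x - f z - d * (x - z) by ring.
  have xz : cabs (x - z) <= 3 * K / 2 ^+ m := near_z i j im jm.
  apply: le_trans (rP x (le_lt_trans xz mr)) _.
  by rewrite ler_wpM2l // ltW // divr_gt0.
apply: le_trans (grid_sum_bound aff) _.
have sides : (2 ^ (N - m))%:R * (cabs (qq N - 1) + cabs (ww N - 1)) <=
    (Q + 7) / 2 ^+ m.
  rewrite ler_pdivlMr // mulrAC -natrX -natrM -expnD subnK // natrX mulrDr.
  have -> : qq N - 1 = (ratroot Q N - 1)%:C by rewrite rmorphB rmorph1.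
  rewrite cabs_real ger0_norm ?subr_ge0 ?ratroot_ge1 //.
  have -> : Q + 7 = (Q - 1) + 8 by ring.
  by apply: lerD; [exact: ratroot_side_le|exact: dyroot_side_le].
apply: le_trans (ler_wpM2l _ sides) _.
  have eL : 0 <= eta / L by rewrite ltW // divr_gt0.
  have K2 : 0 <= 3 * K / 2 ^+ m.
    by apply: divr_ge0; [apply: mulr_ge0|exact: ltW].
  by apply: mulr_ge0 => //; apply: mulr_ge0.
have -> : (4 : R) ^+ m = 2 ^+ m * 2 ^+ m.
  by rewrite -exprMn -natrM.
rewrite invfM.
have -> : 2 * (eta / L * (3 * K / 2 ^+ m)) * ((Q + 7) / 2 ^+ m) =
  eta * (6 * K * (Q + 7) / L) * (2 ^- m * 2 ^- m) by ring.
rewrite ler_wpM2r ?mulr_ge0 ?invr_ge0 ?exprn_ge0 //.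
by rewrite ler_piMr ?(ltW eta0) // ler_pdivrMr // mul1r /L lerDl.
Qed.

Definition circle_mean (g : C -> C) (r : R) (N : nat) : C :=
  (\sum_(j < 2 ^ N) g (r%:C * ww N ^+ j)) / (2 ^ N)%:R.

(** The sector of level 0 is the whole annulus cut along the positive half
    axis: its radial sides cancel, and the circular ones give the difference
    of the means. The division by the weight w - 1 is harmless because the
    side of the polygon is at least 4 / 2 ^ N. *)
Lemma circle_mean_const (eta : R) : 0 < eta -> exists N0, forall N,
  (N0 <= N)%N -> cabs (circle_mean f (r1 * Q) N - circle_mean f r1 N) <= eta.
Proof.
move=> eta0.
have : ~ bad_sector eta 0 r1%:C by exact: no_bad_sector.
move=> nbad; apply: contrapT => no; apply: nbad; split.
- by rewrite cabs_real ger0_norm // ltW.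
- by rewrite cabs_real ger0_norm // ltW.
move=> N0; apply: contrapT => no'; apply: no; exists N0.+1 => N NN0.
rewrite leNgt; apply/negP => lt; apply: no'; exists N; split=> //.
  exact: ltnW.
rewrite expr0 divr1; apply: lt_le_trans lt _.
have pw : qq N ^+ (2 ^ N) = Q%:C.
  by rewrite -(rmorphXn (real_complex R)) /= -{2}(subn0 N) ratroot_pow.
have ww1 : ww N ^+ (2 ^ N) = 1 by rewrite -{2}(subn0 N) dyroot_pow.
rewrite /grid_sum subn0 pw ww1.
rewrite big1 ?add0r => [|i _]; last by rewrite mulr1 subrr mulr0.
rewrite -mulr_sumr sumrB /circle_mean -mulrBl (rmorphM (real_complex R)) /=.
rewrite !cabsM cabsV [leRHS]mulrC ler_wpM2l ?cabs_ge0 //.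
have -> : ((2 ^ N)%:R : C) = ((2 ^ N)%:R : R)%:C by rewrite rmorph_nat.
rewrite cabs_real ger0_norm ?ler0n // natrX -[leLHS]mul1r.
rewrite ler_pdivrMr ?exprn_gt0 //.
case: N NN0 {pw ww1} lt => // N _ _.
by rewrite mulrC; apply: le_trans (dyroot_side_ge N); lra.
Qed.

End Goursat.

Section CauchyTheory.
Context {R : realType}.
Local Notation C := (R[i]^o).
Implicit Types (f g h : C -> C) (r rho eta : R) (z w : C).

Lemma circle_point r N j : 0 <= r ->
  cabs (r%:C * (dyroot N : C) ^+ j : C) = r.
Proof.
by move=> r0; rewrite cabsM cabsX cabs_dyroot expr1n mulr1 cabs_real ger0_norm.
Qed.

Lemma circle_mean_ext f g r N : 0 <= r ->
  (forall z, cabs z = r -> f z = g z) -> circle_mean f r N = circle_mean g r N.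
Proof.
move=> r0 fg; congr (_ / _); apply: eq_bigr => j _; apply: fg.
exact: circle_point.
Qed.

Lemma circle_meanD f g r N :
  circle_mean (fun z => f z + g z) r N = circle_mean f r N + circle_mean g r N.
Proof. by rewrite /circle_mean big_split mulrDl. Qed.

Lemma circle_meanB f g r N :
  circle_mean (fun z => f z - g z) r N = circle_mean f r N - circle_mean g r N.
Proof. by rewrite /circle_mean sumrB mulrBl. Qed.

Lemma circle_meanZ (c : C) f r N :
  circle_mean (fun z => c * f z) r N = c * circle_mean f r N.
Proof. by rewrite /circle_mean -mulr_sumr mulrA. Qed.

Lemma circle_mean_cst (c : C) r N : circle_mean (fun=> c) r N = c.
Proof.
have p : ((2 ^ N)%:R : C) != 0 by rewrite pnatr_eq0 -lt0n expn_gt0.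
rewrite /circle_mean (_ : \sum_(_ < _) _ = c * (2 ^ N)%:R) ?mulfK //.
by rewrite sumr_const card_ord mulr_natr.
Qed.

Lemma circle_mean_bound f r N (M : R) : 0 <= r ->
  (forall z, cabs z = r -> cabs (f z) <= M) -> cabs (circle_mean f r N) <= M.
Proof.
move=> r0 fM; rewrite /circle_mean cabsM cabsV.
have -> : ((2 ^ N)%:R : C) = ((2 ^ N)%:R : R)%:C by rewrite rmorph_nat.
have p : (0 : R) < (2 ^ N)%:R by rewrite ltr0n expn_gt0.
rewrite cabs_real gtr0_norm // ler_pdivrMr //.
apply: le_trans (cabs_sum _ _ _) _.
have -> : M * (2 ^ N)%:R = \sum_(j < 2 ^ N) M.
  by rewrite sumr_const card_ord mulr_natr.
by apply: ler_sum => j _; apply: fM; exact: circle_point.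
Qed.

(** The hypotheses of Riemann's theorem on removable singularities. *)
Definition disk_fun rho f : Prop :=
  (forall z, cabs z < rho -> f @ z --> f z) /\
  (forall z, z != 0 -> cabs z < rho -> derivable f z 1).

(** Shrink the circle: the means over the circles of radii r and r1 are close by
    [circle_mean_const], and that over the small one is close to f 0 by
    continuity. *)
Lemma mean_value_center rho f r eta : disk_fun rho f -> 0 < r < rho ->
  0 < eta -> exists N0, forall N, (N0 <= N)%N ->
    cabs (circle_mean f r N - f 0) <= eta.
Proof.
move=> [fc fd] /andP[r0 rrho] eta0.
have eta2 : 0 < eta / 2 by rewrite divr_gt0.
have rho0 : cabs (0 : C) < rho by rewrite cabs0; lra.
have /cvgC/(_ _ eta2)/nbhsC[d d0 dP] := fc 0 rho0.
pose r1 := Num.min d r / 2.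
have mdr : 0 < Num.min d r by rewrite lt_min d0.
have r1_0 : 0 < r1 by rewrite divr_gt0.
have r1d : r1 < d.
  have : Num.min d r <= d by rewrite ge_min lexx.
  by rewrite /r1; lra.
have r1r : r1 < r.
  have : Num.min d r <= r by rewrite ge_min lexx orbT.
  by rewrite /r1; lra.
have Q1 : 1 <= r / r1 by rewrite ler_pdivlMr // mul1r ltW.
have rE : r1 * (r / r1) = r by rewrite mulrC divfK // gt_eqF.
have fder z : r1 <= cabs z -> cabs z <= r1 * (r / r1) -> derivable f z 1.
  rewrite rE => z1 z2; apply: fd; last exact: le_lt_trans rrho.
  by rewrite -cabs_gt0; lra.
have [N0 N0P] := circle_mean_const r1_0 Q1 fder eta2.
exists N0 => N NN0; have := N0P N NN0; rewrite rE => h.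
have : cabs (circle_mean f r1 N - f 0) <= eta / 2.
  have -> : f 0 = circle_mean (fun=> f 0) r1 N by rewrite circle_mean_cst.
  rewrite -mulN1r -circle_meanZ -circle_meanD.
  apply: circle_mean_bound => [|z zr]; first exact: ltW.
  by rewrite mulN1r ltW // dP // subr0 zr.
by have := cabs_tri (circle_mean f r N) (circle_mean f r1 N) (f 0); lra.
Qed.

Lemma neq_cabs z w : cabs z != cabs w -> z != w.
Proof. by apply: contra_neq => ->. Qed.

Lemma derivable_subC w z : derivable (fun x : C => x - w) z 1.
Proof. by apply: derivableCB; [exact: derivableCid|exact: derivableCc]. Qed.

Lemma derivable_invsub w z : z != w -> derivable (fun x : C => (x - w)^-1) z 1.
Proof.
move=> zw; by apply: derivableCV; [rewrite subr_eq0|exact: derivable_subC].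
Qed.

(** Enlarge the circle instead: the kernel z / (z - w) tends to 1 at infinity. *)
Lemma mean_kernel w r eta : cabs w < r -> 0 < eta ->
  exists N0, forall N, (N0 <= N)%N ->
    cabs (circle_mean (fun z : C => z / (z - w)) r N - 1) <= eta.
Proof.
move=> wr eta0; have w0 := cabs_ge0 w.
have r0 : 0 < r by exact: le_lt_trans wr.
have eta2 : 0 < eta / 2 by rewrite divr_gt0.
pose r2 := r + cabs w + cabs w / (eta / 2).
have q0 : 0 <= cabs w / (eta / 2) by rewrite divr_ge0 // ltW.
have Q1 : 1 <= r2 / r by rewrite ler_pdivlMr // mul1r /r2; lra.
have rE : r * (r2 / r) = r2 by rewrite mulrC divfK // gt_eqF.
have kd z : r <= cabs z -> cabs z <= r * (r2 / r) ->
    derivable (fun z : C => z / (z - w)) z 1.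
  move=> z1 _; apply: derivableCM; first exact: derivableCid.
  by apply: derivable_invsub; apply: neq_cabs; rewrite gt_eqF //; lra.
have [N0 N0P] := circle_mean_const r0 Q1 kd eta2.
exists N0 => N NN0; have := N0P N NN0; rewrite rE => h.
have : cabs (circle_mean (fun z : C => z / (z - w)) r2 N - 1) <= eta / 2.
  rewrite -[X in cabs (_ - X)](circle_mean_cst 1 r2 N).
  rewrite -[- circle_mean _ _ _]mulN1r -circle_meanZ -circle_meanD.
  apply: circle_mean_bound => [|z zr]; first by rewrite /r2; lra.
  have zw : z - w != 0.
    by rewrite subr_eq0; apply: neq_cabs; rewrite zr gt_eqF // /r2; lra.
  have -> : z / (z - w) + -1 * 1 = w / (z - w).
    by rewrite mulr1 -[in X in _ + X](divff zw) -mulrBl subKr.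
  rewrite cabsM cabsV ler_pdivrMr ?cabs_gt0 //.
  have : cabs w / (eta / 2) <= cabs (z - w).
    by have := cabs_lb z w; rewrite zr /r2; lra.
  by rewrite ler_pdivrMr // mulrC.
set m1 := circle_mean _ r N in h *; set m2 := circle_mean _ r2 N in h *.
by have := cabs_tri m1 m2 1; rewrite (cabs_distC m1 m2); lra.
Qed.

Lemma radial_uniform f (s : R) eta : 0 < s -> 0 < eta ->
  (forall z, cabs z = s -> f @ z --> f z) ->
  exists2 d : R, 0 < d & forall z (t : R), cabs z = s -> `|t - 1| < d ->
    cabs (f (t%:C * z) - f z) < eta.
Proof.
move=> s0 eta0 fc; have eta2 : 0 < eta / 2 by rewrite divr_gt0.
have /compact_near_coveringP := @compact_cabs_eq R s;
move=> /(_ R (nbhs (1 : R))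
  (fun t z => cabs (f (t%:C * z) - f z) < eta) _) [].
  move=> z /= zs; have /cvgC/(_ _ eta2)/nbhsC[d d0 dP] := fc z zs.
  have d2 : 0 < d / 2 by rewrite divr_gt0.
  have ds : 0 < d / 2 / (s + d) by rewrite divr_gt0 // addr_gt0.
  exists ([set x | cabs (x - z) < d / 2], [set t | `|t - 1| < d / 2 / (s + d)]).
    split => /=; first exact: cabs_continuous_diff.
    by apply/nbhs_ballP; exists (d / 2 / (s + d)) => // t; rewrite /= distrC.
  move=> [x t] /= [xz tz].
  have xd : cabs x < s + d by have := cabs_lb x z; rewrite zs; lra.
  have txz : cabs (t%:C * x - z) < d.
    have -> : t%:C * x - z = (t - 1)%:C * x + (x - z).
      by rewrite rmorphB rmorph1; ring.
    apply: le_lt_trans (cabsD _ _) _; rewrite cabsM cabs_real.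
    have : `|t - 1| * cabs x <= d / 2.
      rewrite ltr_pdivlMr ?addr_gt0 // in tz; apply: le_trans (ltW tz).
      by rewrite ler_wpM2l // ltW.
    by lra.
  have h1 := dP _ txz; have h2 : cabs (f x - f z) < eta / 2 by apply: dP; lra.
  by have := cabs_tri (f (t%:C * x)) (f z) (f x); rewrite (cabs_distC (f z)); lra.
move=> d /= d0 dP; exists d => // z t zs td.
by apply: (dP t) => //=; rewrite distrC.
Qed.

(** The kernel of Cauchy's formula applied to f - f w; d is the derivative at w. *)
Definition diff_quot f w (d : C) z : C :=
  if z == w then d * w else (f z - f w) * (z / (z - w)).

Lemma diff_quot_disk f w (d : C) rho : w != 0 ->
  (fun x => (f x - f w) / (x - w)) @ w^' --> d -> disk_fun rho f ->
  (forall z, cabs z < rho -> diff_quot f w d @ z --> diff_quot f w d z) /\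
  (forall z, z != 0 -> z != w -> cabs z < rho ->
     derivable (diff_quot f w d) z 1).
Proof.
move=> w0 fw [fc fd].
have near_neq z : z != w -> \forall x \near z,
    (f x - f w) * (x / (x - w)) = diff_quot f w d x.
  move=> zw; have zw0 : 0 < cabs (z - w) by rewrite cabs_gt0 subr_eq0.
  have := cabs_continuous_diff z zw0; apply: filterS => x xz.
  rewrite /diff_quot; case: eqP => // xw.
  by move: xz; rewrite xw cabs_distC ltxx.
split=> [z zrho|z z0 zw zrho]; last first.
  apply: derivable_near_eq (near_neq z zw) _; apply: derivableCM.
    by apply: derivableCB; [exact: fd|exact: derivableCc].
  apply: derivableCM; first exact: derivableCid.
  exact: derivable_invsub.
have [->|zw] := eqVneq z w.
  have : (fun x => (f x - f w) / (x - w) * x) @ w^' --> d * w.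
    exact: (cvgCM fw (@cvg_dnbhs_id R w)).
  move=> /cvg_dnbhsC lim; apply/cvg_nbhsC => e /[dup] e0 /lim [r r0 rP].
  exists r => // x xr; rewrite /diff_quot eqxx.
  case: eqVneq => [|xw]; first by rewrite subrr cabs0.
  by have := rP x xw xr; rewrite mulrAC mulrA.
have -> : diff_quot f w d z = (f z - f w) * (z / (z - w)).
  by rewrite /diff_quot (negbTE zw).
apply: cvg_nbhs_eq (near_neq z zw) _.
have c1 : (fun x => f x - f w) @ z --> f z - f w.
  exact: (cvgCB (fc z zrho) (cvg_cst (f w))).
have c2 : (fun x => x * (x - w)^-1) @ z --> z * (z - w)^-1.
  have ci : (fun x : C => x) @ z --> z by exact: cvg_id.
  have cv : (fun x : C => (x - w)^-1) @ z --> (z - w)^-1.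
    exact: derivable_continuousC (derivable_invsub zw).
  exact: (cvgCM ci cv).
exact: (cvgCM c1 c2).
Qed.

(** The mean of [diff_quot] vanishes in the limit: its value at 0 is 0, so its
    means over the circles inside radius |w| are small, and so are those over
    the circles outside. Crossing the radius |w|, where the differentiability
    of [diff_quot] at w is not known, only takes the uniform continuity of [radial_uniform]. The
    remaining term is f w times the mean of the kernel. *)
Lemma cauchy_formula f rho r w eta : disk_fun rho f -> 0 < r < rho ->
  w != 0 -> cabs w < r -> 0 < eta -> exists N0, forall N, (N0 <= N)%N ->
    cabs (circle_mean (fun z => f z * (z / (z - w))) r N - f w) <= eta.
Proof.
move=> fD /andP[r0 rrho] w0 wr eta0.
have wrho : cabs w < rho by exact: lt_trans rrho.
have /derivable_cvgE[d fwd] := fD.2 w w0 wrho.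
have [kc kd] := diff_quot_disk w0 fwd fD.
set k := diff_quot f w d in kc kd.
have aw : 0 < cabs w by rewrite cabs_gt0.
have eta8 : 0 < eta / 8 by rewrite divr_gt0.
have [|dl dl0 dlP] := @radial_uniform k (cabs w) _ aw eta8.
  by move=> z zw; apply: kc; rewrite zw.
(* The circles of radii |w| (1 - s) and |w| (1 + s) are compared pointwise. *)
pose s := Num.min (Num.min dl 1) ((r - cabs w) / cabs w) / 2.
have m0 : 0 < Num.min (Num.min dl 1) ((r - cabs w) / cabs w).
  by rewrite !lt_min dl0 ltr01 /= divr_gt0 // subr_gt0.
have s0 : 0 < s by rewrite divr_gt0.
have s2 : s * 2 = Num.min (Num.min dl 1) ((r - cabs w) / cabs w).
  by rewrite divfK.
have sdl : s < dl.
  have : s * 2 <= dl by rewrite s2 !ge_min lexx.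
  by lra.
have s1 : s < 1.
  have : s * 2 <= 1 by rewrite s2 !ge_min lexx orbT.
  by lra.
have sr : cabs w * (1 + s) < r.
  have : s * 2 <= (r - cabs w) / cabs w by rewrite s2 ge_min lexx orbT.
  by rewrite ler_pdivlMr // => h; nra.
pose r1 := cabs w * (1 - s); pose r2 := cabs w * (1 + s).
have r1_0 : 0 < r1 by rewrite mulr_gt0 // subr_gt0.
have r1w : r1 < cabs w by rewrite /r1; nra.
have r2w : cabs w < r2 by rewrite /r2; nra.
have r2_0 : 0 < r2 by lra.
have Q1 : 1 <= r / r2 by rewrite ler_pdivlMr // mul1r ltW.
have rE : r2 * (r / r2) = r by rewrite mulrC divfK // gt_eqF.
have kder z : r2 <= cabs z -> cabs z <= r2 * (r / r2) -> derivable k z 1.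
  rewrite rE => z1 z2; apply: kd; last exact: le_lt_trans rrho.
    by rewrite -cabs_gt0; lra.
  by apply: neq_cabs; rewrite gt_eqF //; lra.
have [N1 N1P] := circle_mean_const r2_0 Q1 kder eta8.
have kD : disk_fun (cabs w) k.
  split=> [z zw|z z0 zw]; first by apply: kc; exact: lt_trans wrho.
  apply: kd => //; last exact: lt_trans wrho.
  by apply: neq_cabs; rewrite lt_eqF.
have [|N2 N2P] := @mean_value_center _ _ r1 _ kD _ eta8; first by apply/andP.
have [|N3 N3P] := @mean_kernel w r (eta / (8 * (cabs (f w) + 1))) wr.
  by rewrite divr_gt0 // mulr_gt0 // ltr_wpDl // cabs_ge0.
exists (maxn N1 (maxn N2 N3)) => N; rewrite !geq_max => /and3P[NN1 NN2 NN3].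
have k0 : k 0 = 0.
  by rewrite /k /diff_quot eq_sym (negbTE w0) mul0r mulr0.
have h1 := N1P N NN1; have h2 := N2P N NN2; have h3 := N3P N NN3.
rewrite rE in h1; rewrite k0 subr0 in h2.
have h4 : cabs (circle_mean k r2 N - circle_mean k r1 N) <= eta / 4.
  rewrite /circle_mean -mulrBl -sumrB.
  pose g z := k ((1 + s)%:C * z) - k ((1 - s)%:C * z).
  have -> : \sum_(j < 2 ^ N) (k (r2%:C * (dyroot N : C) ^+ j) -
        k (r1%:C * (dyroot N : C) ^+ j)) =
      \sum_(j < 2 ^ N) g ((cabs w)%:C * (dyroot N : C) ^+ j).
    apply: eq_bigr => j _; rewrite /g /r1 /r2 !mulrA -!rmorphM /=.
    by rewrite (mulrC (1 + s)) (mulrC (1 - s)).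
  apply: (@circle_mean_bound g (cabs w) N) => [|z zw]; first exact: ltW.
  have t1 : cabs (k ((1 + s)%:C * z) - k z) < eta / 8.
    by apply: dlP => //; rewrite addrC addKr gtr0_norm.
  have t2 : cabs (k ((1 - s)%:C * z) - k z) < eta / 8.
    by apply: dlP => //; rewrite addrC addKr normrN gtr0_norm.
  rewrite /g; have := cabs_tri (k ((1 + s)%:C * z)) (k z) (k ((1 - s)%:C * z)).
  by rewrite (cabs_distC (k z)); lra.
have -> : circle_mean (fun z => f z * (z / (z - w))) r N =
    circle_mean k r N + f w * circle_mean (fun z : C => z / (z - w)) r N.
  rewrite -circle_meanZ -circle_meanD; apply: circle_mean_ext => [|z zr].
    exact: ltW.
  rewrite /k /diff_quot ifF; first by ring.
  by apply/negbTE/neq_cabs; rewrite zr gt_eqF.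
set m3 := circle_mean (fun z : C => z / (z - w)) r N in h3 *.
have -> : circle_mean k r N + f w * m3 - f w = circle_mean k r N + f w * (m3 - 1).
  by ring.
have h5 : cabs (f w * (m3 - 1)) <= eta / 8.
  rewrite cabsM; apply: le_trans (ler_wpM2l (cabs_ge0 _) h3) _.
  have a0 : 0 < cabs (f w) + 1 by rewrite ltr_wpDl // cabs_ge0.
  have -> : cabs (f w) * (eta / (8 * (cabs (f w) + 1))) =
      eta / 8 * (cabs (f w) / (cabs (f w) + 1)) by rewrite invfM; ring.
  rewrite ler_piMr ?(ltW eta8) // ler_pdivrMr // mul1r; lra.
have h6 := cabs_tri (circle_mean k r N) (circle_mean k r2 N) 0.
have h7 := cabs_tri (circle_mean k r2 N) (circle_mean k r1 N) 0.
rewrite !subr0 in h6 h7.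
have := cabsD (circle_mean k r N) (f w * (m3 - 1)).
by lra.
Qed.

End CauchyTheory.

Section FiniteOrder.
Context {R : realType}.
Local Notation C := (R[i]^o).
Implicit Types (f g h : C -> C) (r rho eta : R) (z w : C).

Lemma circle_bounded f r : 0 < r -> (forall z, cabs z = r -> f @ z --> f z) ->
  exists M : R, forall z, cabs z = r -> cabs (f z) <= M.
Proof.
move=> r0 fc.
have /compact_near_coveringP := @compact_cabs_eq R r;
move=> /(_ R (pinfty_nbhs R)
  (fun t z => cabs (f z) <= t) _) [].
  move=> z /= zr; have /cvg_nbhsC/(_ _ ltr01)[d d0 dP] := fc z zr.
  exists ([set x | cabs (x - z) < d], [set t | cabs (f z) + 1 < t]).
    split => /=; first exact: cabs_continuous_diff.
    by exists (cabs (f z) + 1); split=> //; rewrite num_real.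
  move=> [x t] /= [xz tz]; have := dP x xz; have := cabs_lb (f x) (f z); lra.
move=> M [_ MP]; exists (M + 1) => z zr; apply: (MP (M + 1)) => //.
by rewrite ltrDl.
Qed.

Lemma cauchy_bound f rho r w (M : R) : disk_fun rho f -> 0 < r < rho ->
  (forall z, cabs z = r -> cabs (f z) <= M) -> w != 0 -> cabs w <= r / 2 ->
  cabs (f w) <= 2 * M.
Proof.
move=> fD /andP[r0 rrho] fM w0 wr.
apply/ler_addgt0Pl => eta eta0.
have wr' : cabs w < r by lra.
have [|N0 N0P] := cauchy_formula fD _ w0 wr' eta0; first by rewrite r0.
have := N0P N0 (leqnn _); set m := circle_mean _ r N0 => h.
have mM : cabs m <= 2 * M.
  apply: circle_mean_bound => [|z zr]; first exact: ltW.
  have zw := cabs_lb z w; rewrite zr in zw.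
  have zw0 : 0 < cabs (z - w) by lra.
  rewrite !cabsM cabsV zr mulrC; apply: ler_pM; rewrite ?cabs_ge0 //.
  - by rewrite divr_ge0 ?cabs_ge0 // ltW.
  - by rewrite ler_pdivrMr //; lra.
  - exact: fM.
have := cabs_lb (f w) m; rewrite cabs_distC; lra.
Qed.

(** Cauchy's formula turns (f w - f 0) / w into the mean of f z / (z - w), which
    is Lipschitz in w near 0; hence the difference quotient is Cauchy at 0. *)
Lemma difference_quotient_cvg f rho : 0 < rho -> disk_fun rho f ->
  cvg ((fun z => (f z - f 0) / z) @ (0 : C)^').
Proof.
move=> rho0 fD; pose r := rho / 2.
have r0 : 0 < r by rewrite divr_gt0.
have rrho : 0 < r < rho by rewrite r0 /r; lra.
have [M MP] : exists M : R, forall z, cabs z = r -> cabs (f z) <= M.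
  by apply: circle_bounded => // z zr; apply: fD.1; rewrite zr; lra.
have M0 : 0 <= M.
  have := MP r%:C; rewrite cabs_real gtr0_norm // => /(_ erefl).
  exact/le_trans/cabs_ge0.
have lip w1 w2 : w1 != 0 -> w2 != 0 -> cabs w1 < r / 2 -> cabs w2 < r / 2 ->
    cabs ((f w1 - f 0) / w1 - (f w2 - f 0) / w2) <=
    4 * M / r ^+ 2 * cabs (w1 - w2).
  move=> w10 w20 w1r w2r.
  apply/ler_addgt0Pl => eta eta0.
  have a1 : 0 < cabs w1 by rewrite cabs_gt0.
  have a2 : 0 < cabs w2 by rewrite cabs_gt0.
  have e1 : 0 < eta * cabs w1 / 4 by rewrite divr_gt0 // mulr_gt0.
  have e2 : 0 < eta * cabs w2 / 4 by rewrite divr_gt0 // mulr_gt0.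
  have w1r' : cabs w1 < r by lra.
  have w2r' : cabs w2 < r by lra.
  have [N1 N1P] := cauchy_formula fD rrho w10 w1r' e1.
  have [N2 N2P] := cauchy_formula fD rrho w20 w2r' e2.
  have [N3 N3P] := mean_value_center fD rrho e1.
  have [N4 N4P] := mean_value_center fD rrho e2.
  pose N := maxn (maxn N1 N2) (maxn N3 N4).
  have h1 : (N1 <= N)%N by rewrite !leq_max leqnn.
  have h2 : (N2 <= N)%N by rewrite !leq_max leqnn orbT.
  have h3 : (N3 <= N)%N by rewrite !leq_max leqnn !orbT.
  have h4 : (N4 <= N)%N by rewrite !leq_max leqnn !orbT.
  pose q w := circle_mean (fun z => f z / (z - w)) r N.
  have qE w : w != 0 -> cabs w < r ->
      circle_mean (fun z => f z * (z / (z - w))) r N - circle_mean f r N =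
      w * q w.
    move=> w0 wr; rewrite /q -circle_meanZ -circle_meanB; apply: circle_mean_ext => [|z zr].
      exact: ltW.
    have zw : z - w != 0.
      by rewrite subr_eq0; apply: neq_cabs; rewrite zr gt_eqF.
    by field.
  have close w : w != 0 -> cabs w < r ->
      cabs (circle_mean (fun z => f z * (z / (z - w))) r N - f w) <=
        eta * cabs w / 4 ->
      cabs (circle_mean f r N - f 0) <= eta * cabs w / 4 ->
      cabs ((f w - f 0) / w - q w) <= eta / 2.
    move=> w0 wr c1 c2; have aw : 0 < cabs w by rewrite cabs_gt0.
    have -> : (f w - f 0) / w - q w = (f w - f 0 - w * q w) / w.
      by rewrite [in RHS]mulrBl [w * q w]mulrC mulfK.
    rewrite cabsM cabsV ler_pdivrMr // -qE //.
    move: c1 c2; set m1 := circle_mean _ _ _; set m2 := circle_mean f r N.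
    move=> c1 c2.
    have -> : f w - f 0 - (m1 - m2) = (f w - m1) + (m2 - f 0) by ring.
    by have := cabsD (f w - m1) (m2 - f 0); rewrite (cabs_distC (f w)); lra.
  have c1 := close w1 w10 w1r' (N1P N h1) (N3P N h3).
  have c2 := close w2 w20 w2r' (N2P N h2) (N4P N h4).
  have c3 : cabs (q w1 - q w2) <= 4 * M / r ^+ 2 * cabs (w1 - w2).
    rewrite /q -circle_meanB.
    apply: circle_mean_bound => [|z zr]; first exact: ltW.
    have z1 := cabs_lb z w1; have z2 := cabs_lb z w2; rewrite zr in z1 z2.
    have b1 : r / 2 <= cabs (z - w1) by lra.
    have b2 : r / 2 <= cabs (z - w2) by lra.
    have p1 : 0 < cabs (z - w1) by lra.
    have p2 : 0 < cabs (z - w2) by lra.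
    have n1 : z - w1 != 0 by rewrite -cabs_gt0.
    have n2 : z - w2 != 0 by rewrite -cabs_gt0.
    have -> : f z / (z - w1) - f z / (z - w2) =
        f z * (w1 - w2) / ((z - w1) * (z - w2)) by field; rewrite n1 n2.
    rewrite !cabsM cabsV cabsM ler_pdivrMr ?mulr_gt0 //.
    have fz := MP z zr.
    have -> : 4 * M / r ^+ 2 * cabs (w1 - w2) *
        (cabs (z - w1) * cabs (z - w2)) = M * cabs (w1 - w2) *
        ((4 / r ^+ 2) * (cabs (z - w1) * cabs (z - w2))) by ring.
    apply: (@le_trans _ _ (M * cabs (w1 - w2))).
      by rewrite ler_wpM2r ?cabs_ge0.
    apply: ler_peMr; first by rewrite mulr_ge0 ?cabs_ge0.
    rewrite mulrAC ler_pdivlMr ?exprn_gt0 // mul1r expr2.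
    have : r / 2 * (r / 2) <= cabs (z - w1) * cabs (z - w2).
      by apply: ler_pM => //; rewrite divr_ge0 // ltW.
    by lra.
  have t1 := cabs_tri ((f w1 - f 0) / w1) (q w1) ((f w2 - f 0) / w2).
  have t2 := cabs_tri (q w1) (q w2) ((f w2 - f 0) / w2).
  by move: t2 c2; rewrite (cabs_distC (q w2)); lra.
apply: cvg_dnbhs_cauchy => e e0.
pose L := 4 * M / r ^+ 2 * 2 + 1.
have L0 : 0 < L.
  rewrite /L ltr_wpDl //; apply: mulr_ge0 => //; apply: divr_ge0.
    exact: mulr_ge0.
  exact: exprn_ge0 (ltW r0).
exists (Num.min (r / 2) (e / L)).
  by rewrite lt_min !divr_gt0.
move=> x y x0 y0; rewrite !subr0 !lt_min => /andP[xr xe] /andP[yr ye].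
apply: le_lt_trans (lip x y x0 y0 xr yr) _.
have xy : cabs (x - y) <= 2 * (e / L) by have := cabsB x y; lra.
have K0 : 0 <= 4 * M / r ^+ 2.
  apply: divr_ge0; first exact: mulr_ge0.
  exact: exprn_ge0 (ltW r0).
apply: le_lt_trans (ler_wpM2l K0 xy) _.
have eL : 0 < e / L by rewrite divr_gt0.
have {2}-> : e = L * (e / L) by rewrite mulrC divfK // gt_eqF.
by rewrite [ltLHS]mulrA ltr_pM2r // /L ltrDl.
Qed.

(** Riemann's theorem in the form in which it can be iterated. *)
Lemma disk_fun_divX f rho : 0 < rho -> disk_fun rho f ->
  exists g, disk_fun rho g /\ forall z, f z = f 0 + z * g z.
Proof.
move=> rho0 fD; have /cvg_ex[/= l fl] := difference_quotient_cvg rho0 fD.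
pose g z := if z == 0 then l else (f z - f 0) / z.
have gE z : z != 0 -> \forall x \near z, (f x - f 0) / x = g x.
  move=> z0; apply/nbhsC; exists (cabs z); first by rewrite cabs_gt0.
  move=> x xz; rewrite /g; case: eqP => // x0.
  by move: xz; rewrite x0 sub0r cabsN ltxx.
have gder z : z != 0 -> cabs z < rho -> derivable g z 1.
  move=> z0 zr; apply: derivable_near_eq (gE z z0) _.
  apply: derivableCM; last exact: derivableCinv.
  by apply: derivableCB; [exact: fD.2|exact: derivableCc].
exists g; split; last first.
  move=> z; rewrite /g; case: eqP => [->|/eqP z0]; first by rewrite mul0r addr0.
  by rewrite mulrC divfK // addrC subrK.
split; last exact: gder.
move=> z zr; have [->|z0] := eqVneq z 0; last first.
  exact: derivable_continuousC (gder z z0 zr).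
rewrite {2}/g eqxx; move/cvg_dnbhsC: fl => fl; apply/cvg_nbhsC => e.
move=> /[dup] e0 /fl[d d0 dP]; exists d => // x xd; rewrite /g.
by case: eqP => [_|/eqP x0]; [rewrite subrr cabs0|exact: dP].
Qed.

(** Divide by z as long as the value at 0 vanishes. If this never stops, then
    Cauchy's bound for the n-th quotient gives |f w| <= 2 M (2 |w| / r)^n for
    all n, so that f vanishes near 0. *)
Lemma disk_fun_order f rho : 0 < rho -> disk_fun rho f ->
  (exists2 d : R, 0 < d & forall z, z != 0 -> cabs z < d -> f z = 0) \/
  exists n g, [/\ disk_fun rho g, g 0 != 0 & forall z, f z = z ^+ n * g z].
Proof.
move=> rho0 fD.
have [G GP] : exists G : (C -> C) -> C -> C, forall g, disk_fun rho g ->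
    disk_fun rho (G g) /\ forall z, g z = g 0 + z * G g z.
  have /choice[G GP] : forall g : C -> C, exists h : C -> C,
      disk_fun rho g -> disk_fun rho h /\ forall z, g z = g 0 + z * h z.
    move=> g; have [/(disk_fun_divX rho0)[h hP]|no] := pselect (disk_fun rho g).
      by exists h.
    by exists g.
  by exists G.
(* gg n is the n-th quotient of f by z, up to its values at 0. *)
pose gg n := iter n G f.
have ggD n : disk_fun rho (gg n).
  by elim: n => [//|n IHn]; have [] := GP _ IHn.
have ggS n z : gg n z = gg n 0 + z * gg n.+1 z by have [] := GP _ (ggD n).
have gg0 : gg 0%N = f by [].
clearbody gg; clear GP G.
have [[n gn0]|all0] := pselect (exists n, gg n 0 != 0).
  right; case: (ex_minnP (ex_intro (fun n => gg n 0 != 0) n gn0)) => m gm0 mmin.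
  exists m, (gg m); split; [exact: ggD|exact: gm0|move=> z].
  suff h k : (k <= m)%N -> f z = z ^+ k * gg k z by exact: h.
  elim: k => [_|k IHk km]; first by rewrite mul1r gg0.
  rewrite (IHk (ltnW km)) ggS (_ : gg k 0 = 0) ?add0r ?exprSr ?mulrA //.
  by apply: contraTeq km => /mmin; rewrite -leqNgt.
left; have {}all0 n : gg n 0 = 0.
  by apply: contrapT => /eqP h; apply: all0; exists n.
have fE n z : f z = z ^+ n * gg n z.
  elim: n => [|n IHn]; first by rewrite mul1r gg0.
  by rewrite IHn ggS all0 add0r exprSr mulrA.
pose r := rho / 2; have r0 : 0 < r by rewrite divr_gt0.
have rrho : 0 < r < rho by rewrite r0 /r; lra.
have [M MP] : exists M : R, forall z, cabs z = r -> cabs (f z) <= M.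
  by apply: circle_bounded => // z zr; apply: fD.1; rewrite zr; lra.
have M0 : 0 <= M.
  have := MP r%:C; rewrite cabs_real gtr0_norm // => /(_ erefl).
  exact/le_trans/cabs_ge0.
clearbody r; exists (r / 2) => [|w w0 wr]; first by rewrite divr_gt0.
have bound n : cabs (f w) * 2 ^+ n <= 2 * M.
  have gM z : cabs z = r -> cabs (gg n z) <= M / r ^+ n.
    move=> zr; rewrite ler_pdivlMr ?exprn_gt0 // -zr -cabsX -cabsM mulrC -fE.
    exact: MP.
  have := cauchy_bound (ggD n) rrho gM w0 (ltW wr).
  rewrite (fE n w) cabsM cabsX => h.
  have aw : 0 < cabs w by rewrite cabs_gt0.
  apply: (@le_trans _ _ (cabs w ^+ n * (2 * (M / r ^+ n)) * 2 ^+ n)).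
    by rewrite !ler_wpM2r ?exprn_ge0 // ler_wpM2l // exprn_ge0 // ltW.
  have -> : cabs w ^+ n * (2 * (M / r ^+ n)) * 2 ^+ n =
      2 * M * ((cabs w * 2) ^+ n / r ^+ n).
    rewrite exprMn; have -> : (2 : R) ^+ n = (1 + 1) ^+ n by [].
    by move: ((1 + 1) ^+ n) => t; ring.
  rewrite -[leRHS]mulr1 ler_wpM2l ?mulr_ge0 // ler_pdivrMr ?exprn_gt0 // mul1r.
  by rewrite lerXn2r ?nnegrE ?mulr_ge0 ?cabs_ge0 ?(ltW r0) //; lra.
apply: contrapT => /eqP fw0; have af : 0 < cabs (f w) by rewrite cabs_gt0.
have [n hn] := pow2_unbounded (2 * M / cabs (f w)).
by have := bound n; rewrite mulrC -ler_pdivlMr // leNgt hn.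
Qed.

End FiniteOrder.

(** * Meromorphic germs *)

Section Meromorphic.
Context {R : realType}.
Local Notation C := (R[i]^o).
Implicit Types (f g h : C -> C) (z : C).

Lemma dnbhs_and z (P Q : C -> Prop) :
  (\forall x \near z^', P x) -> (\forall x \near z^', Q x) ->
  exists2 d : R, 0 < d & forall x, x != z -> cabs (x - z) < d -> P x /\ Q x.
Proof.
move=> zP zQ; apply: (proj1 (dnbhsC z (fun x => P x /\ Q x))).
exact: filterI zP zQ.
Qed.

Lemma dnbhs_near (z0 : C) (P : C -> Prop) : (\forall x \near z0^', P x) ->
  \forall x \near z0^', \forall y \near x, P y.
Proof.
move=> /dnbhsC[d d0 dP]; apply/dnbhsC; exists d => // x xz xd.
have xz0 : 0 < cabs (x - z0) by rewrite cabs_gt0 subr_eq0.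
apply/nbhsC; exists (Num.min (cabs (x - z0)) (d - cabs (x - z0))).
  by rewrite lt_min xz0 subr_gt0.
move=> y; rewrite lt_min => /andP[y1 y2]; apply: dP.
  by apply: contraTneq y1 => ->; rewrite cabs_distC ltxx.
by have := cabs_tri y x z0; lra.
Qed.

Lemma meroP f (z0 : C) : meromorphic_at f z0 <->
  (\forall z \near z0^', derivable f z 1) /\
  exists N (M : R), \forall z \near z0^', cabs ((z - z0) ^+ N * f z) <= M.
Proof.
split=> -[fd [N [M fM]]]; split=> //; exists N.
  exists (complex.Re M); apply: filterS fM => z; rewrite norm_cabs lecE /=.
  by case/andP.
by exists M%:C; apply: filterS fM => z; rewrite norm_cabs lecR.
Qed.

Lemma mero_near_eq f g (z0 : C) : (\forall z \near z0^', f z = g z) ->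
  meromorphic_at f z0 -> meromorphic_at g z0.
Proof.
move=> fg [fd [N [M fM]]]; split.
  apply: filterS2 (dnbhs_near fg) fd => z; exact: derivable_near_eq.
by exists N, M; apply: filterS2 fg fM => z <-.
Qed.

Lemma mero_bounded f (z0 : C) (M : R) : (\forall z \near z0^', derivable f z 1) ->
  (\forall z \near z0^', cabs (f z) <= M) -> meromorphic_at f z0.
Proof.
move=> fd fM; apply/meroP; split=> //; exists 0%N, M.
by apply: filterS fM => z; rewrite mul1r.
Qed.

Lemma cvg_dnbhs_bounded f (z0 : C) (l : C) : f @ z0^' --> l ->
  \forall z \near z0^', cabs (f z) <= cabs l + 1.
Proof.
move=> /cvg_dnbhsC/(_ 1 ltr01)[d d0 dP]; apply/dnbhsC; exists d => // z zz zd.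
by have := dP z zz zd; have := cabs_lb (f z) l; lra.
Qed.

Lemma mero_cvg f (z0 : C) (l : C) : (\forall z \near z0^', derivable f z 1) ->
  f @ z0^' --> l -> meromorphic_at f z0.
Proof. by move=> fd /cvg_dnbhs_bounded; exact: mero_bounded. Qed.

Lemma mero_cst (c : C) (z0 : C) : meromorphic_at (fun=> c) z0.
Proof.
apply: (@mero_bounded _ _ (cabs c)); apply: filterE => z //.
Qed.

Lemma mero_pole_bound f (z0 : C) (N N' : nat) (M : R) : (N <= N')%N ->
  (\forall z \near z0^', cabs ((z - z0) ^+ N * f z) <= M) ->
  \forall z \near z0^', cabs ((z - z0) ^+ N' * f z) <= M.
Proof.
move=> NN' fM; have near1 : \forall z \near z0^', cabs (z - z0) < 1.
  by apply/dnbhsC; exists 1.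
apply: filterS2 fM near1 => z fM z1; rewrite -(subnK NN') exprD -mulrA cabsM.
apply: le_trans fM; rewrite ler_piMl ?cabs_ge0 // cabsX exprn_ile1 ?cabs_ge0 //.
exact: ltW.
Qed.

Lemma mero_add f g (z0 : C) : meromorphic_at f z0 -> meromorphic_at g z0 ->
  meromorphic_at (fun z => f z + g z) z0.
Proof.
move=> /meroP[fd [N [M fM]]] /meroP[gd [N' [M' gM]]]; apply/meroP; split.
  by apply: filterS2 fd gd => z; exact: derivableCD.
exists (maxn N N'), (M + M').
apply: filterS2 (mero_pole_bound (leq_maxl N N') fM)
  (mero_pole_bound (leq_maxr N N') gM) => z fz gz.
by rewrite mulrDr; apply: le_trans (cabsD _ _) (lerD fz gz).
Qed.

Lemma mero_mul f g (z0 : C) : meromorphic_at f z0 -> meromorphic_at g z0 ->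
  meromorphic_at (fun z => f z * g z) z0.
Proof.
move=> /meroP[fd [N [M fM]]] /meroP[gd [N' [M' gM]]]; apply/meroP; split.
  by apply: filterS2 fd gd => z; exact: derivableCM.
exists (N + N')%N, (M * M'); apply: filterS2 fM gM => z fz gz.
by rewrite exprD mulrACA cabsM ler_pM ?cabs_ge0.
Qed.

(** The negation of: P fails at all points of a punctured neighbourhood. For a
    meromorphic germ, a property at frequent points extends to all nearby
    points; see [mero_neq0] and [mero_bounded_cvg]. *)
Definition frequently_at (z0 : C) (P : C -> Prop) : Prop :=
  forall e : R, 0 < e -> exists z, [/\ z != z0, cabs (z - z0) < e & P z].

(** After multiplication by a power of z - z0 the function extends continuously
    by 0, and [disk_fun_order] applies. *)
Lemma mero_structure f (z0 : C) : meromorphic_at f z0 ->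
  (\forall z \near z0^', f z = 0) \/
  exists (a b : nat) (u : C -> C) (c : C), [/\ c != 0, u @ z0^' --> c &
    \forall z \near z0^', (z - z0) ^+ a * f z = (z - z0) ^+ b * u z].
Proof.
move=> /meroP[fd [N [M fM]]].
have [d d0 dP] := dnbhs_and fd fM.
pose h z := if z == 0 then 0 else z ^+ N.+1 * f (z + z0).
have hD : disk_fun d h.
  have hE z : z != 0 -> \forall x \near z, x ^+ N.+1 * f (x + z0) = h x.
    move=> z0'; apply/nbhsC; exists (cabs z); first by rewrite cabs_gt0.
    move=> x xz; rewrite /h; case: eqP => // x0.
    by move: xz; rewrite x0 sub0r cabsN ltxx.
  have hder z : z != 0 -> cabs z < d -> derivable h z 1.
    move=> z0' zd; apply: derivable_near_eq (hE z z0') _.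
    apply: derivableCM; first exact: exprn_derivable.
    apply: (@derivable_compC _ (fun x => x + z0) f).
      by apply: derivableCD; [exact: derivableCid|exact: derivableCc].
    by have [] := dP (z + z0); rewrite ?addrK // -subr_eq0 addrK.
  split; last exact: hder.
  move=> z zd; have [->|z0'] := eqVneq z 0; last first.
    exact: derivable_continuousC (hder z z0' zd).
  apply/cvg_nbhsC => e e0; have M1 : 0 < `|M| + 1 by rewrite ltr_wpDl.
  exists (Num.min d (e / (`|M| + 1))); first by rewrite lt_min d0 divr_gt0.
  move=> x; rewrite subr0 lt_min => /andP[xd xe]; rewrite {2}/h eqxx subr0 /h.
  case: eqP => [_|/eqP x0]; first by rewrite cabs0.
  rewrite exprS -mulrA cabsM.
  have xz : x + z0 != z0 by rewrite -subr_eq0 addrK.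
  have := dP (x + z0) xz; rewrite addrK => /(_ xd)[_ hM].
  have {}hM : cabs (x ^+ N * f (x + z0)) < `|M| + 1.
    by have := ler_norm M; lra.
  move: xe; rewrite ltr_pdivlMr // => xe; apply: le_lt_trans xe.
  by rewrite ler_wpM2l ?cabs_ge0 // ltW.
have hE z : z != z0 -> (z - z0) ^+ N.+1 * f z = h (z - z0).
  by move=> zz; rewrite /h subr_eq0 (negbTE zz) subrK.
have [[r r0 rP]|[n [g [gD g0 gP]]]] := disk_fun_order d0 hD; [left|right].
  apply/dnbhsC; exists r => // z zz zr; apply: contrapT => /eqP fz.
  have := rP (z - z0); rewrite subr_eq0 -hE // => /(_ zz zr) /eqP.
  by rewrite mulf_eq0 (negbTE fz) orbF expf_eq0 subr_eq0 (negbTE zz).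
exists N.+1, n, (fun z => g (z - z0)), (g 0); split=> //; last first.
  by apply/dnbhsC; exists 1 => // z zz _; rewrite hE // gP.
have : g @ (0 : C) --> g 0 by apply: gD.1; rewrite cabs0.
move=> /cvg_nbhsC gc; apply/cvg_dnbhsC => e /gc[r r0 rP]; exists r => // z _ zr.
by apply: rP; rewrite subr0.
Qed.

Lemma mero_neq0 f (z0 : C) : meromorphic_at f z0 ->
  frequently_at z0 (fun z => f z != 0) ->
  (\forall z \near z0^', f z != 0) /\ meromorphic_at (fun z => (f z)^-1) z0.
Proof.
move=> fm freq; have [/dnbhsC[d d0 dP]|] := mero_structure fm.
  by have [z [zz zd]] := freq _ d0; rewrite dP // eqxx.
move=> [a [b [u [c [c0 uc uP]]]]].
have c2 : 0 < cabs c / 2 by rewrite divr_gt0 // cabs_gt0.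
have unz : \forall z \near z0^', cabs c / 2 < cabs (u z).
  move/cvg_dnbhsC: uc => /(_ _ c2)[d d0 dP]; apply/dnbhsC.
  exists d => // z zz zd; have := dP z zz zd; have := cabs_lb c (u z).
  by rewrite cabs_distC; lra.
have neq : \forall z \near z0^', z != z0 by apply/dnbhsC; exists 1.
have fnz : \forall z \near z0^', f z != 0.
  apply: filterS3 unz uP neq => z uz zP zz; apply: contraTneq uz => fz.
  rewrite -leNgt; suff -> : u z = 0 by rewrite cabs0 ltW.
  apply/eqP; move/eqP: zP; rewrite fz mulr0 eq_sym mulf_eq0 expf_eq0 subr_eq0.
  by rewrite (negbTE zz) andbF.
split=> //; apply/meroP; split.
  have [fd _] := fm; apply: filterS2 fnz fd => z; exact: derivableCV.
exists b, (2 / cabs c).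
have near1 : \forall z \near z0^', cabs (z - z0) < 1.
  by apply/dnbhsC; exists 1.
apply: filterS3 (filterI fnz neq) (filterI unz near1) uP => z [fz zz] [uz z1] zP.
have zz' : z - z0 != 0 by rewrite subr_eq0.
have u0 : u z != 0 by rewrite -cabs_gt0; lra.
have -> : (z - z0) ^+ b * (f z)^-1 = (z - z0) ^+ a / u z.
  apply: (mulIf fz); rewrite divfK // mulrAC zP mulfK //.
rewrite cabsM cabsV cabsX.
have le1 : cabs (z - z0) ^+ a <= 1 by rewrite exprn_ile1 ?cabs_ge0 // ltW.
have ac : 0 < cabs c by lra.
apply: (@le_trans _ _ (cabs (u z))^-1).
  by rewrite ler_piMl // invr_ge0 cabs_ge0.
rewrite -[2 / _]invf_div lef_pV2 ?posrE //; first exact: ltW.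
by lra.
Qed.

Lemma mero_inv f (z0 : C) : meromorphic_at f z0 ->
  frequently_at z0 (fun z => f z != 0) ->
  meromorphic_at (fun z => (f z)^-1) z0.
Proof. by move=> fm freq; have [] := mero_neq0 fm freq. Qed.

Lemma mero_bounded_cvg f (z0 : C) (M : R) : meromorphic_at f z0 ->
  frequently_at z0 (fun z => cabs (f z) <= M) ->
  exists l : C, f @ z0^' --> l.
Proof.
move=> fm freq; have [f0|] := mero_structure fm.
  exists 0; apply: (@cvg_dnbhs_eq _ (fun=> 0)); last exact: cvg_cst.
  by apply: filterS f0 => z ->.
move=> [a [b [u [c [c0 uc uP]]]]].
have [ab|ba] := leqP a b.
  exists (0 ^+ (b - a) * c).
  apply: (@cvg_dnbhs_eq _ (fun z => (z - z0) ^+ (b - a) * u z)); last first.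
    apply: cvgCM; last exact: uc.
    have : derivable (fun z : C => (z - z0) ^+ (b - a)) z0 1.
      apply: (@derivable_compC _ (fun x => x - z0) (fun x => x ^+ (b - a))).
        by apply: derivableCB; [exact: derivableCid|exact: derivableCc].
      exact: exprn_derivable.
    by move=> /derivable_continuousC/cvg_nbhs_dnbhs; rewrite subrr.
  have neq : \forall z \near z0^', z != z0 by apply/dnbhsC; exists 1.
  apply: filterS2 neq uP => z zz zP.
  have za : (z - z0) ^+ a != 0 by rewrite expf_neq0 // subr_eq0.
  by apply: (mulfI za); rewrite zP mulrA -exprD subnKC.
exfalso.
have c2 : 0 < cabs c / 2 by rewrite divr_gt0 // cabs_gt0.
have unz : \forall z \near z0^', cabs c / 2 < cabs (u z).
  move/cvg_dnbhsC: uc => /(_ _ c2)[d d0 dP]; apply/dnbhsC.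
  exists d => // z zz zd; have := dP z zz zd; have := cabs_lb c (u z).
  by rewrite cabs_distC; lra.
have [d d0 dP] := dnbhs_and unz uP.
have M1 : 0 < `|M| + 1 by rewrite ltr_wpDl.
pose r := Num.min (Num.min d 1) (cabs c / 2 / (`|M| + 1)).
have r0 : 0 < r by rewrite /r !lt_min d0 ltr01 divr_gt0.
have [z [zz zr fz]] := freq r r0.
move: zr; rewrite /r !lt_min => /andP[/andP[zd z1] zc].
have [uz zP] := dP z zz zd.
have zz' : z - z0 != 0 by rewrite subr_eq0.
have uE : u z = (z - z0) ^+ (a - b) * f z.
  have zb : (z - z0) ^+ b != 0 by rewrite expf_neq0.
  by apply: (mulfI zb); rewrite -zP mulrA -exprD subnKC // ltnW.
move: uz; rewrite uE cabsM cabsX -(prednK (n := (a - b)%N)) ?subn_gt0 //.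
rewrite exprS; apply/negP; rewrite -leNgt.
have le1 : cabs (z - z0) ^+ (a - b).-1 <= 1.
  by rewrite exprn_ile1 ?cabs_ge0 // ltW.
have ge0 : 0 <= cabs (z - z0) ^+ (a - b).-1 by rewrite exprn_ge0 ?cabs_ge0.
rewrite ltr_pdivlMr // in zc.
have fM : cabs (f z) <= `|M| + 1 by have := ler_norm M; lra.
apply: le_trans (ltW zc); rewrite -mulrA ler_wpM2l ?cabs_ge0 //.
apply: le_trans fM; rewrite ler_piMl ?cabs_ge0 //.
Qed.

End Meromorphic.

(** * Jacobi equations and their Jost solutions *)

Section ComplexSequences.
Context {R : realType}.
Local Notation C := (R[i]^o).

Lemma cvg_seqC (u : nat -> C) (l : C) : u @ \oo --> l <->
  forall e : R, 0 < e -> exists N, forall n, (N <= n)%N -> cabs (u n - l) < e.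
Proof.
split=> [/cvgC h e /h [N _ NP]|h].
  by exists N => n Nn; exact: NP.
by apply/cvgC => e /h[N NP]; exists N => // n Nn; exact: NP.
Qed.

Lemma cvg_seq_shift (u : nat -> C) (l : C) :
  u @ \oo --> l -> (fun k => u k.+1) @ \oo --> l.
Proof.
move=> /cvg_seqC h; apply/cvg_seqC => e /h[N NP]; exists N => n Nn.
by apply: NP; exact: leqW.
Qed.

Lemma cvg_seq_eq (u v : nat -> C) (l : C) N : (forall n, (N <= n)%N -> u n = v n) ->
  u @ \oo --> l -> v @ \oo --> l.
Proof.
move=> uv /cvg_seqC h; apply/cvg_seqC => e /h[M MP]; exists (maxn N M) => n.
by rewrite geq_max => /andP[Nn Mn]; rewrite -uv //; exact: MP.
Qed.

Lemma cvg_seq_unique (u : nat -> C) (l l' : C) :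
  u @ \oo --> l -> u @ \oo --> l' -> l = l'.
Proof.
move=> /cvg_seqC ul /cvg_seqC ul'; apply/eqP; rewrite -subr_eq0 -cabs_eq0.
rewrite eq_le cabs_ge0 andbT; apply/ler_addgt0Pl => e e0.
have e2 : 0 < e / 2 by rewrite divr_gt0.
have [N NP] := ul _ e2; have [M MP] := ul' _ e2.
have h1 := NP _ (leq_maxl N M); have h2 := MP _ (leq_maxr N M).
by have := cabs_tri l (u (maxn N M)) l'; rewrite (cabs_distC l (u _)); lra.
Qed.

Lemma cvg_seq_neq0 (u : nat -> C) (l : C) : u @ \oo --> l -> l != 0 ->
  exists N, forall n, (N <= n)%N -> u n != 0.
Proof.
move=> /cvg_seqC h l0; have [|N NP] := h (cabs l); first by rewrite cabs_gt0.
exists N => n /NP; apply: contraTneq => ->.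
by rewrite sub0r cabsN ltxx.
Qed.

Lemma geometric_small (q A e : R) : 0 <= q < 1 -> 0 <= A -> 0 < e ->
  exists N, forall n, (N <= n)%N -> q ^+ n * A < e.
Proof.
move=> /andP[q0 q1] A0 e0.
have qc : (fun n => q ^+ n) @ \oo --> (0 : R).
  by apply: cvg_expr; rewrite ger0_norm.
have eA : 0 < e / (A + 1) by rewrite divr_gt0 // ltr_wpDl.
move/cvgrPdist_lt: qc => /(_ _ eA)[N _ NP]; exists N => n /NP /=.
rewrite sub0r normrN ger0_norm ?exprn_ge0 // ltr_pdivlMr ?ltr_wpDl // => h.
by apply: le_lt_trans h; rewrite ler_wpM2l ?exprn_ge0 // lerDl.
Qed.

Lemma cvg_seq_pow0 (z : C) : cabs z < 1 -> (fun k => z ^+ k : C) @ \oo --> (0 : C).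
Proof.
move=> z1; apply/cvg_seqC => e e0.
have [|N NP] := @geometric_small (cabs z) 1 e _ ler01 e0.
  by rewrite cabs_ge0.
by exists N => n /NP; rewrite mulr1 subr0 cabsX.
Qed.

Lemma cvg_seq_bounded_mul0 (u v : nat -> C) : (forall k, cabs (u k) <= 1) ->
  v @ \oo --> (0 : C) -> (fun k => u k * v k) @ \oo --> (0 : C).
Proof.
move=> u1 /cvg_seqC h; apply/cvg_seqC => e /h[N NP]; exists N => n /NP.
rewrite !subr0; apply: le_lt_trans.
by rewrite cabsM ler_piMl ?cabs_ge0.
Qed.

(** The deviation from the fixed point b / (1 - a) is contracted at each step, up
    to an error which tends to 0. *)
Lemma affine_recursion_cvg (x al be : nat -> C) (a b : C) N :
  (forall k, (N <= k)%N -> x k.+1 = al k * x k + be k) ->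
  al @ \oo --> a -> be @ \oo --> b -> cabs a < 1 ->
  x @ \oo --> b / (1 - a).
Proof.
move=> xS ala beb a1; have a1' : 1 - a != 0.
  rewrite subr_eq0; apply: contraTneq a1 => <-.
  by rewrite cabs1 ltxx.
pose y k := x k - b / (1 - a); pose ga k := be k + (al k - 1) * (b / (1 - a)).
have yS k : (N <= k)%N -> y k.+1 = al k * y k + ga k.
  by move=> Nk; rewrite /y /ga xS //; ring.
have ga0 : ga @ \oo --> (0 : C).
  have -> : (0 : C) = b + (a - 1) * (b / (1 - a)).
    by rewrite -[a - 1]opprB mulNr [_ * (b / _)]mulrC divfK // subrr.
  apply: cvgCD; first exact: beb.
  by apply: cvgCM; [apply: cvgCB; [exact: ala|exact: cvg_cst]|exact: cvg_cst].
pose q := (1 + cabs a) / 2; have q01 : 0 <= q < 1.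
  by have := cabs_ge0 a; rewrite /q => aa; apply/andP; split; lra.
have [q0 q1] := andP q01.
apply/cvg_seqC => e e0; have e2 : 0 < e / 2 by rewrite divr_gt0.
have [|N1 N1P] := (cvg_seqC _ _).1 ala ((1 - cabs a) / 2).
  by rewrite divr_gt0 // subr_gt0.
have [|N2 N2P] := (cvg_seqC _ _).1 ga0 (e / 2 * (1 - q)).
  by rewrite mulr_gt0 // subr_gt0.
pose K := maxn N (maxn N1 N2).
have step k : (K <= k)%N -> cabs (y k.+1) <= q * cabs (y k) + e / 2 * (1 - q).
  rewrite !geq_max => /and3P[kN kN1 kN2]; rewrite yS //.
  apply: le_trans (cabsD _ _) _; rewrite cabsM lerD //.
    rewrite ler_wpM2r ?cabs_ge0 // /q.
    by have := N1P k kN1; have := cabs_lb (al k) a; lra.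
  by have := N2P k kN2; rewrite subr0 => /ltW.
have bound m : cabs (y (K + m)%N) <= q ^+ m * cabs (y K) + e / 2.
  elim: m => [|m IHm]; first by rewrite addn0 mul1r lerDl ltW.
  rewrite addnS; apply: le_trans (step _ (leq_addr _ _)) _.
  have := ler_wpM2l q0 IHm; rewrite exprS mulrDr mulrA; lra.
have [M MP] := geometric_small q01 (cabs_ge0 (y K)) e2.
exists (K + M)%N => n Kn; have := bound (n - K)%N.
rewrite subnKC; last exact: leq_trans (leq_addr _ _) Kn.
have : (M <= n - K)%N by rewrite leq_subRL //; exact: leq_trans (leq_addr _ _) Kn.
by move=> /MP h1 h2; apply: le_lt_trans h2 _; lra.
Qed.

End ComplexSequences.

Section JacobiAlgebra.
Context {F : fieldType}.
Variables (a b : nat -> F).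
Hypothesis b0 : forall k, b k != 0.

Definition jacobi_solution (l : F) (u : nat -> F) : Prop := forall k,
  - b k * u k + a k.+1 * u k.+1 - b k.+1 * u k.+2 = l * u k.+1.

(** Constant in k for two solutions of the same equation; for a solution and its
    conjugate it is the flux of the wave. *)
Definition wronskian (u v : nat -> F) (k : nat) : F :=
  b k * (u k * v k.+1 - u k.+1 * v k).

Lemma wronskianS l l' u v k : jacobi_solution l u -> jacobi_solution l' v ->
  wronskian u v k.+1 = wronskian u v k + (l - l') * (u k.+1 * v k.+1).
Proof.
move=> /(_ k) us /(_ k) vs; rewrite /wronskian.
have uE : b k.+1 * u k.+2 = - b k * u k + a k.+1 * u k.+1 - l * u k.+1.
  by rewrite -us; ring.
have vE : b k.+1 * v k.+2 = - b k * v k + a k.+1 * v k.+1 - l' * v k.+1.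
  by rewrite -vs; ring.
have -> : b k.+1 * (u k.+1 * v k.+2 - u k.+2 * v k.+1) =
    u k.+1 * (b k.+1 * v k.+2) - b k.+1 * u k.+2 * v k.+1 by ring.
by rewrite uE vE; ring.
Qed.

Lemma wronskian_const l u v k : jacobi_solution l u -> jacobi_solution l v ->
  wronskian u v k = wronskian u v 0.
Proof.
move=> us vs; elim: k => // k <-.
by rewrite (wronskianS k us vs) subrr mul0r addr0.
Qed.

Lemma jacobi_solution_comb l u v (x y : F) : jacobi_solution l u ->
  jacobi_solution l v -> jacobi_solution l (fun k => x * u k + y * v k).
Proof.
move=> us vs k; have := us k; have := vs k => vk uk.
transitivity (x * (- b k * u k + a k.+1 * u k.+1 - b k.+1 * u k.+2) +
  y * (- b k * v k + a k.+1 * v k.+1 - b k.+1 * v k.+2)); first by ring.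
by rewrite uk vk; ring.
Qed.

Lemma jacobi_solution_eq0 l u : jacobi_solution l u -> u 0%N = 0 ->
  u 1%N = 0 -> forall k, u k = 0.
Proof.
move=> us u0 u1 k; suff [] : u k = 0 /\ u k.+1 = 0 by [].
elim: k => // k [uk uk1]; split=> //.
have := us k; rewrite uk uk1 !mulr0 addr0 sub0r => /eqP.
by rewrite oppr_eq0 mulf_eq0 (negbTE (b0 _)) => /eqP.
Qed.

Lemma jacobi_solution_back l u N : jacobi_solution l u ->
  (forall k, (N <= k)%N -> u k = 0) -> forall k, u k = 0.
Proof.
move=> us; elim: N => [h k|N IHN h]; first exact: h.
apply: IHN => k Nk; have [{}Nk|kN] := ltnP N k; first exact: h.
have -> : k = N by apply/eqP; rewrite eqn_leq kN.
have := us N; rewrite (h N.+1) ?(h N.+2) // !mulr0 addr0 subr0 mulNr => /eqP.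
by rewrite oppr_eq0 mulf_eq0 (negbTE (b0 _)) => /eqP.
Qed.

End JacobiAlgebra.

Section JostSolutions.
Context {R : realType}.
Local Notation C := (R[i]^o).
Variables (a b : nat -> R) (be : R).
Hypothesis b_gt0 : forall k, 0 < b k.
Hypothesis be_gt0 : 0 < be.
Hypothesis b_lim : (fun k => (b k)%:C : C) @ \oo --> (be%:C : C).

Let aC (k : nat) : C := (a k)%:C.
Let bC (k : nat) : C := (b k)%:C.

Lemma realC_neq0 (x : R) : 0 < x -> (x%:C : C) != 0.
Proof. by move=> x0; rewrite -cabs_gt0 cabs_real normr_gt0 gt_eqF. Qed.

Let bC0 k : bC k != 0. Proof. exact: realC_neq0. Qed.

Definition jost_at (z : C) (u : nat -> C) : Prop :=
  (fun k => u k / z ^+ k : C) @ \oo --> (1 : C).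

Lemma jost_neq0 z u : z != 0 -> jost_at z u ->
  exists N, forall k, (N <= k)%N -> u k != 0.
Proof.
move=> z0 uz; have [N NP] := cvg_seq_neq0 uz (oner_neq0 _).
exists N => k /NP; apply: contra => /eqP ->.
by rewrite mul0r.
Qed.

(** The Wronskian is constant, and its limit can be read off the asymptotics
    because z^k w^k = 1. *)
Lemma jost_wronskian_inv (l z w : C) u v : z * w = 1 ->
  jost_at z u -> jost_at w v ->
  jacobi_solution aC bC l u -> jacobi_solution aC bC l v ->
  wronskian bC u v 0 = be%:C * (w - z).
Proof.
move=> zw uz vw us vs.
have zw0 : z * w != 0 by rewrite zw oner_neq0.
have z0 : z != 0 by apply: contraNneq zw0 => ->; rewrite mul0r.
have w0 : w != 0 by apply: contraNneq zw0 => ->; rewrite mulr0.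
have lim : (fun k => wronskian bC u v k) @ \oo -->
    (be%:C * (w * 1 * 1 - z * 1 * 1) : C).
  apply: (@cvg_seq_eq _ (fun k => bC k * (w * (u k / z ^+ k) *
     (v k.+1 / w ^+ k.+1) - z * (u k.+1 / z ^+ k.+1) * (v k / w ^+ k))) _ _ 0%N).
    move=> k _; rewrite /wronskian; congr (_ * _).
    have zwk : z ^+ k * w ^+ k = 1 by rewrite -exprMn zw expr1n.
    have zk : z ^+ k != 0 by rewrite expf_neq0.
    have wk : w ^+ k != 0 by rewrite expf_neq0.
    rewrite !exprS; congr (_ - _).
      transitivity (u k * v k.+1 / (z ^+ k * w ^+ k)); last by rewrite zwk divr1.
      by field; rewrite zk wk w0.
    transitivity (u k.+1 * v k / (z ^+ k * w ^+ k)); last by rewrite zwk divr1.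
    by field; rewrite zk wk z0.
  apply: cvgCM; first exact: b_lim.
  apply: cvgCB; apply: cvgCM.
  - by apply: cvgCM; [exact: cvg_cst|exact: uz].
  - exact: (cvg_seq_shift vw).
  - by apply: cvgCM; [exact: cvg_cst|exact: (cvg_seq_shift uz)].
  - exact: vw.
rewrite !mulr1 in lim; apply: (cvg_seq_unique _ lim).
apply: (@cvg_seq_eq _ (fun=> wronskian bC u v 0) _ _ 0%N); last exact: cvg_cst.
by move=> k _; rewrite (wronskian_const k us vs).
Qed.

(** For z = w on the unit circle, the leading terms cancel; otherwise z^k tends
    to 0. *)
Lemma jost_wronskian_cvg0 (z w : C) u v : z != 0 -> w != 0 ->
  cabs z <= 1 -> cabs w <= 1 -> (z = w \/ cabs z < 1) ->
  jost_at z u -> jost_at w v -> (fun k => wronskian bC u v k) @ \oo --> (0 : C).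
Proof.
move=> z0 w0 z1 w1 zw uz vw.
have zk k : z ^+ k != 0 by rewrite expf_neq0.
have wk k : w ^+ k != 0 by rewrite expf_neq0.
have bnd (x : C) k : cabs x <= 1 -> cabs (x ^+ k) <= 1.
  by move=> x1; rewrite cabsX exprn_ile1 ?cabs_ge0.
pose f k := u k / z ^+ k; pose g k := v k / w ^+ k.
have uE k : u k = f k * z ^+ k by rewrite /f divfK.
have vE k : v k = g k * w ^+ k by rewrite /g divfK.
have [zw1|{}zw] := zw.
  apply: (@cvg_seq_eq _ (fun k => z ^+ (k + k.+1) * (bC k *
     (f k * g k.+1 - f k.+1 * g k))) _ _ 0%N).
    by move=> k _; rewrite /wronskian !uE !vE -zw1 !exprD !exprS; ring.
  apply: (@cvg_seq_bounded_mul0 _ (fun k => z ^+ (k + k.+1))) => [k|].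
    exact: bnd.
  have -> : (0 : C) = be%:C * (1 * 1 - 1 * 1) by rewrite subrr mulr0.
  apply: cvgCM; first exact: b_lim.
  apply: cvgCB; apply: cvgCM.
  - exact: uz.
  - exact: (cvg_seq_shift vw).
  - exact: (cvg_seq_shift uz).
  - exact: vw.
apply: (@cvg_seq_eq _ (fun k => w ^+ k * (z ^+ k * (bC k *
   (w * (f k * g k.+1) - z * (f k.+1 * g k))))) _ _ 0%N).
  by move=> k _; rewrite /wronskian !uE !vE !exprS; ring.
apply: (@cvg_seq_bounded_mul0 _ (fun k => w ^+ k)) => [k|]; first exact: bnd.
have -> : (0 : C) = 0 * (be%:C * (w * (1 * 1) - z * (1 * 1))) by rewrite mul0r.
apply: cvgCM; first exact: cvg_seq_pow0.
apply: cvgCM; first exact: b_lim.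
apply: cvgCB.
  apply: cvgCM; first exact: cvg_cst.
  by apply: cvgCM; [exact: uz|exact: (cvg_seq_shift vw)].
apply: cvgCM; first exact: cvg_cst.
by apply: cvgCM; [exact: (cvg_seq_shift uz)|exact: vw].
Qed.

(** The decaying (or oscillating) solution is determined by its asymptotics:
    the Wronskian of two candidates tends to 0, hence vanishes. *)
Lemma jost_unique (l z : C) u v : z != 0 -> cabs z <= 1 ->
  jost_at z u -> jost_at z v ->
  jacobi_solution aC bC l u -> jacobi_solution aC bC l v ->
  forall k, u k = v k.
Proof.
move=> z0 z1 uz vz us vs.
have wr0 k : wronskian bC u v k = 0.
  rewrite (wronskian_const k us vs).
  have := jost_wronskian_cvg0 z0 z0 z1 z1 (or_introl erefl) uz vz.
  apply: cvg_seq_unique; apply: (@cvg_seq_eq _ (fun=> wronskian bC u v 0) _ _ 0%N).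
    by move=> k' _; rewrite (wronskian_const k' us vs).
  exact: cvg_cst.
have [N NP] := jost_neq0 z0 vz.
pose r := u N / v N.
have rE k : (N <= k)%N -> u k = r * v k.
  move=> Nk; rewrite -(subnKC Nk); elim: (k - N)%N => [|m IHm].
    by rewrite addn0 /r divfK // NP.
  have := wr0 (N + m)%N; rewrite /wronskian => /eqP.
  rewrite mulf_eq0 (negbTE (bC0 _)) /= subr_eq0 IHm -mulrA mulrCA.
  have vn : v (N + m)%N != 0 by rewrite NP ?leq_addr.
  by rewrite addnS => /eqP E; apply: (mulfI vn); rewrite [LHS]mulrC E.
have r1 : r = 1.
  have : (fun k => r * (v k / z ^+ k)) @ \oo --> r * 1.
    by apply: cvgCM; [exact: cvg_cst|exact: vz].
  rewrite mulr1 => /cvg_seq_unique; apply.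
  apply: (@cvg_seq_eq _ _ _ _ N); last exact: uz.
  by move=> k Nk /=; rewrite rE // mulrA.
have d0 := jacobi_solution_comb 1 (-1) us vs.
move=> k; apply/eqP; rewrite -subr_eq0 -mulN1r -[u k]mul1r; apply/eqP.
apply: (jacobi_solution_back bC0 d0 (N := N)) => m Nm.
by rewrite (rE m Nm) r1 !mul1r mulN1r subrr.
Qed.

Lemma conjC_cvg (u : nat -> C) (l : C) : u @ \oo --> l ->
  (fun k => (u k)^*%C : C) @ \oo --> (l^*%C : C).
Proof.
move=> /cvg_seqC h; apply/cvg_seqC => e /h[N NP]; exists N => n /NP.
by rewrite -rmorphB /= cabs_conj.
Qed.

Lemma jost_conj z u : jost_at z u -> jost_at (z^*%C) (fun k => (u k)^*%C : C).
Proof.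
move=> /conjC_cvg; rewrite conjc1; apply: (@cvg_seq_eq _ _ _ _ 0%N) => k _.
by rewrite rmorphM fmorphV rmorphXn.
Qed.

Lemma jacobi_solution_conj (l : C) u : jacobi_solution aC bC l u ->
  jacobi_solution aC bC (l^*%C : C) (fun k => (u k)^*%C : C).
Proof.
move=> us k; have Ea m : (aC m)^*%C = aC m by exact: conjc_real.
have Eb m : (bC m)^*%C = bC m by exact: conjc_real.
rewrite -(Eb k) -(Ea k.+1) -(Eb k.+1) -rmorphN -!rmorphM.
by rewrite -rmorphD -rmorphB us.
Qed.

(** A zero of u 1 would make u an eigenvector of a real symmetric Jacobi matrix
    for the nonreal eigenvalue l: the Wronskian of u and of its conjugate would
    start from 0 and be l - l^* times an increasing positive sum, but it tends
    to 0. *)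
Lemma jost_nonreal_neq0 (l z : C) u : z != 0 -> cabs z < 1 ->
  l != (l^*%C : C) -> jost_at z u -> jacobi_solution aC bC l u -> u 1%N != 0.
Proof.
move=> z0 z1 ll uz us; apply/eqP => u1.
pose v k := (u k)^*%C : C.
have vs : jacobi_solution aC bC (l^*%C : C) v by exact: jacobi_solution_conj.
pose T k := \sum_(i < k) cabs (u i.+1) ^+ 2.
have wE k : wronskian bC u v k = (l - l^*%C) * (T k)%:C.
  elim: k => [|k IHk].
    by rewrite /wronskian /v u1 /T big_ord0 conjc0 !mulr0 mul0r subr0 mulr0.
  rewrite (wronskianS k us vs) IHk /T big_ord_recr /= rmorphD mulrDr.
  by congr (_ + _ * _); rewrite /v -sqr_normc norm_cabs rmorphXn.
have z0' : (z^*%C : C) != 0 by rewrite conjc_eq0.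
have z1' : cabs (z^*%C : C) <= 1 by rewrite cabs_conj ltW.
have := jost_wronskian_cvg0 z0 z0' (ltW z1) z1' (or_intror z1) uz (jost_conj uz).
move=> /cvg_seqC w0.
have [N NP] := jost_neq0 z0 uz.
have dl : 0 < cabs (l - l^*%C) by rewrite cabs_gt0 subr_eq0.
have uN : 0 < cabs (u N.+1) ^+ 2 by rewrite exprn_gt0 // cabs_gt0 NP // leqnSn.
have [|M MP] := w0 (cabs (l - l^*%C) * cabs (u N.+1) ^+ 2); first exact: mulr_gt0.
have := MP (M + N.+1)%N (leq_addr _ _).
rewrite subr0 wE cabsM ltr_pM2l // cabs_real ger0_norm; last first.
  by apply: sumr_ge0 => i _; rewrite exprn_ge0 ?cabs_ge0.
apply/negP; rewrite -leNgt /T.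
have iN : (N < M + N.+1)%N by rewrite addnS ltnS leq_addl.
rewrite (bigD1 (Ordinal iN)) //= lerDl.
by apply: sumr_ge0 => i _; rewrite exprn_ge0 ?cabs_ge0.
Qed.

(** The constant Wronskian of p and of the Jost solution u is a recursion of the
    first order for p; for p k z^k it has the form of [affine_recursion_cvg]
    with multiplier z^2. *)
Lemma growing_solution_cvg (l z : C) (u p : nat -> C) : z != 0 -> cabs z < 1 ->
  jost_at z u -> jacobi_solution aC bC l u -> jacobi_solution aC bC l p ->
  p 0%N = 1 -> p 1%N = 0 ->
  (fun k => p k * z ^+ k : C) @ \oo -->
    (- ((b 0)%:C * u 1%N * z / be%:C / (1 - z * z)) : C).
Proof.
move=> z0 z1 uz us ps p0 p1.
have zk k : z ^+ k != 0 by rewrite expf_neq0.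
pose f k := u k / z ^+ k; pose c := (b 0)%:C * u 1%N : C.
have uE k : u k = f k * z ^+ k by rewrite /f divfK.
have cE k : bC k * (p k * u k.+1 - p k.+1 * u k) = c.
  have := wronskian_const k ps us; rewrite /wronskian p0 p1 mul0r subr0 mul1r.
  by [].
have [N NP] := jost_neq0 z0 uz.
have beC : (be%:C : C) != 0 by exact: realC_neq0.
have lim : (fun k => p k * z ^+ k : C) @ \oo -->
    (- (c * z * be%:C^-1 * 1^-1) / (1 - z * z * (1 * 1^-1)) : C).
  apply: (@affine_recursion_cvg _ _ (fun k => z * z * (f k.+1 * (f k)^-1))
    (fun k => - (c * z * (bC k)^-1 * (f k)^-1)) _ _ N).
  - move=> k Nk; have fk : f k != 0.
      by apply: contraNneq (NP k Nk) => fk0; rewrite uE fk0 mul0r.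
    apply: (mulIf (mulf_neq0 (bC0 k) fk)).
    rewrite -(cE k) !uE !exprS.
    by field; rewrite bC0 fk.
  - apply: cvgCM; first exact: cvg_cst.
    apply: cvgCM; first exact: (cvg_seq_shift uz).
    by apply: cvgCV; [exact: oner_neq0|exact: uz].
  - apply: cvgCN; apply: cvgCM.
      by apply: cvgCM; [exact: cvg_cst|apply: cvgCV; [exact: beC|exact: b_lim]].
    by apply: cvgCV; [exact: oner_neq0|exact: uz].
  - rewrite invr1 !mulr1 cabsM.
    apply: (le_lt_trans _ z1); rewrite ler_piMl ?cabs_ge0 //; exact: ltW.
by move: lim; rewrite invr1 !mulr1 /c mulNr.
Qed.

End JostSolutions.

(** * Particles, channels and the core *)

Section Particles.
Context {R : realType} (S : multichannel_system R).
Local Notation C := (R[i]^o).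
Local Notation n := (nchan S).
Local Notation fa := (@jacobi_a R S).
Local Notation fb := (@jacobi_b R S).
Local Notation L := (@interaction R S).

Lemma fbC_neq0 s k : (fb s k)%:C != 0 :> R[i].
Proof. by rewrite fmorph_eq0 gt_eqF // jacobi_b_gt0. Qed.

Lemma interaction_chan_neq0 s k : L (chan s k) (chan s k.+1) != 0.
Proof.
have := jacobi_b_gt0 s k; rewrite /jacobi_b oppr_gt0.
by move/lt_eqF => ->.
Qed.

Lemma chan_notin_core s k : chan s k.+1 \notin core S.
Proof. by apply/negP => /coreP; apply; exists s, k. Qed.

Lemma chan0_neqS (s t : 'I_n) k : chan s 0%N <> chan t k.+1.
Proof.
by move=> e; have := attachment_core s; rewrite e (negbTE (chan_notin_core _ _)).
Qed.

Lemma chan_neighbour s k be : L (chan s k.+1) be != 0 ->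
  [\/ be = chan s k.+1, be = chan s k | be = chan s k.+2].
Proof. by have [h _ _] := chanP s; exact: h. Qed.

(** By induction on k: chan s k interacts with the common particle, hence is next
    to it, or equal to it, in the channel t; being the particle of index k of
    the channel s, it can only be chan t k. Attachment points start the
    induction: they are distinct and lie in the core. *)
Lemma chanS_inj k : forall (s t : 'I_n) j, chan s k.+1 = chan t j.+1 -> s = t /\ k = j.
Proof.
have [m] := ubnP k; elim: m k => // m IHm k; rewrite ltnS => km s t j E.
have prev (s' t' : 'I_n) i j' : (i < k)%N -> chan s' i = chan t' j' -> s' = t' /\ i = j'.
  case: i => [|i] ik; case: j' => [|j'] e.
  - by split=> //; exact: attachment_inj e.
  - by case: (chan0_neqS e).
  - by case: (chan0_neqS (esym e)).
  - by have [-> ->] := IHm i (ltnW (leq_trans ik km)) _ _ _ e.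
have prevk (t' : 'I_n) j' : chan s k = chan t' j' -> s = t' /\ k = j'.
  case: k {prev} km E => [|k] km E; case: j' => [|j'] e.
  - by split=> //; exact: attachment_inj e.
  - by case: (chan0_neqS e).
  - by case: (chan0_neqS (esym e)).
  - by have [-> ->] := IHm k km _ _ _ e.
have := interaction_chan_neq0 s k; rewrite interaction_sym E.
case/chan_neighbour => /prevk [e1 e2]; last 1 first.
- move: E; rewrite -e1 e2 => /esym E; exfalso.
  have jk : (j.+1 < k)%N by rewrite e2.
  by have [_] := prev _ _ _ _ jk E; lia.
- move: E; rewrite -e1 => E; exfalso.
  have := interaction_chan_neq0 t j; rewrite -e1 interaction_sym -E.
  have jk : (j < k)%N by rewrite e2.
  case/chan_neighbour => /(prev _ _ _ _ jk) [_]; lia.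
- by [].
Qed.

Lemma chan_inj (s t : 'I_n) k j : chan s k = chan t j -> s = t /\ k = j.
Proof.
case: k j => [|k] [|j] e.
- by split=> //; exact: attachment_inj e.
- by case: (chan0_neqS e).
- by case: (chan0_neqS (esym e)).
- by have [-> ->] := chanS_inj e.
Qed.

Lemma core_chanP (al : S) : al \in core S \/ exists s k, al = chan s k.+1.
Proof.
have [c|nc] := boolP (al \in core S); [by left|right].
by apply: contrapT => no; move/negP: nc; apply; apply/coreP.
Qed.

(** A row of the interaction matrix has finite support. *)
Lemma sum_setT_seq (T : choiceType) (V : zmodType) (r : seq T) (f : T -> V) :
  uniq r -> (forall i, i \notin r -> f i = 0) ->
  \sum_(i \in [set: T]) f i = \sum_(i <- r) f i.
Proof.
move=> ur f0; rewrite (fsbig_seq _ _ ur); apply/esym/fsbig_widen => //.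
by move=> i [_ /= /negP]; exact: f0.
Qed.

Lemma apply_matrix_chan (u : S -> R[i]) s k :
  apply_matrix L u (chan s k.+1) =
  - (fb s k)%:C * u (chan s k) + (fa s k.+1)%:C * u (chan s k.+1)
    - (fb s k.+1)%:C * u (chan s k.+2).
Proof.
rewrite /apply_matrix (@sum_setT_seq _ _ [:: chan s k; chan s k.+1; chan s k.+2]).
- rewrite !big_cons big_nil addr0 addrA /jacobi_a /jacobi_b !rmorphN opprK mulNr.
  by rewrite opprK interaction_sym.
- rewrite /= !inE !negb_or !andbT; apply/andP; split; last first.
    by apply/eqP => /chan_inj[_]; lia.
  by apply/andP; split; apply/eqP => /chan_inj[_]; lia.
move=> be; rewrite !inE !negb_or => /and3P[b0 b1 b2].
have [->|/chan_neighbour] := eqVneq (L (chan s k.+1) be) 0; first by rewrite mul0r.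
by case=> e; move: b0 b1 b2; rewrite e eqxx.
Qed.

Lemma interaction_core_chan (al : S) g k : al \in core S ->
  L al (chan g k.+1) != 0 -> al = chan g 0%N /\ k = 0%N.
Proof.
move=> alc; rewrite interaction_sym => /chan_neighbour[] e.
- by move: alc; rewrite e (negbTE (chan_notin_core _ _)).
- case: k e => [|k] e; first by [].
  by move: alc; rewrite e (negbTE (chan_notin_core _ _)).
- by move: alc; rewrite e (negbTE (chan_notin_core _ _)).
Qed.

Lemma apply_matrix_core (u : S -> R[i]) (al : S) : al \in core S ->
  apply_matrix L u al = \sum_(x : core S) (L al (fsval x))%:C * u (fsval x) -
    \sum_(g < n | al == chan g 0%N) (fb g 0)%:C * u (chan g 1%N).
Proof.
move=> alc; rewrite /apply_matrix.
rewrite (@sum_setT_seq _ _ (core S ++ [seq chan g 1%N | g <- enum 'I_n])).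
- rewrite big_cat /= big_seq_fsetE big_map big_enum /=; congr (_ + _).
  rewrite [RHS](_ : _ = \sum_(g < n) if al == chan g 0%N then
    - ((fb g 0)%:C * u (chan g 1%N)) else 0); last first.
    by rewrite -big_mkcond sumrN.
  apply: eq_bigr => g _; case: eqP => [->|ne].
    by rewrite /jacobi_b rmorphN mulNr opprK.
  have [->|/(interaction_core_chan alc)[]//] := eqVneq (L al (chan g 1%N)) 0.
  by rewrite mul0r.
- rewrite cat_uniq fset_uniq /= map_inj_uniq ?enum_uniq ?andbT.
    apply/hasPn => be /mapP[g _ ->] /=; exact: chan_notin_core.
  by move=> g h /chan_inj[].
move=> be; rewrite mem_cat negb_or => /andP[bc bm].
have [->|Lb] := eqVneq (L al be) 0; first by rewrite mul0r.
have [bc'|[g [k e]]] := core_chanP be; first by rewrite bc' in bc.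
move: Lb; rewrite e => /(interaction_core_chan alc)[_ k0].
by case/negP: bm; rewrite e k0; apply/mapP; exists g; rewrite ?mem_enum.
Qed.

Lemma resolventE (x y : core S) (l : R[i]) :
  resolvent (fsval x) (fsval y) l =
  invmx (core_mx S - l%:M) (enum_rank x) (enum_rank y).
Proof.
rewrite /resolvent !insubT ?fsvalP // => px py.
by congr (invmx _ (enum_rank _) (enum_rank _)); apply: val_inj.
Qed.

Definition gate (g : 'I_n) : core S := FSetSub (attachment_core g).

(** The channels enter the core only through sources b_g(0) y_g at the
    attachment points; applying the resolvent to these sources solves the
    equation of the core. *)
Lemma resolvent_equation (l : R[i]) (y : 'I_n -> R[i]) (u : S -> R[i]) :
  core_regular S l ->
  (forall al, al \in core S -> u al = \sum_(v < n)
     resolvent al (chan v 0%N) l * (fb v 0)%:C * y v) ->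
  forall x : core S, \sum_(x' : core S) (L (fsval x) (fsval x'))%:C * u (fsval x') =
    l * u (fsval x) +
    \sum_(g < n | fsval x == chan g 0%N) (fb g 0)%:C * y g.
Proof.
move=> reg uE x; pose M := core_mx S - l%:M.
pose w : 'cV[R[i]]_(#|{: core S}|) := \col_j u (fsval (enum_val j)).
pose G : 'cV[R[i]]_(#|{: core S}|) :=
  \col_j \sum_(g < n | enum_val j == gate g) (fb g 0)%:C * y g.
have wE : w = invmx M *m G.
  apply/matrixP => i j; rewrite !mxE uE ?fsvalP //.
  under [RHS]eq_bigr => k _ do rewrite !mxE mulr_sumr.
  rewrite (exchange_big_dep xpredT) //=; apply: eq_bigr => g _.
  rewrite (big_pred1 (enum_rank (gate g))) => [|k]; last first.
    by rewrite (can2_eq enum_valK enum_rankK).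
  by rewrite mulrA -{1}[chan g 0%N]/(fsval (gate g)) resolventE enum_valK.
have MwG : M *m w = G by rewrite wE mulKVmx.
have := congr1 (fun X : 'cV_(#|{: core S}|) => X (enum_rank x) 0) MwG.
rewrite /M mulmxBl mul_scalar_mx !mxE enum_rankK => h.
have -> : \sum_(x' : core S) (L (fsval x) (fsval x'))%:C * u (fsval x') =
    \sum_j core_mx S (enum_rank x) j * w j 0.
  rewrite (reindex (fun j : 'I_#|{: core S}| => enum_val j)) /=; last first.
    by apply: onW_bij; exists enum_rank; [exact: enum_valK|exact: enum_rankK].
  by apply: eq_bigr => j _; rewrite !mxE enum_rankK.
by move/eqP: h; rewrite subr_eq addrC => /eqP ->.
Qed.

Lemma core_equation (l : R[i]) (u : S -> R[i]) : core_regular S l ->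
  (forall al, al \in core S -> u al = \sum_(v < n)
     resolvent al (chan v 0%N) l * (fb v 0)%:C * u (chan v 1%N)) ->
  forall al, al \in core S -> apply_matrix L u al = l * u al.
Proof.
move=> reg uE al alc; rewrite apply_matrix_core //.
by rewrite (resolvent_equation reg uE (FSetSub alc)) addrK.
Qed.

End Particles.

(** * The spectral variables *)

Section SpectralVariables.
Context {R : realType} (S : multichannel_system R).
Local Notation C := (R[i]^o).
Local Notation n := (nchan S).

Lemma closed_diskE (z : C) : closed_disk z <-> cabs z <= 1.
Proof. by rewrite /closed_disk /= cabs_le1. Qed.

Lemma open_diskE (z : C) : open_disk z <-> cabs z < 1.
Proof. by rewrite /open_disk /= cabs_lt1. Qed.

Lemma unit_circleE (z : C) : unit_circle z <-> cabs z = 1.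
Proof. exact: cabs_is1. Qed.

Lemma cabs1_neq0 (z : C) : cabs z = 1 -> z != 0.
Proof. by move=> z1; rewrite -cabs_gt0 z1. Qed.

Lemma conj_unit (z : C) : cabs z = 1 -> (z^*%C : C) = z^-1.
Proof.
move=> z1; have z0 := cabs1_neq0 z1.
apply: (mulfI z0); rewrite divff //; have := sqr_normc z.
by rewrite norm_cabs z1 rmorph1 expr1n => ->.
Qed.

Lemma zhukovsky_inv a b (z : C) : zhukovsky a b z^-1 = zhukovsky a b z.
Proof. by rewrite /zhukovsky invrK addrC [in RHS]addrC [z + _]addrC. Qed.

Lemma zhukovsky_conj a b (z : C) :
  (zhukovsky a b z)^*%C = zhukovsky a b (z^*%C : C).
Proof.
rewrite /zhukovsky rmorphB rmorphM rmorphD fmorphV.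
by congr (_ - _ * _); exact: conjc_real.
Qed.

Lemma zhukovsky_quadratic a (b : R) (z l : C) : 0 < b -> z != 0 ->
  (zhukovsky a b z = l <-> z ^+ 2 - (a%:C - l) / b%:C * z + 1 = 0).
Proof.
move=> b0 z0; have bC : (b%:C : C) != 0 by exact: realC_neq0.
rewrite /zhukovsky; split => [<-|q].
  by field; rewrite bC z0.
have -> : z + z^-1 = (a%:C - l) / b%:C.
  apply: (mulIf z0); rewrite mulrDl mulVf // -expr2.
  by apply/eqP; rewrite -subr_eq0 addrAC q.
by rewrite mulrC divfK // opprB addrC subrK.
Qed.

(** The Zhukovsky map is two to one, z and z^-1 having the same image. *)
Lemma zhukovsky_eq a (b : R) (z w : C) : 0 < b -> z != 0 -> w != 0 ->
  zhukovsky a b z = zhukovsky a b w -> z = w \/ z * w = 1.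
Proof.
move=> b0 z0 w0 /addrI /oppr_inj /(mulfI (realC_neq0 b0)) e.
have : (z - w) * (z * w - 1) = 0.
  have -> : (z - w) * (z * w - 1) = z * w * ((z + z^-1) - (w + w^-1)).
    by field; rewrite z0 w0.
  by rewrite e subrr mulr0.
move/eqP; rewrite mulf_eq0 !subr_eq0 => /orP[]/eqP; by [left|right].
Qed.

Lemma Im_inv (z : C) : complex.Im (z^-1 : R[i]) = - complex.Im z / cabs z ^+ 2.
Proof. by rewrite sqr_cabs; case: z => x y /=; rewrite mulNr. Qed.

Lemma Re_inv (z : C) : complex.Re (z^-1 : R[i]) = complex.Re z / cabs z ^+ 2.
Proof. by rewrite sqr_cabs; case: z => x y. Qed.

Lemma Im_zhukovsky a b (z : C) : complex.Im (zhukovsky a b z) =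
  b * complex.Im z * ((cabs z ^+ 2)^-1 - 1).
Proof.
have h := Im_inv z; rewrite /zhukovsky; move: h; case: (z^-1) => u v /= ->.
by case: z => x y /=; ring.
Qed.

Lemma Re_zhukovsky a b (z : C) : complex.Re (zhukovsky a b z) =
  a - b * complex.Re z * ((cabs z ^+ 2)^-1 + 1).
Proof.
have h := Re_inv z; rewrite /zhukovsky; move: h; case: (z^-1) => u v /= ->.
by case: z => x y /=; ring.
Qed.

Lemma eq_complexP (z w : C) : complex.Re z = complex.Re w ->
  complex.Im z = complex.Im w -> z = w.
Proof. by case: z w => [x y] [x' y'] /= -> ->. Qed.

Lemma nonreal_conj (l : C) : complex.Im l != 0 -> l != (l^*%C : C).
Proof.
apply: contra => /eqP h; have /= := congr1 (@complex.Im R) h.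
by case: (l) => x y /= /eqP; rewrite -subr_eq0 opprK -mulr2n mulrn_eq0.
Qed.

(** Each band lies in the spectrum because the spectrum is the union of the
    bands. *)
Lemma band_edges (g : 'I_n) :
  spec_a S - 2 * spec_b S <= chan_a g - 2 * chan_b g /\
  chan_a g + 2 * chan_b g <= spec_a S + 2 * spec_b S.
Proof.
have b0 := chan_b_gt0 g; have h := bands_union S.
have sub x : chan_a g - 2 * chan_b g <= x <= chan_a g + 2 * chan_b g ->
    spec_a S - 2 * spec_b S <= x <= spec_a S + 2 * spec_b S.
  move=> xg; have : (\bigcup_s `[chan_a (s : 'I_n) - 2 * chan_b s,
     chan_a s + 2 * chan_b s]%classic) x.
    by exists g => //=; rewrite in_itv.
  by rewrite h /= in_itv.
have /andP[h1 _] : spec_a S - 2 * spec_b S <= chan_a g - 2 * chan_b g <=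
    spec_a S + 2 * spec_b S by apply: sub; lra.
have /andP[_ h2] : spec_a S - 2 * spec_b S <= chan_a g + 2 * chan_b g <=
    spec_a S + 2 * spec_b S by apply: sub; lra.
by [].
Qed.

Lemma spec_b_gt0 (g : 'I_n) : 0 < spec_b S.
Proof. by have [h1 h2] := band_edges g; have := chan_b_gt0 g; lra. Qed.

(** Such points serve to show that a function does not vanish identically near z:
    there lambda is not real, and selfadjointness excludes degeneracies. *)
Lemma nonreal_near (z : C) (e : R) : cabs z <= 1 -> 0 < e ->
  exists x : C, [/\ x != z, cabs (x - z) < e, cabs x < 1 &
    complex.Im x != 0].
Proof.
move=> z1 e0; pose eta := Num.min (1 / 2) (e / 2).
have eta0 : 0 < eta by rewrite lt_min !divr_gt0.
have eta1 : eta <= 1 / 2 by rewrite ge_min lexx.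
have etae : eta <= e / 2 by rewrite ge_min lexx orbT.
pose sg : R := if 0 <= complex.Im z then 1 else -1.
have sgn : `|sg| = 1 by rewrite /sg; case: ifP; rewrite ?normrN normr1.
have sgI : 0 <= sg * complex.Im z.
  by rewrite /sg; case: ifP => [h|/negbT]; [rewrite mul1r|rewrite -ltNge; lra].
pose x (c : R) : C := (1 - eta)%:C * z + Complex 0 (sg * (eta * c)).
have iabs (c : R) : cabs (Complex 0 c : C) = `|c|.
  apply/eqP; rewrite -(@eqrXn2 _ 2) ?cabs_ge0 // sqr_cabs /= expr0n add0r.
  by rewrite real_normK ?num_real.
have xP (c : R) : 0 < c <= 1 / 2 -> [/\ cabs (x c - z) < e, cabs (x c) < 1 &
    complex.Im (x c) != 0].
  move=> /andP[c0 c1]; split.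
  - have -> : x c - z = - (eta%:C * z) + Complex 0 (sg * (eta * c)).
      by rewrite /x rmorphB rmorph1; ring.
    apply: le_lt_trans (cabsD _ _) _.
    rewrite cabsN cabsM cabs_real iabs !normrM sgn !gtr0_norm //.
    have : eta * cabs z <= eta * 1 by rewrite ler_wpM2l // ltW.
    by have := ler_wpM2l (ltW eta0) c1; lra.
  - apply: le_lt_trans (cabsD _ _) _.
    rewrite cabsM cabs_real iabs !normrM sgn !gtr0_norm //; last by lra.
    have : (1 - eta) * cabs z <= (1 - eta) * 1 by rewrite ler_wpM2l //; lra.
    by have := ler_wpM2l (ltW eta0) c1; lra.
  - have -> : complex.Im (x c) = (1 - eta) * complex.Im z + sg * (eta * c).
      by rewrite /x; case: (z) => u v /=; ring.
    have -> : complex.Im z = sg * (sg * complex.Im z).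
      by rewrite mulrA -expr2 -real_normK ?num_real // sgn expr1n mul1r.
    have -> : (1 - eta) * (sg * (sg * complex.Im z)) + sg * (eta * c) =
      sg * ((1 - eta) * (sg * complex.Im z) + eta * c) by ring.
    rewrite mulf_neq0 //; first by rewrite -normr_eq0 sgn oner_eq0.
    by rewrite gt_eqF // ltr_wpDl ?mulr_gt0 // mulr_ge0 // subr_ge0; lra.
have h2 := xP (1 / 2) _; have h3 := xP (1 / 3) _.
have [e2|ne2] := eqVneq (x (1 / 2)) z; last first.
  by exists (x (1 / 2)); have [] := h2; [lra|split].
have [e3|ne3] := eqVneq (x (1 / 3)) z; last first.
  by exists (x (1 / 3)); have [] := h3; [lra|split].
exfalso; move: e2; rewrite -e3 /x => /addrI /(congr1 (@complex.Im R)) /=.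
have sg0 : sg != 0 by rewrite -normr_eq0 sgn oner_eq0.
by move=> /(mulfI sg0) /(mulfI (lt0r_neq0 eta0)); lra.
Qed.

Lemma finite_isolated (A : set C) (z : C) : finite_set A ->
  exists2 d : R, 0 < d & forall x, A x -> x != z -> d <= cabs (x - z).
Proof.
move=> /finite_seqP[s ->]; elim: s => [|y s [d d0 dP]].
  by exists 1 => // x; rewrite /= in_nil.
have [yz|yz] := eqVneq y z.
  exists d => // x /=; rewrite in_cons => /orP[/eqP ->|]; last exact: dP.
  by rewrite yz eqxx.
exists (Num.min d (cabs (y - z))).
  by rewrite lt_min d0 cabs_gt0 subr_eq0.
move=> x /=; rewrite in_cons => /orP[/eqP -> _|xs xz].
  by rewrite ge_min lexx orbT.
by rewrite ge_min dP.
Qed.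

Lemma within_cvgE (D : set C) (f : C -> C) z : {within D, continuous f} ->
  D z -> forall e : R, 0 < e -> exists2 d : R, 0 < d & forall x, D x ->
    cabs (x - z) < d -> cabs (f x - f z) < e.
Proof.
move=> /subspace_continuousP fc /fc /cvgC h e /h /nbhsC[d d0 dP].
by exists d => // x Dx xd; exact: dP.
Qed.

Variable th : 'I_n -> C -> C.
Hypothesis th_theta : is_theta th.

Lemma th_cont g (z : C) (e : R) : cabs z <= 1 -> 0 < e ->
  exists2 d : R, 0 < d & forall x, cabs x <= 1 -> cabs (x - z) < d ->
    cabs (th g x - th g z) < e.
Proof.
move=> z1 e0; have [_ _ hc] := th_theta g.
have zD : closed_disk z by apply/closed_diskE.
have [d d0 dP] := within_cvgE hc zD e0.
by exists d => // x /closed_diskE xD; exact: dP.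
Qed.

Lemma th_open g (z : C) : cabs z < 1 -> z != 0 ->
  [/\ cabs (th g z) < 1, th g z != 0 &
      zhukovsky (chan_a g) (chan_b g) (th g z) = lambda S z].
Proof.
move=> /open_diskE z1 z0; have [_ h _] := th_theta g.
by have [/open_diskE] := h z z1 z0; split.
Qed.

Lemma th_at0 g : th g 0 = 0.
Proof. by have [] := th_theta g. Qed.

Lemma approach_seq (z : C) : cabs z <= 1 -> z != 0 ->
  exists2 t : nat -> R, forall k, 0 < t k < 1 &
    (fun k => (t k)%:C * z : C) @ \oo --> z.
Proof.
move=> z1 z0; exists (fun k => 1 - 2 ^- k.+1) => [k|].
  have : (0 : R) < 2 ^- k.+1 by rewrite invr_gt0 exprn_gt0.
  have : (2 : R) ^- k.+1 < 1 by rewrite invf_lt1 ?exprn_gt0 // exprn_egt1 // ltr1n.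
  by move=> h1 h2; apply/andP; split; lra.
apply/cvg_seqC => e e0; have [N NP] := pow2_unbounded (e^-1).
exists N => k Nk.
have -> : (1 - 2 ^- k.+1)%:C * z - z = - ((2 ^- k.+1)%:C * z).
  by rewrite rmorphB rmorph1; ring.
rewrite cabsN cabsM cabs_real ger0_norm ?invr_ge0 ?exprn_ge0 //.
apply: (@le_lt_trans _ _ (2 ^- k.+1)).
  by rewrite ler_piMr ?invr_ge0 ?exprn_ge0.
rewrite invf_plt ?posrE ?exprn_gt0 //; apply: lt_le_trans NP _.
by rewrite ler_weXn2l ?ler1n // ltnW // ltnS.
Qed.

Lemma th_seq g (z : C) (x : nat -> C) : cabs z <= 1 ->
  (forall k, cabs (x k) <= 1) -> x @ \oo --> z ->
  (fun k => th g (x k)) @ \oo --> th g z.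
Proof.
move=> z1 x1 /cvg_seqC xz; apply/cvg_seqC => e e0.
have [d d0 dP] := th_cont g z1 e0; have [N NP] := xz d d0.
by exists N => k Nk; apply: dP => //; exact: NP.
Qed.

Lemma lambda_derivable (z : C) : z != 0 -> derivable (lambda S) z 1.
Proof.
move=> z0; rewrite /lambda /zhukovsky; apply: derivableCB.
  exact: derivableCc.
apply: derivableCM; first exact: derivableCc.
by apply: derivableCD; [exact: derivableCid|exact: derivableCinv].
Qed.

Lemma seq_cvg_comp (f : C -> C) (z : C) (x : nat -> C) : f @ z --> f z ->
  x @ \oo --> z -> (fun k => f (x k)) @ \oo --> f z.
Proof.
move=> /cvg_nbhsC fc /cvg_seqC xz; apply/cvg_seqC => e /fc[d d0 dP].
by have [N NP] := xz d d0; exists N => k Nk; apply: dP; exact: NP.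
Qed.

(** theta_g + theta_g^-1 as a function of the point of the disk. *)
Definition chan_w (g : 'I_n) (z : C) : C := ((chan_a g)%:C - lambda S z) / (chan_b g)%:C.

Lemma chan_w_derivable g (z : C) : z != 0 -> derivable (chan_w g) z 1.
Proof.
move=> z0; apply: derivableCM; last exact: derivableCc.
by apply: derivableCB; [exact: derivableCc|exact: lambda_derivable].
Qed.

(** Approach z along the radius and pass to the limit in the quadratic equation,
    which also keeps th g z away from 0. *)
Lemma th_closed g (z : C) : cabs z <= 1 -> z != 0 ->
  [/\ cabs (th g z) <= 1, th g z != 0 &
      zhukovsky (chan_a g) (chan_b g) (th g z) = lambda S z].
Proof.
move=> z1 z0; have [t t01 tz] := approach_seq z1 z0.
pose x k := (t k)%:C * z.
have b0 := chan_b_gt0 g.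
have x1 k : cabs (x k) < 1.
  have /andP[t0 t1] := t01 k; rewrite cabsM cabs_real gtr0_norm //.
  by apply: le_lt_trans t1; rewrite ler_piMr // ltW.
have x0 k : x k != 0.
  have /andP[t0 t1] := t01 k; rewrite mulf_neq0 //; exact: realC_neq0.
have thx : (fun k => th g (x k)) @ \oo --> th g z.
  by apply: th_seq => // k; rewrite ltW.
have wx : (fun k => chan_w g (x k)) @ \oo --> chan_w g z.
  apply: seq_cvg_comp tz; apply: derivable_continuousC.
  exact: chan_w_derivable.
have quad : th g z ^+ 2 - chan_w g z * th g z + 1 = 0.
  have : (fun k => th g (x k) * th g (x k) - chan_w g (x k) * th g (x k) + 1)
      @ \oo --> th g z * th g z - chan_w g z * th g z + 1.
    apply: cvgCD; last exact: cvg_cst.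
    by apply: cvgCB; apply: cvgCM; [exact: thx|exact: thx|exact: wx|exact: thx].
  rewrite -expr2 => /cvg_seq_unique; apply.
  apply: (@cvg_seq_eq _ (fun=> 0) _ _ 0%N) => [k _|]; last exact: cvg_cst.
  have [_ h1 h2] := th_open g (x1 k) (x0 k).
  by move/(zhukovsky_quadratic _ _ b0 h1): h2; rewrite -expr2 => ->.
have th0 : th g z != 0.
  apply/eqP => e; move: quad; rewrite e expr0n mulr0 subr0 add0r => /eqP.
  by rewrite oner_eq0.
split=> //; last exact/(zhukovsky_quadratic _ _ b0 th0).
rewrite leNgt; apply/negP => h.
have [N NP] := (cvg_seqC _ _).1 thx (cabs (th g z) - 1) ltac:(by rewrite subr_gt0).
have := NP N (leqnn _); have [h1 _ _] := th_open g (x1 N) (x0 N).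
by have := cabs_lb (th g z) (th g (x N)); rewrite cabs_distC; lra.
Qed.

Lemma th_quad g (z : C) : cabs z <= 1 -> z != 0 ->
  th g z ^+ 2 - chan_w g z * th g z + 1 = 0.
Proof.
move=> z1 z0; have [_ h1 h2] := th_closed g z1 z0.
by apply/(zhukovsky_quadratic _ _ (chan_b_gt0 g) h1).
Qed.

Lemma Im_lambda (z : C) : complex.Im (lambda S z) =
  spec_b S * complex.Im z * ((cabs z ^+ 2)^-1 - 1).
Proof. exact: Im_zhukovsky. Qed.

Lemma Im_lambda_circle (z : C) : cabs z = 1 -> complex.Im (lambda S z) = 0.
Proof. by move=> z1; rewrite Im_lambda z1 expr1n invr1 subrr mulr0. Qed.

Lemma nonreal_lambda (z : C) : 'I_n -> cabs z < 1 -> complex.Im z != 0 ->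
  complex.Im (lambda S z) != 0.
Proof.
move=> g z1 Iz; have z0 : 0 < cabs z.
  by rewrite cabs_gt0; apply: contraNneq Iz => ->.
rewrite Im_lambda !mulf_neq0 //; first by rewrite gt_eqF // (spec_b_gt0 g).
rewrite subr_eq0 invr_eq1 -cabsX; apply/eqP => h.
have : cabs z ^+ 2 < 1 by rewrite exprn_ilt1 // ltW.
by rewrite -cabsX h ltxx.
Qed.

Lemma zhukovsky_Im_sign (a b a' b' : R) (z w : C) : 0 < b -> 0 < b' ->
  z != 0 -> w != 0 -> cabs z < 1 -> cabs w < 1 ->
  zhukovsky a b z = zhukovsky a' b' w ->
  0 <= complex.Im z * complex.Im w.
Proof.
move=> b0 b'0 z0 w0 z1 w1 /(congr1 (@complex.Im R)).
rewrite !Im_zhukovsky => h.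
have pos (u : C) : u != 0 -> cabs u < 1 -> 0 < (cabs u ^+ 2)^-1 - 1.
  move=> u0 u1; have u2 : 0 < cabs u by rewrite cabs_gt0.
  rewrite subr_gt0 invf_gt1 ?exprn_gt0 // exprn_ilt1 //.
  exact: ltW.
have p1 := pos z z0 z1; have p2 := pos w w0 w1.
have k1 : 0 < b * ((cabs z ^+ 2)^-1 - 1) by rewrite mulr_gt0.
have k2 : 0 < b' * ((cabs w ^+ 2)^-1 - 1) by rewrite mulr_gt0.
have : 0 <= (complex.Im z * complex.Im w) * (b' * ((cabs w ^+ 2)^-1 - 1)).
  have -> : complex.Im z * complex.Im w * (b' * ((cabs w ^+ 2)^-1 - 1)) =
    complex.Im z ^+ 2 * (b * ((cabs z ^+ 2)^-1 - 1)).
    transitivity (complex.Im z * (b' * complex.Im w * ((cabs w ^+ 2)^-1 - 1))).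
      by ring.
    by rewrite -h; ring.
  by rewrite mulr_ge0 ?sqr_ge0 // ltW.
by rewrite pmulr_lge0.
Qed.

(** On the open disk the imaginary parts of z, of every th g z and of lambda have
    the same sign, since Im (z + z^-1) has the sign of - Im z there; the circle
    is reached along radii. *)
Lemma th_Im_sign g h (z : C) : cabs z <= 1 -> z != 0 ->
  0 <= complex.Im (th g z) * complex.Im (th h z) /\
  0 <= complex.Im (th g z) * complex.Im z.
Proof.
move=> z1 z0; have [t t01 tz] := approach_seq z1 z0.
pose x k := (t k)%:C * z.
have x1 k : cabs (x k) < 1.
  have /andP[t0 t1] := t01 k; rewrite cabsM cabs_real gtr0_norm //.
  by apply: le_lt_trans t1; rewrite ler_piMr // ltW.
have x0 k : x k != 0.
  have /andP[t0 t1] := t01 k; rewrite mulf_neq0 //; exact: realC_neq0.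
have thx g' : (fun k => th g' (x k)) @ \oo --> th g' z.
  by apply: th_seq => // k; rewrite ltW.
have lim (u v : nat -> C) (l m : C) : u @ \oo --> l -> v @ \oo --> m ->
    (forall k, 0 <= complex.Im (u k) * complex.Im (v k)) ->
    0 <= complex.Im l * complex.Im m.
  move=> ul vm uv; rewrite leNgt; apply/negP => neg.
  pose e := Num.min (1 / 2) (- (complex.Im l * complex.Im m) /
      (4 * (`|complex.Im l| + `|complex.Im m| + 1))).
  have d0 : 0 < 4 * (`|complex.Im l| + `|complex.Im m| + 1).
    by rewrite mulr_gt0 // ltr_wpDl // addr_ge0.
  have e0 : 0 < e by rewrite lt_min !divr_gt0 // oppr_gt0.
  have e1 : e <= 1 / 2 by rewrite ge_min lexx.
  have e2 : e * (4 * (`|complex.Im l| + `|complex.Im m| + 1)) <=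
      - (complex.Im l * complex.Im m).
    by rewrite -ler_pdivlMr // ge_min lexx orbT.
  have [N1 N1P] := (cvg_seqC _ _).1 ul e e0.
  have [N2 N2P] := (cvg_seqC _ _).1 vm e e0.
  have := N1P _ (leq_maxl N1 N2); have := N2P _ (leq_maxr N1 N2).
  set k := maxn N1 N2; have := uv k.
  have := le_Im_cabs (u k - l); have := le_Im_cabs (v k - m).
  have -> : complex.Im (u k - l) = complex.Im (u k) - complex.Im l.
    by case: (u k) (l) => [? ?] [].
  have -> : complex.Im (v k - m) = complex.Im (v k) - complex.Im m.
    by case: (v k) (m) => [? ?] [].
  move: (complex.Im (u k)) (complex.Im (v k)) => a b.
  move: neg e2; move: (complex.Im l) (complex.Im m) => a' b' neg e2.
  move=> h1 h2 ab h3 h4.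
  have {h1}h1 : `|b - b'| < e by apply: le_lt_trans h1 h3.
  have {h2}h2 : `|a - a'| < e by apply: le_lt_trans h2 h4.
  have E : a * b = a' * b' + (a - a') * b' + a' * (b - b') + (a - a') * (b - b').
    by ring.
  have p1 : `|(a - a') * b'| <= e * `|b'| by rewrite normrM ler_wpM2r // ltW.
  have p2 : `|a' * (b - b')| <= e * `|a'|.
    by rewrite normrM mulrC ler_wpM2r // ltW.
  have p3 : `|(a - a') * (b - b')| <= e * e.
    by rewrite normrM ler_pM // ltW.
  have q1 := ler_norm ((a - a') * b'); have q2 := ler_norm (a' * (b - b')).
  have q3 := ler_norm ((a - a') * (b - b')).
  have q4 : e * e <= e * 1 by rewrite ler_wpM2l //; lra.
  have q5 : 0 <= e * `|a'| by rewrite mulr_ge0 // ltW.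
  have q6 : 0 <= e * `|b'| by rewrite mulr_ge0 // ltW.
  by move: e2; rewrite mulrCA !mulrDr mulr1; lra.
split.
  apply: (lim _ _ _ _ (thx g) (thx h)) => k.
  have [a1 a2 a3] := th_open g (x1 k) (x0 k).
  have [b1 b2 b3] := th_open h (x1 k) (x0 k).
  exact: (zhukovsky_Im_sign (chan_b_gt0 g) (chan_b_gt0 h) a2 b2 a1 b1
    (etrans a3 (esym b3))).
apply: (lim _ _ _ _ (thx g) tz) => k.
have [a1 a2 a3] := th_open g (x1 k) (x0 k).
exact: (zhukovsky_Im_sign (chan_b_gt0 g) (spec_b_gt0 g) a2 (x0 k) a1 (x1 k) a3).
Qed.

End SpectralVariables.

(** * Continuation of the spectral variables across the circle *)

Section ThetaExtension.
Context {R : realType} (S : multichannel_system R).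
Local Notation C := (R[i]^o).
Local Notation n := (nchan S).
Variable th : 'I_n -> C -> C.
Hypothesis th_theta : is_theta th.

(** The implicit function theorem for a quadratic equation: subtracting its
    instances at x and z expresses f x - f z by w x - w z, with a denominator
    which tends to f z - (f z)^-1. *)
Lemma simple_root_derivable (f w : C -> C) (z : C) : f @ z --> f z ->
  (\forall x \near z, f x ^+ 2 - w x * f x + 1 = 0) -> derivable w z 1 ->
  f z ^+ 2 != 1 -> derivable f z 1.
Proof.
move=> fc quad wd f1; have qz := nbhs_singleton quad.
have f0 : f z != 0.
  by apply/eqP => e; move: qz; rewrite e expr0n mulr0 subr0 add0r => /eqP; rewrite oner_eq0.
have wE : w z = f z + (f z)^-1.
  apply: (mulIf f0); rewrite mulrDl mulVf // -expr2.
  by apply/eqP; rewrite eq_sym -subr_eq0 addrAC qz.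
have den0 : f z + f z - w z != 0.
  have -> : f z + f z - w z = (f z ^+ 2 - 1) / f z by rewrite wE; field.
  by rewrite mulf_neq0 ?invr_eq0 // subr_eq0.
have /derivable_cvgE[d wd'] := wd.
apply/derivable_cvgE; exists (f z * d * (f z + f z - w z)^-1).
have fd := cvg_nbhs_dnbhs fc.
have wcd := cvg_nbhs_dnbhs (derivable_continuousC wd).
have denc : (fun x => f x + f z - w x) @ z^' --> f z + f z - w z.
  by apply: cvgCB; [apply: cvgCD; [exact: fd|exact: cvg_cst]|exact: wcd].
have dennz : \forall x \near z^', f x + f z - w x != 0.
  move/cvg_dnbhsC: denc => /(_ (cabs (f z + f z - w z))).
  rewrite cabs_gt0 => /(_ den0)[r r0 rP]; apply/dnbhsC; exists r => // x xz xr.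
  apply: contraTneq (rP x xz xr) => ->.
  by rewrite sub0r cabsN ltxx.
apply: (@cvg_dnbhs_eq _ (fun x => f z * ((w x - w z) / (x - z)) *
    (f x + f z - w x)^-1)); last first.
  apply: cvgCM; last exact: (cvgCV den0 denc).
  by apply: cvgCM; [exact: cvg_cst|exact: wd'].
move/nbhsC: quad => [r r0 rP]; move/dnbhsC: dennz => [s s0 sP].
apply/dnbhsC; exists (Num.min r s); first by rewrite lt_min r0.
move=> x xz; rewrite lt_min => /andP[xr xs].
have qx := rP x xr; have nx := sP x xz xs.
have xz0 : x - z != 0 by rewrite subr_eq0.
have key : (f x - f z) * (f x + f z - w x) = f z * (w x - w z).
  apply/eqP; rewrite -subr_eq0; apply/eqP.
  transitivity ((f x ^+ 2 - w x * f x + 1) - (f z ^+ 2 - w z * f z + 1)).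
    by ring.
  by rewrite qx qz subrr.
by rewrite mulrA -key; field; rewrite nx xz0.
Qed.

Lemma th_conj g (z : C) : cabs z <= 1 -> th g (z^*%C : C) = (th g z)^*%C.
Proof.
move=> z1; have [->|z0] := eqVneq z 0; first by rewrite conjc0 (th_at0 th_theta) conjc0.
have opn (x : C) : cabs x < 1 -> x != 0 -> th g (x^*%C : C) = (th g x)^*%C.
  move=> x1 x0; have [a1 a2 a3] := th_open th_theta g x1 x0.
  have x1' : cabs (x^*%C : C) < 1 by rewrite cabs_conj.
  have x0' : (x^*%C : C) != 0 by rewrite conjc_eq0.
  have [b1 b2 b3] := th_open th_theta g x1' x0'.
  have c0 : ((th g x)^*%C : C) != 0 by rewrite conjc_eq0.
  have E : zhukovsky (chan_a g) (chan_b g) (th g (x^*%C : C)) =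
      zhukovsky (chan_a g) (chan_b g) ((th g x)^*%C : C).
    by rewrite b3 -zhukovsky_conj a3 /lambda zhukovsky_conj.
  have [//|e] := zhukovsky_eq (chan_b_gt0 g) b2 c0 E.
  have := congr1 (@cabs R) e; rewrite cabsM cabs_conj cabs1 => h.
  have : cabs (th g (x^*%C : C)) * cabs (th g x) < 1.
    apply: le_lt_trans b1; rewrite ler_piMr ?cabs_ge0 //.
    exact: ltW.
  by rewrite h ltxx.
have [t t01 tz] := approach_seq z1 z0.
pose x k := (t k)%:C * z.
have x1 k : cabs (x k) < 1.
  have /andP[t0 t1] := t01 k; rewrite cabsM cabs_real gtr0_norm //.
  by apply: le_lt_trans t1; rewrite ler_piMr // ltW.
have x0 k : x k != 0.
  have /andP[t0 t1] := t01 k; rewrite mulf_neq0 //; exact: realC_neq0.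
have l1 : (fun k => th g ((x k)^*%C : C)) @ \oo --> th g (z^*%C : C).
  apply: (th_seq th_theta); first by rewrite cabs_conj.
    by move=> k; rewrite cabs_conj ltW.
  exact: conjC_cvg.
have l2 : (fun k => (th g (x k))^*%C : C) @ \oo --> ((th g z)^*%C : C).
  exact: conjC_cvg (th_seq th_theta z1 (fun k => ltW (x1 k)) tz).
apply: (cvg_seq_unique l1); apply: (@cvg_seq_eq _ _ _ _ 0%N _ l2) => k _.
by rewrite opn.
Qed.

Lemma th_circle g (z : C) : cabs z = 1 ->
  cabs (th g z) = 1 \/ complex.Im (th g z) = 0.
Proof.
move=> z1; have z0 := cabs1_neq0 z1.
have [|a1 a2 a3] := th_closed th_theta g _ z0; first by rewrite z1.
have := congr1 (@complex.Im R) a3; rewrite Im_lambda_circle // Im_zhukovsky.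
move=> /eqP; rewrite !mulf_eq0 (gt_eqF (chan_b_gt0 g)) /=.
case/orP => [/eqP h|]; [by right|rewrite subr_eq0 => h; left].
apply/eqP; rewrite -(@pexpr_eq1 _ _ 2) ?cabs_ge0 // -[_ ^+ 2]invrK.
by rewrite (eqP h) invr1.
Qed.

(** The two solutions of the equation of theta_g outside the closed disk: the
    reflection of a function which has modulus 1 on the circle, and that of a
    function which is real there. *)
Definition theta_outer (b : bool) (g : 'I_n) (z : C) : C :=
  if b then (th g z^-1)^-1 else th g z^-1.

(** The solution outside the disk is selected by the behaviour of theta_g at the
    radial projection of z. The selection is locally constant except near the
    points of the circle which are not regular. *)
Definition theta_ext (g : 'I_n) (z : C) : C :=
  if cabs z <= 1 then th g z
  else theta_outer (cabs (th g (z / (cabs z)%:C)) == 1) g z.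

(** An edge of the band of g is a square root branch point of theta_g, unless it
    is also an edge of the spectrum: then theta_g and the variable z branch
    together, at z = 1 or z = -1. *)
Definition regular_point (g : 'I_n) (z : C) : Prop :=
  th g z ^+ 2 != 1 \/ (z = 1 \/ z = -1).

Lemma theta_outer_circle g (z : C) : cabs z = 1 ->
  theta_outer (cabs (th g z) == 1) g z = th g z.
Proof.
move=> z1; rewrite /theta_outer -(conj_unit z1) th_conj ?z1 //.
case: eqP => [t1|t1]; first by rewrite (conj_unit t1) invrK.
have [//|] := th_circle g z1; case: (th g z) => x y /= ->.
by rewrite oppr0.
Qed.

Lemma chan_w_inv (g : 'I_n) (z : C) : chan_w g z^-1 = chan_w g z.
Proof. by rewrite /chan_w /lambda zhukovsky_inv. Qed.

Lemma inv_root (f w : C) : f != 0 -> f ^+ 2 - w * f + 1 = 0 ->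
  f^-1 ^+ 2 - w * f^-1 + 1 = 0.
Proof.
move=> f0 q; have -> : f^-1 ^+ 2 - w * f^-1 + 1 = (f ^+ 2 - w * f + 1) / f ^+ 2.
  by field.
by rewrite q mul0r.
Qed.

Lemma theta_ext_quad g (z : C) : z != 0 ->
  theta_ext g z ^+ 2 - chan_w g z * theta_ext g z + 1 = 0.
Proof.
move=> z0; rewrite /theta_ext; case: ifPn => [z1|]; first exact: th_quad.
rewrite -ltNge => z1; have iz1 : cabs z^-1 <= 1.
  by rewrite cabsV invf_le1 ?(ltW z1) // (lt_trans ltr01).
have iz0 : z^-1 != 0 by rewrite invr_eq0.
have := th_quad th_theta g iz1 iz0; rewrite chan_w_inv /theta_outer => q.
have [_ h _] := th_closed th_theta g iz1 iz0.
by case: ifP => _ //; exact: inv_root.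
Qed.

Lemma theta_ext_disk g (z : C) : cabs z <= 1 -> theta_ext g z = th g z.
Proof. by rewrite /theta_ext => ->. Qed.

Lemma sqr_eq1 (x : C) : x ^+ 2 = 1 -> x = 1 \/ x = -1.
Proof. by move=> /eqP; rewrite sqrf_eq1 => /orP[]/eqP; [left|right]. Qed.

(** With the opposite sign, the lower edge of the band would be the upper edge of
    the spectrum, or conversely; but the band is contained in the spectrum. *)
Lemma edge_sign g (z : C) : z = 1 \/ z = -1 -> th g z ^+ 2 = 1 -> th g z = z.
Proof.
move=> zE t2; have b0 := chan_b_gt0 g; have [e1 e2] := band_edges g.
have z1 : cabs z = 1 by case: zE => ->; rewrite ?cabsN cabs1.
have z0 := cabs1_neq0 z1.
have [|_ _] := th_closed th_theta g _ z0; first by rewrite z1.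
have ReE a b : complex.Re (zhukovsky a b (1 : C)) = a - 2 * b.
  by rewrite Re_zhukovsky cabs1 /= expr1n invr1; ring.
have ReN a b : complex.Re (zhukovsky a b (-1 : C)) = a + 2 * b.
  by rewrite Re_zhukovsky cabsN cabs1 /= expr1n invr1; ring.
case: (sqr_eq1 t2) => ->; case: zE => ->; rewrite /lambda // => h; exfalso.
  by have := congr1 (@complex.Re R) h; rewrite ReE ReN; lra.
by have := congr1 (@complex.Re R) h; rewrite ReE ReN; lra.
Qed.

Lemma Re_lambda_circle (z : C) : cabs z = 1 ->
  complex.Re (lambda S z) = spec_a S - 2 * spec_b S * complex.Re z.
Proof. by move=> z1; rewrite /lambda Re_zhukovsky z1 expr1n invr1; ring. Qed.

Lemma Re_circle_bounds (z : C) : cabs z = 1 -> -1 <= complex.Re z <= 1.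
Proof. by move=> z1; have := le_Re_cabs z; rewrite z1 ler_norml. Qed.

(** The band of g and the spectrum share this edge, and lambda maps the circle
    into the spectrum; hence near the edge its values lie in the band. *)
Lemma edge_inside g (z : C) : z = 1 \/ z = -1 -> th g z ^+ 2 = 1 ->
  exists2 d : R, 0 < d & forall x, cabs x = 1 -> cabs (x - z) < d ->
    cabs (th g x) = 1.
Proof.
move=> zE t2; have tz := edge_sign zE t2.
have b0 := chan_b_gt0 g; have [e1 e2] := band_edges g.
have z1 : cabs z = 1 by case: zE => ->; rewrite ?cabsN cabs1.
have sb0 := spec_b_gt0 g.
have zl : cabs z <= 1 by rewrite z1.
have [d d0 dP] := th_cont th_theta g zl ltr01; exists d => // x x1 xd.
have [//|Im0] := th_circle g x1.
have xl : cabs x <= 1 by rewrite x1.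
have x0 := cabs1_neq0 x1.
have [a1 a2 a3] := th_closed th_theta g xl x0.
have := dP x xl xd; rewrite tz.
have := congr1 (@complex.Re R) a3; rewrite Re_lambda_circle // Re_zhukovsky.
have := Re_circle_bounds x1; move=> /andP[rx1 rx2].
have := sqr_cabs (th g x); rewrite Im0 expr0n addr0.
have ac : 0 < cabs (th g x) by rewrite cabs_gt0.
have := le_Re_cabs (th g x - z).
have -> : complex.Re (th g x - z) = complex.Re (th g x) - complex.Re z.
  by case: (th g x) (z) => [? ?] [].
move: (complex.Re (th g x)) (complex.Re x) rx1 rx2 => r rx rx1 rx2.
move=> h1 h2 h3 h4.
have {h1 h4}h1 : `|r - complex.Re z| < 1 by apply: le_lt_trans h1 h4.
move: h1; rewrite ltr_norml => /andP[h1 h4].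
apply/eqP; rewrite eq_le a1 /=.
rewrite -(@ler_sqr _ 1) ?nnegrE ?cabs_ge0 // expr1n h2.
have r0 : r != 0.
  apply: contraTneq ac => r0; move: h2; rewrite r0 expr0n => /eqP.
  by rewrite expf_eq0 => /eqP ->; rewrite ltxx.
have h3' : chan_a g - chan_b g * (r + r^-1) = spec_a S - 2 * spec_b S * rx.
  by rewrite -h3 h2; field.
have edge : chan_a g - 2 * chan_b g * complex.Re z =
    spec_a S - 2 * spec_b S * complex.Re z.
  have [_ _] := th_closed th_theta g zl (cabs1_neq0 z1); rewrite tz => h.
  have := congr1 (@complex.Re R) h; rewrite Re_lambda_circle // => <-.
  by rewrite Re_zhukovsky z1 expr1n invr1; ring.
case: zE h1 h4 edge => -> /= h1 h4 edge.
  have rp : 0 < r by lra.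
  have : r + r^-1 <= 2.
    rewrite -(ler_pM2l b0).
    have : spec_b S * rx <= spec_b S * 1 by rewrite ler_wpM2l // ltW.
    by lra.
  move=> h5; have : (r - 1) ^+ 2 <= 0.
    have : r * (r + r^-1) <= r * 2 by rewrite ler_wpM2l // ltW.
    by rewrite mulrDr mulfV // expr2; lra.
  move=> h6; have : r - 1 = 0.
    by apply/eqP; rewrite -sqrf_eq0 eq_le h6 sqr_ge0.
  by move=> /subr0_eq ->; rewrite expr1n.
have rp : r < 0 by lra.
have : - 2 <= r + r^-1.
  rewrite -(ler_pM2l b0).
  have : spec_b S * -1 <= spec_b S * rx by rewrite ler_wpM2l // ltW.
  by lra.
move=> h5; have : (r + 1) ^+ 2 <= 0.
  have : r * (r + r^-1) <= r * - 2 by rewrite ler_wnM2l // ltW.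
  by rewrite mulrDr mulfV // expr2; lra.
move=> h6; have : r + 1 = 0.
  by apply/eqP; rewrite -sqrf_eq0 eq_le h6 sqr_ge0.
by move=> /eqP; rewrite addr_eq0 => /eqP ->; rewrite sqrrN expr1n.
Qed.

Lemma regular_rule_const g (z : C) : cabs z = 1 -> regular_point g z ->
  exists2 d : R, 0 < d & forall x, cabs x = 1 -> cabs (x - z) < d ->
    (cabs (th g x) == 1) = (cabs (th g z) == 1).
Proof.
move=> z1 rz; have zl : cabs z <= 1 by rewrite z1.
have [t2|t2] := eqVneq (th g z ^+ 2) 1.
  have zE : z = 1 \/ z = -1 by case: rz => //; rewrite t2 eqxx.
  have [d d0 dP] := edge_inside zE t2; exists d => // x x1 xd.
  by rewrite dP // (edge_sign zE t2) z1.
have [a1 a2 a3] := th_closed th_theta g zl (cabs1_neq0 z1).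
have [tz1|tz1] := eqVneq (cabs (th g z)) 1; last first.
  have e0 : 0 < 1 - cabs (th g z) by rewrite subr_gt0 lt_neqAle tz1.
  have [d d0 dP] := th_cont th_theta g zl e0; exists d => // x x1 xd.
  have xl : cabs x <= 1 by rewrite x1.
  apply/negbTE; rewrite lt_eqF //.
  by have := dP x xl xd; have := cabs_lb (th g x) (th g z); lra.
have I0 : 0 < `|complex.Im (th g z)|.
  rewrite normr_gt0; apply: contra t2 => /eqP I0.
  have := sqr_cabs (th g z); rewrite tz1 I0 expr1n expr0n addr0 => h.
  apply/eqP; move: I0 h; case: (th g z) => x y /= -> h.
  by apply: eq_complexP => /=; rewrite ?mul0r ?mulr0 ?subr0 ?addr0 -?expr2.
have [d d0 dP] := th_cont th_theta g zl I0; exists d => // x x1 xd.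
have xl : cabs x <= 1 by rewrite x1.
have := dP x xl xd; have := le_Im_cabs (th g x - th g z).
have -> : complex.Im (th g x - th g z) = complex.Im (th g x) - complex.Im (th g z).
  by case: (th g x) (th g z) => [? ?] [].
move=> h1 h2; have [->|Im0] := th_circle g x1; first by rewrite eqxx.
by move: (le_lt_trans h1 h2); rewrite Im0 sub0r normrN ltxx.
Qed.

Lemma normalize_close (x y : C) : 1 <= cabs x -> y != 0 ->
  cabs (x / (cabs x)%:C - y / (cabs y)%:C) <= 2 * cabs (x - y).
Proof.
move=> x1 y0; have ax : 0 < cabs x by lra.
have ay : 0 < cabs y by rewrite cabs_gt0.
have axC := realC_neq0 ax; have ayC := realC_neq0 ay.
have -> : x / (cabs x)%:C - y / (cabs y)%:C =
  ((x - y) + (y / (cabs y)%:C) * (cabs y - cabs x)%:C) / (cabs x)%:C.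
  by rewrite rmorphB; field; rewrite axC ayC.
rewrite cabsM cabsV cabs_real gtr0_norm // ler_pdivrMr //.
apply: le_trans (cabsD _ _) _; rewrite !cabsM cabsV !cabs_real (gtr0_norm ay).
rewrite divff ?gt_eqF // mul1r.
have : `|cabs y - cabs x| <= cabs (x - y).
  rewrite ler_norml; have := cabs_lb x y; have := cabs_lb y x.
  by rewrite (cabs_distC y x) => h1 h2; apply/andP; split; lra.
have : 2 * cabs (x - y) <= 2 * cabs (x - y) * cabs x.
  by rewrite ler_peMr // mulr_ge0 ?cabs_ge0.
by lra.
Qed.

Lemma theta_outer_cont (b : bool) g (y : C) (e : R) : 1 <= cabs y -> 0 < e ->
  exists2 d : R, 0 < d & forall x, 1 <= cabs x -> cabs (x - y) < d ->
    cabs (theta_outer b g x - theta_outer b g y) < e.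
Proof.
move=> y1 e0; have ay : 0 < cabs y by lra.
have y0 : y != 0 by rewrite -cabs_gt0.
have iy1 : cabs y^-1 <= 1 by rewrite cabsV invf_le1.
have [_ ty0 _] := th_closed th_theta g iy1 ltac:(by rewrite invr_eq0).
have base (e' : R) : 0 < e' -> exists2 d : R, 0 < d & forall x, 1 <= cabs x ->
    cabs (x - y) < d -> cabs (th g x^-1 - th g y^-1) < e'.
  move=> e'0; have [d d0 dP] := th_cont th_theta g iy1 e'0.
  exists d => // x x1 xd; have ax : 0 < cabs x by lra.
  apply: dP; first by rewrite cabsV invf_le1.
  have x0 : x != 0 by rewrite -cabs_gt0.
  have -> : x^-1 - y^-1 = (y - x) / (x * y) by field; rewrite x0 y0.
  rewrite cabsM cabsV cabsM cabs_distC; apply: le_lt_trans xd.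
  by rewrite ler_piMr ?cabs_ge0 // invf_le1 ?mulr_gt0 // mulr_ege1.
case: b; last exact: base.
have at0 : 0 < cabs (th g y^-1) by rewrite cabs_gt0.
pose e' := Num.min (cabs (th g y^-1) / 2) (e * cabs (th g y^-1) ^+ 2 / 2).
have e'0 : 0 < e' by rewrite lt_min !divr_gt0 // mulr_gt0 // exprn_gt0.
have [d d0 dP] := base e' e'0; exists d => // x x1 xd.
have := dP x x1 xd; rewrite /e' lt_min => /andP[h1 h2].
rewrite /theta_outer; move: ty0 at0 h1 h2; set u := th g x^-1; set v := th g y^-1.
move=> v0 av h1 h2.
have au : cabs v / 2 < cabs u by have := cabs_lb v u; rewrite cabs_distC; lra.
have u0 : u != 0 by rewrite -cabs_gt0; lra.
have -> : u^-1 - v^-1 = (v - u) / (u * v) by field; rewrite u0 v0.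
rewrite cabsM cabsV cabsM cabs_distC ltr_pdivrMr ?mulr_gt0 //; last by lra.
apply: lt_le_trans h2 _; rewrite -mulrA ler_pM2l // expr2 -mulrA.
by rewrite [leRHS]mulrC ler_wpM2l ?(ltW av) // ltW.
Qed.

(** Inside the disk this is the continuity of theta_g; near the circle the
    selection is constant by [regular_rule_const], and the reflected function
    agrees with theta_g on the circle. *)
Lemma theta_ext_cont g (z : C) : cabs z <= 1 ->
  (cabs z = 1 -> regular_point g z) ->
  exists2 d : R, 0 < d & forall y, cabs (y - z) < d ->
    theta_ext g @ y --> theta_ext g y.
Proof.
move=> z1 rz; have inner y : cabs y < 1 -> theta_ext g @ y --> theta_ext g y.
  move=> y1; apply/cvg_nbhsC => e e0.
  have [d d0 dP] := th_cont th_theta g (ltW y1) e0.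
  exists (Num.min d (1 - cabs y)); first by rewrite lt_min d0 subr_gt0.
  move=> x; rewrite lt_min => /andP[xd xy].
  have x1 : cabs x <= 1 by have := cabs_lb x y; lra.
  by rewrite !theta_ext_disk ?(ltW y1) //; exact: dP.
have [zlt|] := ltrP (cabs z) 1.
  exists (1 - cabs z); first by rewrite subr_gt0.
  by move=> y yz; apply: inner; have := cabs_lb y z; lra.
move=> zge; have {z1 zge}z1 : cabs z = 1 by apply/eqP; rewrite eq_le z1.
have [d d0 dP] := regular_rule_const z1 (rz z1).
set b := cabs (th g z) == 1 in dP.
have dd0 : 0 < Num.min (1 / 2) (d / 4) by rewrite lt_min !divr_gt0.
exists (Num.min (1 / 2) (d / 4)) => // y; rewrite lt_min => /andP[yz2 yz].
have y0 : y != 0.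
  by rewrite -cabs_gt0; have := cabs_lb z y; rewrite cabs_distC z1; lra.
have [y1|y1] := ltrP (cabs y) 1; first exact: inner.
have znorm : z / (cabs z)%:C = z by rewrite z1 divr1.
have rule x : 1 <= cabs x -> cabs (x - z) < d / 2 ->
    (cabs (th g (x / (cabs x)%:C)) == 1) = b.
  move=> x1 xz; apply: dP; last first.
    by have := normalize_close x1 (cabs1_neq0 z1); rewrite znorm; lra.
  have ax : 0 < cabs x by lra.
  by rewrite cabsM cabsV cabs_real gtr0_norm // divff // gt_eqF.
have outer x : 1 <= cabs x -> cabs (x - z) < d / 2 ->
    theta_ext g x = theta_outer b g x.
  move=> x1 xz; rewrite /theta_ext rule //; case: ifP => // x1'.
  have {x1 x1'}x1 : cabs x = 1 by apply/eqP; rewrite eq_le x1' x1.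
  rewrite -{1}(theta_outer_circle g x1); congr theta_outer; apply: dP => //.
  by lra.
apply/cvg_nbhsC => e e0.
have [d1 d10 d1P] := theta_outer_cont b g y1 e0.
have [d2 d20 d2P] : exists2 d2 : R, 0 < d2 & forall x, cabs x <= 1 ->
    cabs (x - y) < d2 -> cabs (theta_ext g x - theta_ext g y) < e.
  have [ylt|yle] := ltrP 1 (cabs y).
    exists (cabs y - 1); first by rewrite subr_gt0.
    by move=> x x1; have := cabs_lb y x; rewrite cabs_distC; lra.
  have [d2 d20 d2P] := th_cont th_theta g yle e0; exists d2 => // x x1 xd.
  by rewrite !theta_ext_disk //; exact: d2P.
exists (Num.min (d / 4) (Num.min d1 d2)).
  by rewrite !lt_min d10 d20 divr_gt0.
move=> x; rewrite !lt_min => /and3P[xd xd1 xd2].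
have [x1|x1] := lerP (cabs x) 1; first exact: d2P.
have xz : cabs (x - z) < d / 2 by have := cabs_tri x y z; lra.
rewrite outer ?(ltW x1) // outer //; last by lra.
by apply: d1P => //; rewrite ltW.
Qed.

Lemma theta_ext_derivable g (y : C) : y != 0 ->
  theta_ext g @ y --> theta_ext g y -> theta_ext g y ^+ 2 != 1 ->
  derivable (theta_ext g) y 1.
Proof.
move=> y0 yc y1.
have wd : derivable (chan_w g) y 1 by exact: chan_w_derivable.
apply: (@simple_root_derivable (theta_ext g) (chan_w g) y yc _ wd y1).
apply/nbhsC; exists (cabs y); first by rewrite cabs_gt0.
move=> x xy; apply: theta_ext_quad; apply: contraTneq xy => ->.
by rewrite sub0r cabsN ltxx.
Qed.

Lemma lambda_inj (g : 'I_n) (x y : C) : x != 0 -> y != 0 ->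
  lambda S x = lambda S y -> x = y \/ x * y = 1.
Proof. by move=> x0 y0; apply: zhukovsky_eq; rewrite ?(spec_b_gt0 g). Qed.

(** If th g z ^+ 2 = 1, then z = 1 or z = -1 by regularity. A nearby x with the
    same value has lambda x = lambda z, so that x = z or x z = 1, that is,
    x = z. *)
Lemma theta_ext_sqr_neq1 g (z : C) : cabs z <= 1 -> z != 0 ->
  (cabs z = 1 -> regular_point g z) ->
  \forall x \near z^', theta_ext g x ^+ 2 != 1.
Proof.
move=> z1 z0 rz; have [d d0 dP] := theta_ext_cont z1 rz.
have zc : theta_ext g @ z --> theta_ext g z by apply: dP; rewrite subrr cabs0.
move: zc; rewrite theta_ext_disk // => /[dup] zc' /cvg_nbhsC zc.
have [t2|t2] := eqVneq (th g z ^+ 2) 1; last first.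
  have sqc : (fun x => theta_ext g x * theta_ext g x) @ z --> th g z * th g z.
    exact: (cvgCM zc' zc').
  move/cvg_nbhsC: sqc => /(_ (cabs (th g z ^+ 2 - 1))).
  rewrite cabs_gt0 subr_eq0 => /(_ t2)[r r0 rP]; apply/dnbhsC; exists r => //.
  move=> x _ xr; have := rP x xr; rewrite -!expr2; apply: contraTneq => ->.
  by rewrite cabs_distC ltxx.
have z1' : cabs z = 1.
  apply/eqP; rewrite eq_le z1 /= leNgt; apply/negP => zlt.
  have [h _ _] := th_open th_theta g zlt z0.
  move: t2 => /(congr1 (@cabs R)); rewrite cabsX cabs1 => /eqP.
  by rewrite pexpr_eq1 ?cabs_ge0 // => /eqP e; rewrite e ltxx in h.
have zE : z = 1 \/ z = -1 by case: (rz z1') => //; rewrite t2 eqxx.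
have tz := edge_sign zE t2.
have [r r0 rP] := zc 1 ltr01.
apply/dnbhsC; exists (Num.min r (cabs z)); first by rewrite lt_min r0 cabs_gt0.
move=> x xz; rewrite lt_min => /andP[xr xz'].
have x0 : x != 0 by apply: contraTneq xz' => ->; rewrite sub0r cabsN ltxx.
apply: contra xz => /eqP x2.
have c2 : cabs (1 + 1 : C) = 1 + 1.
  have -> : (1 + 1 : C) = (1 + 1 : R)%:C by rewrite rmorphD rmorph1.
  by rewrite cabs_real ger0_norm.
have xt : theta_ext g x = z.
  have := rP x xr; rewrite tz; case: (sqr_eq1 x2) => ->; case: zE => -> //.
    by rewrite opprK c2 => h; exfalso; lra.
  by rewrite -opprD cabsN c2 => h; exfalso; lra.
have ez := th_quad th_theta g z1 z0; have ex := theta_ext_quad g x0.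
rewrite tz in ez; rewrite xt in ex.
have bC := realC_neq0 (chan_b_gt0 g).
have : chan_w g x = chan_w g z.
  by apply: (mulIf z0); apply/eqP; rewrite -subr_eq0 -(subrr (0 : C)) -{1}ez -ex; apply/eqP; ring.
move=> /(mulIf (invr_neq0 bC)) /addrI /oppr_inj h.
have [->//|/(congr1 (fun u => u * z))] := lambda_inj g x0 z0 h.
have zz : z * z = 1 by case: zE => ->; rewrite ?mulrNN mulr1.
by rewrite -mulrA zz mulr1 mul1r => ->.
Qed.

Lemma theta_ext_near_derivable g (z : C) : cabs z <= 1 ->
  (cabs z = 1 -> regular_point g z) ->
  \forall x \near z^', derivable (theta_ext g) x 1.
Proof.
move=> z1 rz; have [d d0 dP] := theta_ext_cont z1 rz.
have nsq : \forall x \near z^', x != 0 /\ theta_ext g x ^+ 2 != 1.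
  have [->|z0] := eqVneq z 0; last first.
    have h := theta_ext_sqr_neq1 z1 z0 rz.
    have h0 : \forall x \near z^', x != 0.
      apply/dnbhsC; exists (cabs z); first by rewrite cabs_gt0.
      by move=> x _; apply: contraTneq => ->; rewrite sub0r cabsN ltxx.
    by apply: filterS2 h h0 => x.
  apply/dnbhsC; exists 1 => // x x0; rewrite subr0 => x1; split=> //.
  rewrite theta_ext_disk ?(ltW x1) //.
  have [h _ _] := th_open th_theta g x1 x0.
  apply: contraTneq h => /(congr1 (@cabs R)); rewrite cabsX cabs1 => /eqP.
  by rewrite pexpr_eq1 ?cabs_ge0 // => /eqP ->; rewrite ltxx.
have near_d : \forall x \near z^', cabs (x - z) < d by apply/dnbhsC; exists d.
apply: filterS2 near_d nsq => x xd [x0 x2].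
by apply: theta_ext_derivable => //; exact: dP.
Qed.

End ThetaExtension.

(** * Charts of the closed disk *)

Section SquareRootBranch.
Context {R : realType}.
Local Notation C := (R[i]^o).

Lemma ImB (z w : C) : complex.Im (z - w) = complex.Im z - complex.Im w.
Proof. by case: z w => [? ?] []. Qed.

Lemma ReB (z w : C) : complex.Re (z - w) = complex.Re z - complex.Re w.
Proof. by case: z w => [? ?] []. Qed.

Lemma sqrtc_close (u : C) : cabs (sqrtc u - 1 : C) <= cabs (u - 1).
Proof.
have -> : u - 1 = (sqrtc u - 1) * (sqrtc u + 1) by rewrite -subr_sqr_1 sqr_sqrtc.
rewrite cabsM ler_peMr ?cabs_ge0 //.
have : complex.Re (sqrtc u + 1 : C) = complex.Re (sqrtc u) + 1.
  by case: (sqrtc u).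
have := le_Re_cabs (sqrtc u + 1 : C); have := Re_sqrtc_ge0 u => h1 h2 h3.
by move: h2; rewrite h3 ger0_norm; lra.
Qed.

(** Near 1 the square root has real part larger than 1/2, so that the
    denominator sqrt x + sqrt u of the difference quotient stays away from 0. *)
Lemma sqrtc_derivable (u : C) : cabs (u - 1) < 1 / 2 ->
  derivable (@sqrtc R : C -> C) u 1.
Proof.
move=> u1.
have Re_half (x : C) : cabs (x - 1) < 1 / 2 -> 1 / 2 < complex.Re (sqrtc x).
  move=> x1; have := sqrtc_close x; have := le_Re_cabs (sqrtc x - 1 : C).
  have -> : complex.Re (sqrtc x - 1 : C) = complex.Re (sqrtc x) - 1.
    by case: (sqrtc x).
  by rewrite ler_norml => /andP[]; lra.
have ru := Re_half u u1.
have sum1 (x : C) : cabs (x - 1) < 1 / 2 -> 1 <= cabs (sqrtc x + sqrtc u : C).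
  move=> /Re_half rx; have := le_Re_cabs (sqrtc x + sqrtc u : C).
  have -> : complex.Re (sqrtc x + sqrtc u) = complex.Re (sqrtc x) + complex.Re (sqrtc u).
    by case: (sqrtc x) (sqrtc u) => [? ?] [].
  by have := ler_norm (complex.Re (sqrtc x) + complex.Re (sqrtc u)); lra.
have diff (x : C) : x - u = (sqrtc x - sqrtc u) * (sqrtc x + sqrtc u).
  by rewrite -subr_sqr !sqr_sqrtc.
pose d := 1 / 2 - cabs (u - 1); have d0 : 0 < d by rewrite subr_gt0.
have nearu (x : C) : cabs (x - u) < d -> cabs (x - 1) < 1 / 2.
  by move=> xd; have := cabs_tri x u 1; rewrite /d in xd; lra.
have lip (x : C) : cabs (x - u) < d -> cabs (sqrtc x - sqrtc u : C) <= cabs (x - u).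
  by move=> /nearu /sum1 h; rewrite diff cabsM ler_peMr ?cabs_ge0.
have sc : (@sqrtc R : C -> C) @ u^' --> (sqrtc u : C).
  apply/cvg_dnbhsC => e e0; exists (Num.min d e); first by rewrite lt_min d0.
  by move=> x _; rewrite lt_min => /andP[/lip h1 h2]; apply: le_lt_trans h2.
have u0 : (sqrtc u + sqrtc u : C) != 0.
  by rewrite -cabs_gt0; apply: lt_le_trans (sum1 u u1); exact: ltr01.
apply/derivable_cvgE; exists ((sqrtc u + sqrtc u : C)^-1).
apply: (@cvg_dnbhs_eq _ (fun x => (sqrtc x + sqrtc u : C)^-1)).
  apply/dnbhsC; exists d => // x xu xd.
  have s0 : (sqrtc x + sqrtc u : C) != 0.
    by rewrite -cabs_gt0; apply: lt_le_trans (sum1 x (nearu x xd)); exact: ltr01.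
  have n0 : (sqrtc x - sqrtc u : C) != 0.
    by apply: contra xu => /eqP h; rewrite -subr_eq0 diff h mul0r.
  by rewrite diff invfM mulrA divff // mul1r.
apply: (cvgCV u0); apply: cvgCD; [exact: sc|exact: cvg_cst].
Qed.

End SquareRootBranch.

Section Charts.
Context {R : realType} (S : multichannel_system R).
Local Notation C := (R[i]^o).
Local Notation n := (nchan S).
Variable th : 'I_n -> C -> C.
Hypothesis th_theta : is_theta th.

(** Near a point z of the unit circle, 1 - x^2 with 0 < Re x runs once through the
    quotients y / z of the points y <> z of the disk, and x is a local
    parameter in which a square root branch point at z is resolved. *)
Definition edge_param (z x : C) : C := z * (1 - x ^+ 2).

Lemma edge_param_derivable (z x : C) : derivable (edge_param z) x 1.
Proof.
apply: derivableCM; first exact: derivableCc.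
by apply: derivableCB; [exact: derivableCc|exact: exprn_derivable].
Qed.

Lemma derivable_small (f : C -> C) (l : C) (e : R) : 0 < e ->
  f 0 = l -> derivable f 0 1 -> \forall x \near (0 : C), cabs (f x - l) < e.
Proof.
move=> e0 <- /derivable_continuousC /cvg_nbhsC/(_ e e0)[d d0 dP].
by apply/nbhsC; exists d.
Qed.

(** With w = theta + theta^-1 one has theta - theta^-1 = +- sqrt (w^2 - 4), and
    w^2 - 4 = x^2 q(x) with q 0 <> 0 in the parameter x, so that theta - theta^-1
    is x times a holomorphic function up to a sign. The sign is the same at all
    points of the disk: the form K below is nonnegative on theta - theta^-1,
    because |theta| <= 1, Re theta keeps the sign of theta (z) and Im theta that
    of Im z, while K is positive on the candidate x sqrt (q x). *)
Lemma edge_branch g (z : C) : cabs z = 1 -> complex.Im z != 0 ->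
  th g z ^+ 2 = 1 -> exists t : C -> C,
  [/\ t 0 = th g z, \forall x \near (0 : C), derivable t x 1 &
      \forall x \near (0 : C), 0 < complex.Re x -> cabs (edge_param z x) <= 1 ->
        th g (edge_param z x) = t x].
Proof.
move=> z1 Iz t2; have z0 := cabs1_neq0 z1.
have zl : cabs z <= 1 by rewrite z1.
have bg := chan_b_gt0 g; have sb := spec_b_gt0 g.
have bgC := realC_neq0 bg.
set sg := th g z in t2 *.
have sg0 : sg != 0 by apply: contra_eq_neq t2 => ->; rewrite expr0n eq_sym oner_eq0.
pose sR := complex.Re sg.
have sgE : sg = sR%:C.
  by rewrite /sR; case: (sqr_eq1 t2) => -> /=; rewrite ?oppr0 // rmorphN rmorph1.
have sR2 : sR * sR = 1.
  have := t2; rewrite sgE expr2 => /(congr1 (@complex.Re R)) /=.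
  by rewrite mulr0 subr0.
pose ta : R := if 0 < complex.Im z then 1 else -1.
have ta2 : ta * ta = 1 by rewrite /ta; case: ifP => _; rewrite ?mulrNN mulr1.
have taI : 0 < ta * complex.Im z.
  rewrite /ta; case: ifPn => [h|]; first by rewrite mul1r.
  by rewrite -leNgt => h; rewrite mulN1r oppr_gt0 lt_neqAle Iz.
pose ratio := spec_b S / chan_b g.
have ratio0 : 0 < ratio by rewrite divr_gt0.
(* q 0 = - 4 sg (spec_b / chan_b) (z - z^-1) is purely imaginary, and kap is a
   multiple of the square root of q 0 which lies in the right quadrant. *)
pose kap : C := Complex (- sR) ta.
pose rho := Num.sqrt (4 * ratio * (ta * complex.Im z)).
have rp : 0 < 4 * ratio * (ta * complex.Im z).
  by apply: mulr_gt0 taI; exact: mulr_gt0.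
have rho2 : rho * rho = 4 * ratio * (ta * complex.Im z).
  by rewrite -expr2 sqr_sqrtr // ltW.
have rho0 : 0 < rho by rewrite sqrtr_gt0.
pose r0 : C := rho%:C * kap.
pose q1 (x : C) : C := - (ratio%:C * (z - z^-1 * (1 - x ^+ 2)^-1)).
pose q (x : C) : C := q1 x * (4 * sg + x ^+ 2 * q1 x).
have kap2 : kap * kap = Complex 0 (- (2 * (sR * ta))).
  by apply: eq_complexP => /=; rewrite ?sR2 ?ta2; [rewrite mulrNN sR2 subrr|ring].
have r0q : r0 * r0 = q 0.
  have zz : z - z^-1 = Complex 0 (2 * complex.Im z).
    by rewrite -(conj_unit z1); case: (z) => x y; apply: eq_complexP => /=; ring.
  have -> : r0 * r0 = (rho * rho)%:C * (kap * kap) by rewrite /r0 rmorphM; ring.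
  rewrite /q /q1 expr0n subr0 invr1 mulr1 mul0r addr0 zz sgE kap2 rho2.
  have -> : (4 : C) = (4 : R)%:C by rewrite rmorph_nat.
  apply: eq_complexP => /=; first by ring.
  rewrite !(mul0r, mulr0, subr0, add0r, addr0, oppr0).
  have -> : 4 * ratio * (ta * complex.Im z) * - (2 * (sR * ta)) =
    - (8 * ratio * complex.Im z * sR) * (ta * ta) by ring.
  by rewrite ta2; ring.
have kap0 : kap != 0.
  apply/eqP => /(congr1 (@complex.Im R)) /= h; move: ta2; rewrite h mul0r => /eqP.
  by rewrite eq_sym oner_eq0.
have r00 : r0 != 0 by rewrite mulf_neq0 // realC_neq0.
have q00 : q 0 != 0 by rewrite -r0q mulf_neq0.
have q1d (x : C) : x ^+ 2 != 1 -> derivable q1 x 1.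
  move=> x1; apply: derivableCN; apply: derivableCM; first exact: derivableCc.
  apply: derivableCB; first exact: derivableCc.
  apply: derivableCM; first exact: derivableCc.
  apply: derivableCV; first by rewrite subr_eq0 eq_sym.
  by apply: derivableCB; [exact: derivableCc|exact: exprn_derivable].
have qd (x : C) : x ^+ 2 != 1 -> derivable q x 1.
  move=> x1; apply: derivableCM; first exact: q1d.
  apply: derivableCD; first exact: derivableCc.
  by apply: derivableCM; [exact: exprn_derivable|exact: q1d].
pose u (x : C) : C := q x / q 0.
have ud (x : C) : x ^+ 2 != 1 -> derivable u x 1.
  by move=> x1; apply: derivableCM; [exact: qd|exact: derivableCc].
have u0 : u 0 = 1 by rewrite /u divff.
pose t (x : C) : C := (chan_w g (edge_param z x) + x * (r0 * sqrtc (u x))) / 2.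
have small : \forall x \near (0 : C), cabs x < 1 / 2.
  by apply/nbhsC; exists (1 / 2) => // x; rewrite subr0.
have sq1 (x : C) : cabs x < 1 / 2 -> x ^+ 2 != 1.
  move=> xs; apply: contraTneq xs => /(congr1 (@cabs R)).
  rewrite cabsX cabs1 => /eqP; rewrite pexpr_eq1 ?cabs_ge0 // => /eqP ->.
  by rewrite -leNgt; lra.
have n01 : (0 : C) ^+ 2 != 1 by rewrite expr0n eq_sym oner_eq0.
have uclose : \forall x \near (0 : C), cabs (u x - 1) < 1 / 4.
  by apply: derivable_small => //; exact: ud.
have wz : chan_w g z = 2 * sg.
  have := th_quad th_theta g zl z0; rewrite -/sg t2 => h.
  have E : 2 * sg * sg = 2 by rewrite -mulrA -expr2 t2 mulr1.
  apply: (mulIf sg0); rewrite E; apply/eqP; rewrite -subr_eq0 -oppr_eq0 -h.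
  by apply/eqP; ring.
have wE (x : C) : x ^+ 2 != 1 -> chan_w g (edge_param z x) = 2 * sg + x ^+ 2 * q1 x.
  move=> x1; rewrite -wz /chan_w /lambda /zhukovsky /edge_param /q1 /ratio.
  rewrite fmorph_div /=.
  have d0 : 1 - x ^+ 2 != 0 by rewrite subr_eq0 eq_sym.
  by field; rewrite z0 bgC d0.
have disc (x : C) : x ^+ 2 != 1 ->
    chan_w g (edge_param z x) ^+ 2 - 4 = (x * (r0 * sqrtc (u x))) ^+ 2.
  move=> x1; have -> : (x * (r0 * sqrtc (u x))) ^+ 2 =
      x ^+ 2 * ((r0 * r0) * (sqrtc (u x)) ^+ 2) by ring.
  rewrite sqr_sqrtc r0q [q 0 * _]mulrC divfK // wE //.
  transitivity (4 * (sg ^+ 2) - 4 + x ^+ 2 * q1 x * (4 * sg + x ^+ 2 * q1 x)).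
    by ring.
  by rewrite t2 mulr1 subrr add0r /q mulrA.
have e00 : edge_param z 0 = z by rewrite /edge_param expr0n subr0 mulr1.
exists t; split.
- by rewrite /t e00 mul0r addr0 wz mulrC mulKf // (_ : 2 != 0 :> C) // pnatr_eq0.
- apply: filterS2 small uclose => x xs ux.
  have e0 : edge_param z x != 0.
    by rewrite mulf_neq0 // subr_eq0 eq_sym sq1.
  apply: derivableCM; last exact: derivableCc.
  apply: derivableCD.
    apply: (@derivable_compC _ (edge_param z) (chan_w g)).
      exact: edge_param_derivable.
    exact: chan_w_derivable.
  apply: derivableCM; first exact: derivableCid.
  apply: derivableCM; first exact: derivableCc.
  apply: (@derivable_compC _ u (@sqrtc R)); first by apply: ud; exact: sq1.
  by apply: sqrtc_derivable; lra.
have omclose : \forall x \near (0 : C), cabs (edge_param z x - z) < ta * complex.Im z.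
  by apply: derivable_small => //; exact: edge_param_derivable.
have [dt dt0 dtP] := th_cont th_theta g zl (ltr01 : 0 < 1).
have omclose2 : \forall x \near (0 : C), cabs (edge_param z x - z) < dt.
  by apply: derivable_small => //; exact: edge_param_derivable.
apply: filterS (filterI (filterI small uclose) (filterI omclose omclose2)).
move=> x [[xs ux] [xom xdt]] Rex oml.
have x1 := sq1 x xs.
have om0 : edge_param z x != 0 by rewrite mulf_neq0 // subr_eq0 eq_sym.
have [a1 a2 _] := th_closed th_theta g oml om0.
have quad := th_quad th_theta g oml om0.
set T := th g (edge_param z x) in a1 a2 quad *.
have wT : chan_w g (edge_param z x) = T + T^-1.
  apply: (mulIf a2); rewrite mulrDl mulVf // -expr2.
  by apply/eqP; rewrite eq_sym -subr_eq0 addrAC quad.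
(* The real linear form whose positive side contains kap. *)
pose K (y : C) : R := - sR * complex.Re y + ta * complex.Im y.
have KN y : K (- y) = - K y by rewrite /K; case: y => a b /=; ring.
have KT : 0 <= K (T - T^-1).
  have -> : K (T - T^-1) = (sR * complex.Re T) * ((cabs T ^+ 2)^-1 - 1) +
      (ta * complex.Im T) * ((cabs T ^+ 2)^-1 + 1).
    have h1 := Re_inv T; have h2 := Im_inv T; rewrite /K; move: h1 h2.
    case: (T^-1) => a b /= -> ->; case: (T) => c d /=; ring.
  have aT : 0 < cabs T ^+ 2 by rewrite exprn_gt0 // cabs_gt0.
  have T2 : 1 <= (cabs T ^+ 2)^-1.
    by rewrite invf_ge1 // exprn_ile1 ?cabs_ge0.
  apply: addr_ge0; apply: mulr_ge0.
  - have := dtP _ oml xdt; rewrite -/T -/sg => h.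
    have := le_lt_trans (le_Re_cabs (T - sg)) h.
    have -> : complex.Re (T - sg) = complex.Re T - sR.
      exact: ReB.
    have : sR = 1 \/ sR = -1.
      have : sR ^+ 2 == 1 by rewrite expr2 sR2.
      by rewrite sqrf_eq1 => /orP[]/eqP; [left|right].
    by rewrite ltr_norml => -[] -> /andP[h1 h2]; lra.
  - by rewrite subr_ge0.
  - have [_ ImT] := th_Im_sign th_theta g g oml om0.
    have Iom : 0 < ta * complex.Im (edge_param z x).
      have := le_lt_trans (le_Im_cabs (edge_param z x - z)) xom.
      have -> : complex.Im (edge_param z x - z) =
          complex.Im (edge_param z x) - complex.Im z.
        exact: ImB.
      rewrite ltr_norml /ta; case: ifP => _ /andP[]; lra.
    have : 0 <= (ta * complex.Im T) * (ta * complex.Im (edge_param z x)).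
      by rewrite mulrACA ta2 mul1r.
    by rewrite pmulr_lge0.
  - by rewrite addr_ge0 // (le_trans ler01).
have Kr : 0 < K (x * (r0 * sqrtc (u x))).
  have -> : K (x * (r0 * sqrtc (u x))) = 2 * rho * complex.Re (x * sqrtc (u x)).
    have -> : x * (r0 * sqrtc (u x)) = r0 * (x * sqrtc (u x)) by ring.
    rewrite /K /r0 /kap; case: (x * sqrtc (u x)) => X Y /=.
    transitivity (rho * ((sR * sR) * X + (ta * ta) * X)); first by ring.
    by rewrite sR2 ta2; ring.
  rewrite !mulr_gt0 //.
  have sx : cabs (sqrtc (u x) - 1 : C) < 1 / 4.
    by apply: le_lt_trans (sqrtc_close _) ux.
  have x2R : cabs x <= 2 * complex.Re x.
    have h1 : 0 <= complex.Re (x ^+ 2).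
      have : cabs (1 - x ^+ 2) ^+ 2 <= 1.
        move: oml; rewrite /edge_param cabsM z1 mul1r => h.
        by rewrite exprn_ile1 ?cabs_ge0.
      rewrite sqr_cabs; have := sqr_ge0 (complex.Re (x ^+ 2)).
      have := sqr_ge0 (complex.Im (x ^+ 2)).
      by case: (x ^+ 2) => a b /=; rewrite !expr2; lra.
    rewrite -ler_sqr ?nnegrE ?cabs_ge0 ?mulr_ge0 ?(ltW Rex) // sqr_cabs.
    by move: h1; rewrite expr2; case: (x) => a b /=; rewrite !expr2; nra.
  have -> : complex.Re (x * sqrtc (u x)) =
      complex.Re x + complex.Re (x * (sqrtc (u x) - 1)).
    by case: (x) (sqrtc (u x)) => [a b] [c d] /=; ring.
  have h2 : cabs (x * (sqrtc (u x) - 1)) <= 2 * complex.Re x * (1 / 4).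
    by rewrite cabsM ler_pM ?cabs_ge0 // ltW.
  have := le_trans (le_Re_cabs (x * (sqrtc (u x) - 1) : C)) h2.
  by rewrite ler_norml => /andP[]; lra.
have dsq : (T - T^-1 - x * (r0 * sqrtc (u x))) *
    (T - T^-1 + x * (r0 * sqrtc (u x))) = 0.
  rewrite -subr_sqr -disc // wT; have := divff a2; move: (T^-1) => i Ti.
  transitivity (4 * (1 - T * i)); first by ring.
  by rewrite Ti subrr mulr0.
move/eqP: dsq; rewrite mulf_eq0 => /orP[]/eqP h.
  rewrite /t wT -(subr0_eq h).
  have n2 : (2 : C) != 0 by rewrite pnatr_eq0.
  by apply: (mulIf n2); rewrite divfK //; ring.
move/addr0_eq: h => h.
by move: KT; rewrite -[T - T^-1]opprK h KN oppr_ge0 leNgt Kr.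
Qed.

End Charts.

Section ChartExistence.
Context {R : realType} (S : multichannel_system R).
Local Notation C := (R[i]^o).

Lemma near_cvg (P : C -> Prop) (F : set_system C) (f : C -> C) (z : C) :
  f @ F --> z -> (\forall y \near z, P y) -> \forall x \near F, P (f x).
Proof. by move=> fx zP; exact: (fx P zP). Qed.

Lemma cvg_compC (F : set_system C) (f h : C -> C) (z : C) :
  h @ F --> z -> derivable f z 1 -> (fun x => f (h x)) @ F --> f z.
Proof.
move=> hz /derivable_continuousC fz Q Qz.
by apply: (@near_cvg (fun y => Q (f y)) F h z hz); exact: (fz Q Qz).
Qed.
Local Notation n := (nchan S).
Variable th : 'I_n -> C -> C.

(** A local description of the closed disk near z0 in which everything is
    single valued: om is a holomorphic parametrisation with om x0 = z0, the t g
    are holomorphic around x0 and agree with theta_g for the parameters in D,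
    and these reach all the points of the disk near z0. *)
Record chart (z0 x0 : C) (om : C -> C) (t : 'I_n -> C -> C)
    (D : C -> Prop) : Prop := Chart {
  chart_derivable : forall x, derivable om x 1;
  chart_base : om x0 = z0;
  chart_neq0 : \forall x \near x0^', om x != 0;
  chart_theta_cvg : forall g, t g @ x0^' --> th g z0;
  chart_theta_derivable : forall g, \forall x \near x0^', derivable (t g) x 1;
  chart_sub : \forall x \near x0^', D x ->
    [/\ cabs (om x) <= 1, om x != z0 & forall g, th g (om x) = t g x];
  chart_onto : forall e : R, 0 < e -> exists2 d : R, 0 < d &
    forall y, cabs y <= 1 -> y != z0 -> cabs (y - z0) < d ->
    exists x, [/\ D x, x != x0, cabs (x - x0) < e & om x = y] }.

Hypothesis th_theta : is_theta th.

Lemma chart_id (z0 : C) : cabs z0 <= 1 ->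
  (cabs z0 = 1 -> forall g, regular_point th g z0) ->
  chart z0 z0 (fun x => x) (theta_ext th) (fun x => cabs x <= 1).
Proof.
move=> z1 rz; constructor.
- exact: derivableCid.
- by [].
- have [->|z00] := eqVneq z0 0; first by apply/dnbhsC; exists 1.
  apply/dnbhsC; exists (cabs z0) => [|x _]; first by rewrite cabs_gt0.
  apply: contraTneq => ->; rewrite sub0r cabsN ltxx; exact: isT.
- move=> g; have [d d0 dP] := theta_ext_cont th_theta z1 (fun h => rz h g).
  rewrite -(theta_ext_disk th g z1); apply: cvg_nbhs_dnbhs.
  by apply: dP; rewrite subrr cabs0.
- by move=> g; apply: theta_ext_near_derivable => // h; exact: rz.
- apply/dnbhsC; exists 1 => // x xz _ x1; split=> // g.
  by rewrite theta_ext_disk.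
- by move=> e e0; exists e => // y y1 yz ye; exists y.
Qed.

(** x is the square root of 1 - y / z with nonnegative real part. If this real
    part were 0, then y = z (1 + (Im x)^2) would lie outside the disk. *)
Lemma edge_param_onto (z y : C) : cabs z = 1 -> cabs y <= 1 -> y != z ->
  exists x : C, [/\ 0 < complex.Re x, cabs x ^+ 2 = cabs (y - z) &
    edge_param z x = y].
Proof.
move=> z1 y1 yz; have z0 := cabs1_neq0 z1.
pose x : C := sqrtc (1 - y / z); have x2 : x ^+ 2 = 1 - y / z by exact: sqr_sqrtc.
have xy : edge_param z x = y.
  by rewrite /edge_param x2 opprB addrC subrK mulrC divfK.
exists x; split=> //; last first.
  rewrite -cabsX x2; have -> : 1 - y / z = (z - y) / z by field.
  by rewrite cabsM cabsV z1 invr1 mulr1 cabs_distC.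
rewrite lt_neqAle Re_sqrtc_ge0 andbT eq_sym; apply/eqP => Rx.
have e : x ^+ 2 = (- (complex.Im x ^+ 2))%:C.
  have : complex.Re x = 0 by [].
  by rewrite !expr2; case: (x) => a b /= ->; apply: eq_complexP => /=; ring.
have : cabs (edge_param z x) = 1 + complex.Im x ^+ 2.
  rewrite /edge_param cabsM z1 mul1r e -(rmorph1 (real_complex R)) -rmorphB opprK.
  by rewrite cabs_real ger0_norm // addr_ge0 // sqr_ge0.
rewrite xy => h; move: y1; rewrite h => I2.
have I0 : complex.Im x ^+ 2 = 0.
  by apply/eqP; rewrite eq_le sqr_ge0 andbT; lra.
move: xy; rewrite /edge_param e I0 oppr0 subr0 mulr1 => /esym yz'.
by rewrite yz' eqxx in yz.
Qed.

Lemma circle_Im_neq0 (z : C) : cabs z = 1 -> z != 1 -> z != -1 -> complex.Im z != 0.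
Proof.
move=> z1 zp zm; apply/eqP => I0.
have : z ^+ 2 = 1.
  have := sqr_cabs z; rewrite z1 I0 expr0n addr0 expr1n => h.
  have zR : z = (complex.Re z)%:C by apply: eq_complexP.
  by rewrite zR -rmorphXn -h rmorph1.
by case/sqr_eq1 => e; [rewrite e eqxx in zp|rewrite e eqxx in zm].
Qed.

(** A channel of which z is not a band edge is holomorphic at z, hence in the
    parameter x. *)
Lemma edge_chart_theta g (z : C) : cabs z = 1 -> z != 1 -> z != -1 ->
  exists t : C -> C, [/\ t @ 0^' --> th g z,
    \forall x \near (0 : C)^', derivable t x 1 &
    \forall x \near (0 : C)^', 0 < complex.Re x -> cabs (edge_param z x) <= 1 ->
      th g (edge_param z x) = t x].
Proof.
move=> z1 zp zm; have Iz := circle_Im_neq0 z1 zp zm.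
have [t2|t2] := eqVneq (th g z ^+ 2) 1.
  have [t [t0 td tE]] := edge_branch th_theta z1 Iz t2.
  exists t; split.
  - rewrite -t0; apply: cvg_nbhs_dnbhs; apply: derivable_continuousC.
    exact: nbhs_singleton td.
  - exact: cvg_within td.
  - exact: cvg_within tE.
have zl : cabs z <= 1 by rewrite z1.
have z0 := cabs1_neq0 z1.
have rz : cabs z = 1 -> regular_point th g z by left.
have e0 : edge_param z 0 = z by rewrite /edge_param expr0n subr0 mulr1.
have [d d0 dP] := theta_ext_cont th_theta zl rz.
have zc : theta_ext th g @ z --> theta_ext th g z by apply: dP; rewrite subrr cabs0.
have zd : derivable (theta_ext th g) z 1.
  by apply: theta_ext_derivable => //; rewrite theta_ext_disk.
have near_d : \forall y \near z, derivable (theta_ext th g) y 1.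
  have /dnbhsC[r r0 rP] := theta_ext_near_derivable th_theta zl rz.
  apply/nbhsC; exists r; first by [].
  move=> y yr; have [->|yz] := eqVneq y z; first exact: zd.
  exact: rP.
have ec := derivable_continuousC (@edge_param_derivable R z 0).
exists (fun x => theta_ext th g (edge_param z x)); split.
- rewrite -(theta_ext_disk th g zl) -{2}e0.
  apply: cvg_nbhs_dnbhs; apply: derivable_continuousC.
  apply: (@derivable_compC _ (edge_param z) (theta_ext th g)).
    exact: edge_param_derivable.
  by rewrite e0.
- apply: cvg_within; rewrite e0 in ec.
  have near_e : \forall x \near (0 : C), derivable (theta_ext th g) (edge_param z x) 1.
    exact: (@near_cvg (fun y => derivable (theta_ext th g) y 1) (nbhs (0 : C))
      (edge_param z) z ec near_d).
  apply: filterS near_e => x xd; apply: (@derivable_compC _ (edge_param z) (theta_ext th g)); last exact: xd.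
  exact: edge_param_derivable.
- apply/dnbhsC; exists 1 => // x _ _ _ x1.
  by rewrite theta_ext_disk.
Qed.

Lemma near_ord (F : set_system C) (FF : Filter F) (P : 'I_n -> C -> Prop) :
  (forall g, \forall x \near F, P g x) -> \forall x \near F, forall g, P g x.
Proof. exact: filter_forall. Qed.

Lemma chart_edge (z0 : C) : cabs z0 = 1 -> z0 != 1 -> z0 != -1 ->
  exists t, chart z0 0 (edge_param z0) t
    (fun x => 0 < complex.Re x /\ cabs (edge_param z0 x) <= 1).
Proof.
move=> z1 zp zm; have [t tP] := choice (fun g => edge_chart_theta g z1 zp zm).
have z00 := cabs1_neq0 z1.
have e0 : edge_param z0 0 = z0 by rewrite /edge_param expr0n subr0 mulr1.
exists t; constructor.
- exact: edge_param_derivable.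
- exact: e0.
- apply/dnbhsC; exists (1 / 2) => // x _; rewrite subr0 => xs.
  rewrite mulf_neq0 // subr_eq0 eq_sym; apply/eqP => /(congr1 (@cabs R)).
  rewrite cabsX cabs1 => /eqP; rewrite pexpr_eq1 ?cabs_ge0 // => /eqP h.
  by move: xs; rewrite h; lra.
- by move=> g; have [] := tP g.
- by move=> g; have [] := tP g.
- have H : forall g, \forall x \near (0 : C)^', 0 < complex.Re x ->
      cabs (edge_param z0 x) <= 1 -> th g (edge_param z0 x) = t g x.
    by move=> g; have [] := tP g.
  have n0 : \forall x \near (0 : C)^', x != 0 by apply/dnbhsC; exists 1.
  have Ff : Filter (0 : C)^' by exact: filter_filter.
  have H' := near_ord Ff H.
  apply: filterS2 H' n0 => x xH x0 [Rx x1].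
  split=> // [|g]; last exact: xH.
  rewrite /edge_param -subr_eq0 -{2}(mulr1 z0) -mulrBr mulf_neq0 //.
  by rewrite addrAC subrr add0r oppr_eq0 expf_neq0.
- move=> e e_gt0; exists (e ^+ 2) => [|y y1 yz ye]; first exact: exprn_gt0.
  have [x [Rx x2 xy]] := edge_param_onto z1 y1 yz.
  exists x; split; rewrite ?xy //.
  + by apply: contraTneq Rx => ->; rewrite ltxx.
  + by rewrite subr0; move: ye; rewrite -x2 ltr_pXn2r ?nnegrE ?cabs_ge0 // ltW.
Qed.

Lemma chart_exists (z0 : C) : cabs z0 <= 1 -> exists x0 om t D, chart z0 x0 om t D.
Proof.
move=> zl; have [[z1 [zp zm]]|H] :=
  EM (cabs z0 = 1 /\ z0 != 1 /\ z0 != -1).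
  by have [t tP] := chart_edge z1 zp zm; do 3!eexists; eexists; exact: tP.
do 3!eexists; eexists; apply: chart_id => // z1 g; right.
have [->|zp] := eqVneq z0 1; first by left.
have [->|zm] := eqVneq z0 (-1); first by right.
by case: H.
Qed.

End ChartExistence.

Arguments chart_theta_cvg {R S th z0 x0 om t D} _ _.
Arguments cvg_compC {R F f h z} _ _.

(** * The columns of U as formulas in the spectral variables *)

Section LocalAlgebras.
Context {R : realType}.
Local Notation C := (R[i]^o).

(** What meromorphy at a point and differentiability at a point have in common;
    Fl is the filter on which the functions have to be known. The formulas for
    U are shown once to stay in such a class. *)
Record local_algebra (Fl : set_system C) (P : (C -> C) -> Prop) : Prop :=
  LocalAlgebra {
    la_filter : Filter Fl;
    la_cst : forall c : C, P (fun=> c);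
    la_add : forall f g, P f -> P g -> P (fun x => f x + g x);
    la_mul : forall f g, P f -> P g -> P (fun x => f x * g x);
    la_inv : forall f, P f -> (\forall x \near Fl, f x != 0) ->
      P (fun x => (f x)^-1);
    la_eq : forall f g, (\forall x \near Fl, f x = g x) -> P f -> P g }.

Lemma near_frequently (z : C) (P : C -> Prop) : (\forall x \near z^', P x) ->
  frequently_at z P.
Proof.
move=> /dnbhsC[d d0 dP] e e0.
have de : 0 < Num.min d e by rewrite lt_min d0.
have [x xz] := dnbhs_nonempty z de; rewrite lt_min => /andP[xd xe].
by exists x; split=> //; exact: dP.
Qed.

Lemma mero_local (z : C) : local_algebra z^' (meromorphic_at ^~ z).
Proof.
constructor.
- exact: filter_filter.
- by move=> c; exact: mero_cst.
- by move=> f g; exact: mero_add.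
- by move=> f g; exact: mero_mul.
- by move=> f fm f0; apply: mero_inv fm (near_frequently f0).
- by move=> f g; exact: mero_near_eq.
Qed.

Lemma derivable_local (z : C) :
  local_algebra (nbhs z) (fun f : C -> C => derivable f z 1).
Proof.
constructor.
- exact: filter_filter.
- by move=> c; exact: derivableCc.
- by move=> f g; exact: derivableCD.
- by move=> f g; exact: derivableCM.
- by move=> f fd f0; apply: derivableCV fd; exact: nbhs_singleton f0.
- by move=> f g; exact: derivable_near_eq.
Qed.

Section Closure.
Variables (Fl : set_system C) (P : (C -> C) -> Prop).
Hypothesis PA : local_algebra Fl P.

Lemma la_ext (f g : C -> C) : f =1 g -> P f -> P g.
Proof. by move=> /funext ->. Qed.

Lemma la_opp f : P f -> P (fun x => - f x).
Proof.
move=> Pf; apply: la_ext (la_mul PA (la_cst PA (-1)) Pf) => x.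
by rewrite mulN1r.
Qed.

Lemma la_sub f g : P f -> P g -> P (fun x => f x - g x).
Proof. by move=> Pf Pg; exact: (la_add PA Pf (la_opp Pg)). Qed.

Lemma la_sum (I : Type) (r : seq I) (F : I -> C -> C) :
  (forall i, P (F i)) -> P (fun x => \sum_(i <- r) F i x).
Proof.
move=> PF; elim: r => [|i r IH].
  by apply: la_ext (la_cst PA 0) => x; rewrite big_nil.
by apply: la_ext (la_add PA (PF i) IH) => x; rewrite big_cons.
Qed.

Lemma la_prod (I : Type) (r : seq I) (F : I -> C -> C) :
  (forall i, P (F i)) -> P (fun x => \prod_(i <- r) F i x).
Proof.
move=> PF; elim: r => [|i r IH].
  by apply: la_ext (la_cst PA 1) => x; rewrite big_nil.
by apply: la_ext (la_mul PA (PF i) IH) => x; rewrite big_cons.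
Qed.

Lemma la_det m (M : C -> 'M[R[i]]_m) : (forall i j, P (fun x => M x i j)) ->
  P (fun x => \det (M x)).
Proof.
move=> PM; rewrite /determinant; apply: la_sum => s.
apply: (la_mul PA (la_cst PA _)); apply: la_prod => i; exact: PM.
Qed.

(** Cramer's rule. *)
Lemma la_invmx m (M : C -> 'M[R[i]]_m) : (forall i j, P (fun x => M x i j)) ->
  (\forall x \near Fl, M x \in unitmx) ->
  forall i j, P (fun x => invmx (M x) i j).
Proof.
move=> PM Mu i j; have FF := la_filter PA.
apply: (la_eq PA (f := fun x => (\det (M x))^-1 * cofactor (M x) j i)).
  by apply: filterS Mu => x xu; rewrite /invmx xu !mxE.
apply: (la_mul PA).
  apply: (la_inv PA); first exact: la_det.
  by apply: filterS Mu => x; rewrite unitmxE unitfE.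
apply: (la_mul PA (la_cst PA _)); apply: la_det => a b.
by apply: la_ext (PM (lift j a) (lift i b)) => x; rewrite !mxE.
Qed.

End Closure.
End LocalAlgebras.

Section Formulas.
Context {R : realType} (S : multichannel_system R).
Local Notation C := (R[i]^o).
Local Notation n := (nchan S).
Local Notation fa := (@jacobi_a R S).
Local Notation fb := (@jacobi_b R S).
Variable e : 'I_n -> nat -> C -> C.
Implicit Types (l : C) (t : 'I_n -> C).

(** The matrix T as a function of the spectral parameter l and of the values t of
    the theta_g, these being treated as independent variables, so that the
    formulas make sense in every chart. *)
Definition gate_mx l t : 'M[R[i]]_n :=
  diag_mx (\row_g e g 0 (t g)) -
  Rmx S l *m B0mx S *m diag_mx (\row_g e g 1 (t g)).

Lemma gate_mxE l t g h : gate_mx l t g h = e g 0 (t g) *+ (g == h) -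
  resolvent (chan g 0%N) (chan h 0%N) l * (fb h 0%N)%:C * e h 1 (t h).
Proof. by rewrite /gate_mx mxE [in RHS]/= !mul_mx_diag !mxE. Qed.

(** The solution p of the channel s, as a polynomial in l. *)
Fixpoint dirichlet (s : 'I_n) (k : nat) (l : C) : C :=
  match k with
  | 0 => 1
  | k1.+1 =>
      match k1 with
      | 0 => 0
      | k2.+1 => (((fa s k1)%:C - l) * dirichlet s k1 l
                   - (fb s k2)%:C * dirichlet s k2 l) / (fb s k1)%:C
      end
  end.

Lemma psol_dirichlet s k om : psol s k om = dirichlet s k (lambda S om).
Proof.
suff : psol s k om = dirichlet s k (lambda S om) /\
    psol s k.+1 om = dirichlet s k.+1 (lambda S om) by case.
elim: k => [|k [IH1 IH2]]; first by [].
split; first exact: IH2.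
change ((((fa s k.+1)%:C - lambda S om) * psol s k.+1 om
  - (fb s k)%:C * psol s k om) / (fb s k.+1)%:C = dirichlet s k.+2 (lambda S om)).
by rewrite IH1 IH2.
Qed.

Lemma dirichlet_solution s l :
  jacobi_solution (fun k => (fa s k)%:C : C) (fun k => (fb s k)%:C : C) l
    (fun k => dirichlet s k l).
Proof.
move=> k.
change (dirichlet s k.+2 l) with ((((fa s k.+1)%:C - l) * dirichlet s k.+1 l
  - (fb s k)%:C * dirichlet s k l) / (fb s k.+1)%:C).
by rewrite [_%:C * (_ / _)]mulrC divfK ?fbC_neq0 //; ring.
Qed.

(** The s-th diagonal entry of B B(0)^-1 D E(1)^-1. *)
Definition source (s : 'I_n) t : C :=
  (chan_b s)%:C / (fb s 0%N)%:C * ((t s)^-1 - t s) / e s 1 (t s).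

(** The coefficient of the Jost solution of the channel g in the column s of U. *)
Definition scatter (s g : 'I_n) l t : C := invmx (gate_mx l t) g s * source s t.

(** The entry g of U(k) n_s. *)
Definition wave (s : 'I_n) (k : nat) (g : 'I_n) l t : C :=
  - (dirichlet s k l * source s t) *+ (g == s) + e g k (t g) * scatter s g l t.

(** The coefficient s_ss, determined by the representation at k = 1, where the
    term in p vanishes. *)
Definition reflection (s : 'I_n) l t : C :=
  scatter s s l t - e s 1 (t s)^-1 / e s 1 (t s).

Lemma diag_unitmx (d : 'rV[R[i]]_n) :
  (diag_mx d \in unitmx) <-> forall g, d 0 g != 0.
Proof.
rewrite unitmxE det_diag unitfE; split=> [h g|h].
  by apply: contraNneq h => dg; rewrite (bigD1 g) //= dg mul0r.
by apply/prodf_neq0 => g _.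
Qed.

Lemma invmx_diag (d : 'rV[R[i]]_n) : (forall g, d 0 g != 0) ->
  invmx (diag_mx d) = diag_mx (\row_g (d 0 g)^-1).
Proof.
move=> d0; have du : diag_mx d \in unitmx by apply/diag_unitmx.
rewrite -[RHS]mulmx1 -(mulmxV du) mulmxA.
suff -> : diag_mx (\row_g (d 0 g)^-1) *m diag_mx d = 1%:M by rewrite mul1mx.
apply/matrixP => i j; rewrite mul_diag_mx !mxE.
by case: eqP => [->|_]; rewrite ?mulr1n ?mulr0n ?mulr0 // mulVf.
Qed.

Variable th : 'I_n -> C -> C.

Lemma TmxE om : Tmx th e om = gate_mx (lambda S om) (th^~ om).
Proof. by []. Qed.

Lemma U_domainP om : U_domain th e om <->
  [/\ cabs om <= 1, om != 0, core_regular S (lambda S om),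
      Tmx th e om \in unitmx & forall g, e g 1%N (th g om) != 0].
Proof.
split=> -[h1 h2 h3 h4 h5]; split=> //.
- exact/closed_diskE.
- by move=> g; have /diag_unitmx/(_ g) := h5; rewrite mxE.
- exact/closed_diskE.
- by apply/diag_unitmx => g; rewrite mxE.
Qed.

Lemma UcolE s k g om : U_domain th e om ->
  Ucol th e s k g om = wave s k g (lambda S om) (th^~ om).
Proof.
case/U_domainP => _ _ _ _ e0; rewrite /Ucol -colE mxE.
have b0 h : (\row_s (fb s 0%N)%:C : 'rV[R[i]]_n) 0 h != 0 by rewrite mxE fbC_neq0.
have e0' h : (\row_s e s 1%N (th s om) : 'rV[R[i]]_n) 0 h != 0 by rewrite mxE.
rewrite /Umx /Emx /Bmx /B0mx /Dmx (invmx_diag b0) (invmx_diag e0') !mulmxA.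
rewrite [diag_mx _ *m invmx _]mul_diag_mx !mul_mx_diag !mxE TmxE /wave /scatter /source psol_dirichlet.
by case: eqP => [->|_]; rewrite ?mulr1n ?mulr0n /=; ring.
Qed.

End Formulas.

Section FormulaAlgebra.
Context {R : realType} (S : multichannel_system R).
Local Notation C := (R[i]^o).
Local Notation n := (nchan S).
Variable e : 'I_n -> nat -> C -> C.
Variables (Fl : set_system C) (P : (C -> C) -> Prop).
Hypothesis PA : local_algebra Fl P.
Variables (l : C -> C) (t : 'I_n -> C -> C).
Hypothesis Pl : P l.

Lemma la_core_mx i j : P (fun x => (core_mx S - (l x)%:M) i j).
Proof.
have [ij|ij] := eqVneq i j.
  apply: la_ext (la_sub PA (la_cst PA (core_mx S i j)) Pl) => x.
  by rewrite !mxE ij eqxx.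
apply: la_ext (la_cst PA (core_mx S i j)) => x.
by rewrite !mxE (negbTE ij) mulr0n subr0.
Qed.

Lemma la_resolvent (al be : S) : (\forall x \near Fl, core_regular S (l x)) ->
  P (fun x => resolvent al be (l x)).
Proof.
move=> lr; rewrite /resolvent.
case: insubP => [y _ _|_]; last exact: (la_cst PA).
case: insubP => [z _ _|_]; last exact: (la_cst PA).
apply: (la_invmx PA) => //; exact: (la_core_mx).
Qed.

Hypothesis Pe : forall g k, P (fun x => e g k (t g x)).

Lemma la_gate_mx : (\forall x \near Fl, core_regular S (l x)) ->
  forall g h, P (fun x => gate_mx e (l x) (t^~ x) g h).
Proof.
move=> lr g h.
apply: (la_ext (f := fun x => e g 0%N (t g x) * (g == h)%:R -
   resolvent (chan g 0%N) (chan h 0%N) (l x) * (jacobi_b h 0%N)%:C * e h 1 (t h x))).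
  by move=> x; rewrite gate_mxE mulr_natr.
apply: (la_sub PA).
  exact (la_mul PA (Pe g 0) (la_cst PA _)).
apply: (la_mul PA) (Pe h 1); apply: (la_mul PA) (la_cst PA _).
exact: la_resolvent.
Qed.

Lemma la_dirichlet s k : P (fun x => @dirichlet R S s k (l x)).
Proof.
suff : P (fun x => @dirichlet R S s k (l x)) /\ P (fun x => @dirichlet R S s k.+1 (l x)).
  by case.
elim: k => [|k [IH1 IH2]]; first by split; exact: (la_cst PA).
split; first exact: IH2.
apply: (la_mul PA) (la_cst PA _); apply: (la_sub PA).
  by apply: (la_mul PA) IH2; apply: (la_sub PA (la_cst PA _)).
exact: (la_mul PA (la_cst PA _)).
Qed.

Hypothesis Pt : forall g, P (t g).

Lemma la_source s : (\forall x \near Fl, t s x != 0) ->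
  (\forall x \near Fl, e s 1%N (t s x) != 0) -> P (fun x => source e s (t^~ x)).
Proof.
move=> t0 e0; apply: (la_mul PA); last exact: (la_inv PA).
apply: (la_mul PA (la_cst PA _)); apply: (la_sub PA); last exact: Pt.
exact: (la_inv PA).
Qed.

Section Regular.
Hypothesis l_regular : \forall x \near Fl, core_regular S (l x).
Hypothesis gate_unit : \forall x \near Fl, gate_mx e (l x) (t^~ x) \in unitmx.
Variable s : 'I_n.
Hypothesis t_neq0 : \forall x \near Fl, t s x != 0.
Hypothesis e_neq0 : \forall x \near Fl, e s 1%N (t s x) != 0.

Lemma la_scatter g : P (fun x => scatter e s g (l x) (t^~ x)).
Proof.
apply: (la_mul PA); last exact: la_source.
have Pg := la_gate_mx l_regular.
exact: (@la_invmx _ _ _ PA _ (fun x => gate_mx e (l x) (t^~ x)) Pg gate_unit).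
Qed.

Lemma la_wave k g : P (fun x => wave e s k g (l x) (t^~ x)).
Proof.
apply: (la_add PA); last exact: (la_mul PA (Pe g k) (la_scatter g)).
apply: (la_ext (f := fun x =>
  - (dirichlet s k (l x) * source e s (t^~ x)) * (g == s)%:R)).
  by move=> x; rewrite mulr_natr.
apply: (la_mul PA) (la_cst PA _); apply: (la_opp PA).
by apply: (la_mul PA); [exact: la_dirichlet|exact: la_source].
Qed.

End Regular.
End FormulaAlgebra.

(** * The exceptional points are finite in number *)

Section GoodPoints.
Context {R : realType} (S : multichannel_system R).
Local Notation C := (R[i]^o).
Local Notation n := (nchan S).
Local Notation fa := (@jacobi_a R S).
Local Notation fb := (@jacobi_b R S).

(** The terms of a convergent series tend to 0, and the weights are at least 1. *)
Lemma jacobi_b_cvg (g : 'I_n) : (fun k => (fb g k)%:C : C) @ \oo --> ((chan_b g)%:C : C).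
Proof.
have [eps e0 /(_ g) /cvg_series_cvg_0 h] := coefficients_decay S.
apply/cvg_seqC => d d0; have [N _ NP] : \forall k \near \oo,
    `|(1 + eps) ^+ k.+1 * (`|fa g k.+1 - chan_a g| + `|fb g k.+1 - chan_b g|)| < d.
  by apply: cvgr0_norm_lt d0; exact: h.
exists N.+1 => -[//|k] Nk; have := NP k Nk; rewrite -rmorphB cabs_real /=.
rewrite ger0_norm; last first.
  by rewrite mulr_ge0 ?addr_ge0 // exprn_ge0 // addr_ge0 // ltW.
apply: le_lt_trans; set x := `|fa _ _ - _|; set y := `|_ - _|.
have y0 : 0 <= y := normr_ge0 _; have x0 : 0 <= x := normr_ge0 _.
apply: (@le_trans _ _ (x + y)); first by rewrite lerDr.
rewrite ler_peMl ?addr_ge0 //; apply: exprn_ege1; lra.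
Qed.

(** A real symmetric matrix has real eigenvalues: pair an eigenvector v with its
    conjugate. *)
Lemma core_regular_nonreal (l : C) : complex.Im l != 0 -> core_regular S l.
Proof.
move=> Il; rewrite /core_regular unitmxE unitfE; apply/det0P => -[v v0 vM].
pose M := core_mx S.
have Msym i j : M i j = M j i by rewrite !mxE interaction_sym.
have Mreal i j : (M i j)^*%C = M i j by rewrite !mxE conjc_real.
have eq i : \sum_j v 0 j * M j i = l * v 0 i.
  have := congr1 (fun A : 'rV_ _ => A 0 i) vM.
  rewrite mulmxBr mxE mul_mx_scalar !mxE => /subr0_eq <-.
  by apply: eq_bigr => j _; rewrite /M.
pose N := \sum_i v 0 i * (v 0 i)^*%C.
have NE : N = (\sum_i cabs (v 0 i) ^+ 2)%:C.
  rewrite rmorph_sum; apply: eq_bigr => i _.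
  by rewrite -[v 0 i * _]sqr_normc norm_cabs rmorphXn.
have N0 : \sum_i cabs (v 0 i) ^+ 2 != 0.
  apply: contra v0; rewrite psumr_eq0 => [/allP h|i _]; last by rewrite exprn_ge0 ?cabs_ge0.
  apply/eqP/matrixP => i j; rewrite ord1 mxE.
  have := h j (mem_index_enum _); rewrite expf_eq0 /= cabs_eq0 => /eqP; exact.
have Q : l * N = \sum_i \sum_j v 0 j * M j i * (v 0 i)^*%C.
  rewrite mulr_sumr; apply: eq_bigr => i _.
  by rewrite mulrA -eq mulr_suml.
have Qc : (l * N)^*%C = l * N.
  rewrite Q rmorph_sum exchange_big /=; apply: eq_bigr => i _.
  rewrite rmorph_sum /=; apply: eq_bigr => j _.
  by rewrite !rmorphM /= conjcK Mreal Msym; ring.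
move: Qc; rewrite rmorphM /= NE conjc_real => /(mulIf _) h.
have NC : ((\sum_i cabs (v 0 i) ^+ 2)%:C : R[i]) != 0.
  by rewrite fmorph_eq0.
by have := nonreal_conj Il; rewrite (h NC) eqxx.
Qed.

Variables (th : 'I_n -> C -> C) (e : 'I_n -> nat -> C -> C).
Hypothesis th_theta : is_theta th.
Hypothesis e_jost : is_jost e.

Lemma jost_derivable g k (z : C) : cabs z <= 1 -> \forall x \near z, derivable (e g k) x 1.
Proof.
move=> /closed_diskE z1; have [h _ _] := e_jost g; have [G [oG DG Gh]] := h k.
have : nbhs z G by apply: open_nbhs_nbhs; split=> //; exact: DG.
by apply: filterS => x; exact: Gh.
Qed.

Lemma jost_solution g (z : C) : cabs z <= 1 -> z != 0 ->
  jacobi_solution (fun k => (fa g k)%:C : C) (fun k => (fb g k)%:C : C)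
    (zhukovsky (chan_a g) (chan_b g) z) (fun k => e g k z).
Proof.
move=> /closed_diskE z1 z0 k; have [_ h _] := e_jost g; exact: h.
Qed.

Lemma jost_asymptotics g (z : C) : cabs z <= 1 -> z != 0 ->
  jost_at z (fun k => e g k z).
Proof.
by move=> /closed_diskE z1 z0; have [_ _ h] := e_jost g; exact: h.
Qed.

Lemma jost_theta_solution g (z : C) : cabs z <= 1 -> z != 0 ->
  jacobi_solution (fun k => (fa g k)%:C : C) (fun k => (fb g k)%:C : C)
    (lambda S z) (fun k => e g k (th g z)).
Proof.
move=> z1 z0; have [h1 h2 <-] := th_closed th_theta g z1 z0.
exact: jost_solution.
Qed.

(** At these points every factor of U is defined and invertible, and no theta_g is
    at an edge of its band. *)
Definition good (om : C) : Prop :=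
  [/\ cabs om <= 1, om != 0, core_regular S (lambda S om),
      Tmx th e om \in unitmx &
      forall g, e g 1%N (th g om) != 0 /\ th g om ^+ 2 != 1].

Lemma good_U om : good om -> U_domain th e om.
Proof.
by case=> ? ? ? ? h; apply/U_domainP; split=> // g; have [] := h g.
Qed.

Hypothesis T_inv : finite_set [set om : C |
  closed_disk om /\ Tmx th e om \notin unitmx].
Variable s : 'I_n.

(** lambda is not real, and the factors are controlled by the selfadjointness of
    the core and of the channels. *)
Lemma good_nonreal (y : C) : cabs y < 1 -> complex.Im y != 0 ->
  Tmx th e y \in unitmx -> good y.
Proof.
move=> y1 Iy Ty; have yl := ltW y1.
have y0 : y != 0 by apply: contraNneq Iy => ->.
split=> // [|g].
  by apply: core_regular_nonreal; exact: (nonreal_lambda s).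
have [t1 t0 tE] := th_open th_theta g y1 y0; split; last first.
  apply/eqP => /(congr1 (@cabs R)); rewrite cabsX cabs1 => /eqP.
  by rewrite pexpr_eq1 ?cabs_ge0 // => /eqP h; rewrite h ltxx in t1.
have Il := nonreal_conj (nonreal_lambda s y1 Iy).
have h := jost_nonreal_neq0 (@jacobi_b_cvg g) t0 t1 Il
  (jost_asymptotics g (ltW t1) t0) (jost_theta_solution g yl y0).
exact: h.
Qed.

Lemma good_near_nonreal (z0 : C) (d : R) : cabs z0 <= 1 -> 0 < d ->
  exists y, [/\ y != z0, cabs (y - z0) < d, cabs y < 1 & good y].
Proof.
move=> z1 d0; have [r r0 rP] := finite_isolated z0 T_inv.
have [|y [yz yd y1 Iy]] := @nonreal_near _ z0 (Num.min d r) z1.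
  by rewrite lt_min d0.
move: yd; rewrite lt_min => /andP[yd yr]; exists y; split=> //.
apply: good_nonreal => //; apply: contraT => Ty.
have := rP y _ yz; rewrite leNgt yr; apply; split=> //.
by apply/closed_diskE; exact: ltW.
Qed.

Section InChart.
Variables (z0 x0 : C) (om : C -> C) (t : 'I_n -> C -> C) (D : C -> Prop).
Hypothesis z0_le1 : cabs z0 <= 1.
Hypothesis ch : chart th z0 x0 om t D.

(** The points of [good_near_nonreal] are reached by the chart. It follows that
    each factor of U, a meromorphic germ in the chart, does not vanish near x0
    by [mero_neq0]. *)
Lemma chart_frequently_good : frequently_at x0 (fun x =>
  [/\ D x, good (om x), cabs (om x) < 1 & forall g, th g (om x) = t g x]).
Proof.
move=> d d0; have /dnbhsC[r r0 rP] := chart_sub ch.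
have dr : 0 < Num.min d r by rewrite lt_min d0.
have [d1 d10 d1P] := chart_onto ch dr.
have [y [yz yd y1 gy]] := good_near_nonreal z0_le1 d10.
have [x [Dx xx]] := d1P y (ltW y1) yz yd.
rewrite lt_min => /andP[xd xr] xy; have [_ _ tx] := rP x xx xr Dx.
by exists x; rewrite xy; split=> //; split=> // g; rewrite -tx xy.
Qed.

Lemma frequently_mono (P Q : C -> Prop) : frequently_at x0 P ->
  (forall x, P x -> Q x) -> frequently_at x0 Q.
Proof. by move=> h PQ d /h[x [h1 h2 /PQ h3]]; exists x. Qed.

Lemma chart_om_mero : meromorphic_at om x0.
Proof.
have od := chart_derivable ch.
apply: (@mero_cvg _ _ _ (om x0)); first by apply/dnbhsC; exists 1 => // x _ _; exact: od.
by apply: cvg_nbhs_dnbhs; apply: derivable_continuousC; exact: od.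
Qed.

Lemma chart_lambda_mero : meromorphic_at (fun x => lambda S (om x)) x0.
Proof.
have A := mero_local x0; have om_m := chart_om_mero.
apply: (la_sub A (la_cst A _)); apply: (la_mul A (la_cst A _)).
apply: (la_add A om_m); apply: (la_inv A om_m); exact: chart_neq0 ch.
Qed.

Lemma chart_theta_mero g : meromorphic_at (t g) x0.
Proof.
apply: (@mero_cvg _ _ _ (th g z0)).
  exact: chart_theta_derivable ch g.
exact: chart_theta_cvg ch g.
Qed.

Lemma theta_le1 g : cabs (th g z0) <= 1.
Proof.
have [->|z00] := eqVneq z0 0; first by rewrite (th_at0 th_theta) cabs0 ler01.
by have [] := th_closed th_theta g z0_le1 z00.
Qed.

Lemma chart_jost_cvg g k : (fun x => e g k (t g x)) @ x0^' --> e g k (th g z0).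
Proof.
have ed := nbhs_singleton (jost_derivable g k (theta_le1 g)).
exact: (cvg_compC (chart_theta_cvg ch g) ed).
Qed.

Lemma chart_jost_mero g k : meromorphic_at (fun x => e g k (t g x)) x0.
Proof.
apply: (@mero_cvg _ _ _ (e g k (th g z0))); last exact: chart_jost_cvg.
have tc := chart_theta_cvg ch g; have td := chart_theta_derivable ch g.
have ed := jost_derivable g k (theta_le1 g).
have ed' : \forall x \near x0^', derivable (e g k) (t g x) 1.
  exact: (@near_cvg _ (fun y => derivable (e g k) y 1) x0^' (t g) _ tc ed).
apply: filterS2 td ed' => x; exact: derivable_compC.
Qed.

Lemma chart_near_core_regular : \forall x \near x0^', core_regular S (lambda S (om x)).
Proof.
have A := mero_local x0.
pose f (x : C) : C := \det (core_mx S - (lambda S (om x))%:M).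
have fm : meromorphic_at f x0.
  by apply: (la_det A) => i j; exact: (la_core_mx A chart_lambda_mero).
have [] := mero_neq0 fm.
  apply: frequently_mono chart_frequently_good _ => x [_ [_ _ + _ _] _ _].
  by rewrite /core_regular unitmxE unitfE.
by move=> h _; apply: filterS h => x; rewrite /core_regular unitmxE unitfE.
Qed.

Lemma chart_near_gate : \forall x \near x0^',
  gate_mx e (lambda S (om x)) (t^~ x) \in unitmx.
Proof.
have A := mero_local x0.
pose f (x : C) : C := \det (gate_mx e (lambda S (om x)) (t^~ x)).
have fm : meromorphic_at f x0.
  apply: (la_det A) => i j.
  exact: (la_gate_mx A chart_lambda_mero chart_jost_mero chart_near_core_regular).
have [] := mero_neq0 fm.
  apply: frequently_mono chart_frequently_good _ => x [_ [_ _ _ + _] _ tx].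
  rewrite TmxE unitmxE unitfE /f.
  by rewrite (_ : (th^~ (om x)) = (t^~ x)) //; apply/funext => g; exact: tx.
by move=> h _; apply: filterS h => x; rewrite unitmxE unitfE.
Qed.

Lemma chart_near_jost g : \forall x \near x0^', e g 1%N (t g x) != 0.
Proof.
have [] // := mero_neq0 (chart_jost_mero g 1).
by apply: frequently_mono chart_frequently_good _ => x [_ [_ _ _ _ /(_ g)[+ _]] _ <-].
Qed.

Lemma chart_near_theta g : \forall x \near x0^', t g x != 0 /\ t g x ^+ 2 != 1.
Proof.
have A := mero_local x0; have tm := chart_theta_mero g.
have [t0 _] : (\forall x \near x0^', t g x != 0) /\ meromorphic_at (fun x => (t g x)^-1) x0.
  apply: mero_neq0 tm _.
  apply: frequently_mono chart_frequently_good _ => x [_ [om1 om0 _ _ _] _ <-].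
  by have [] := th_closed th_theta g om1 om0.
have [t1 _] : (\forall x \near x0^', t g x * t g x - 1 != 0) /\
    meromorphic_at (fun x => (t g x * t g x - 1)^-1) x0.
  apply: mero_neq0; first exact: (la_sub A (la_mul A tm tm) (la_cst A 1)).
  apply: frequently_mono chart_frequently_good _ => x [_ [_ _ _ _ /(_ g)[_ +]] _ <-].
  by rewrite subr_eq0.
by apply: filterS2 t0 t1 => x; rewrite subr_eq0.
Qed.

Lemma chart_near_good : \forall x \near x0^', D x -> good (om x).
Proof.
have Ff : Filter x0^' by exact: filter_filter.
have J := near_ord Ff chart_near_jost; have T := near_ord Ff chart_near_theta.
apply: filterS3 chart_near_core_regular chart_near_gate _; last first.
  exact: filterI (filterI J T) (filterI (chart_sub ch) (chart_neq0 ch)).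
move=> x c1 c2 [[j1 t1] [s1 o1]] Dx.
have [h1 h2 h3] := s1 Dx.
have tE : (th^~ (om x)) = (t^~ x) by apply/funext => g; exact: h3.
split; [exact: h1|exact: o1|exact: c1|by rewrite TmxE tE|move=> g].
by rewrite h3; split; [exact: j1|have [] := t1 g].
Qed.

Lemma chart_wave_mero k g :
  meromorphic_at (fun x => wave e s k g (lambda S (om x)) (t^~ x)) x0.
Proof.
apply: (la_wave (mero_local x0) chart_lambda_mero chart_jost_mero
  chart_theta_mero chart_near_core_regular chart_near_gate _ (chart_near_jost s)).
by apply: filterS (chart_near_theta s) => x [].
Qed.

Lemma chart_scatter_mero g :
  meromorphic_at (fun x => scatter e s g (lambda S (om x)) (t^~ x)) x0.
Proof.
apply: (la_scatter (mero_local x0) chart_lambda_mero chart_jost_mero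
  chart_theta_mero chart_near_core_regular chart_near_gate _ (chart_near_jost s)).
by apply: filterS (chart_near_theta s) => x [].
Qed.

End InChart.

Lemma good_isolated (z0 : C) : cabs z0 <= 1 -> exists2 d : R, 0 < d &
  forall y, cabs y <= 1 -> y != z0 -> cabs (y - z0) < d -> good y.
Proof.
move=> z1; have [x0 [om [t [D ch]]]] := chart_exists th_theta z1.
have /dnbhsC[r r0 rP] := chart_near_good z1 ch.
have [d d0 dP] := chart_onto ch r0; exists d => // y y1 yz yd.
by have [x [Dx xx xr <-]] := dP y y1 yz yd; exact: rP.
Qed.

Definition bad_set : set C := [set om | closed_disk om /\ ~ good om].

(** An infinite set of bad points would accumulate in the closed disk, against
    [good_isolated]. *)
Lemma bad_finite : finite_set bad_set.
Proof.
apply: contrapT => /infiniteP /pcard_leP[f].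
have fb k : bad_set (f k) by apply: funS.
have [|l lP] := @bounded_seq_cluster _ (fun k => f k : C) 1.
  by move=> k; have [/closed_diskE] := fb k.
have l1 : cabs l <= 1.
  rewrite leNgt; apply/negP => l1; have d0 : 0 < cabs l - 1 by rewrite subr_gt0.
  have [m _ h] := lP _ d0 0%N; have [/closed_diskE fm _] := fb m.
  by have := cabs_lb l (f m); rewrite cabs_distC; lra.
have [d d0 dP] := good_isolated l1.
have bad_l m : cabs (f m - l) < d -> f m = l.
  move=> md; apply/eqP/negPn/negP => ml; have [/closed_diskE fm ng] := fb m.
  by apply: ng; exact: dP.
have [m _ /bad_l fm] := lP d d0 0%N; have [m' mm' /bad_l fm'] := lP d d0 m.+1.
have : m = m'   by apply: (@inj _ _ _ f); rewrite ?inE //; exact: etrans fm (esym fm').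
by move=> e'; rewrite -e' ltnn in mm'.
Qed.

End GoodPoints.

(** * The column of U at good points and its limits *)

Section WaveIdentities.
Context {R : realType} (S : multichannel_system R).
Local Notation C := (R[i]^o).
Local Notation n := (nchan S).
Local Notation fa := (@jacobi_a R S).
Local Notation fb := (@jacobi_b R S).
Variable e : 'I_n -> nat -> C -> C.
Implicit Types (l : C) (t : 'I_n -> C).

Lemma wave1 s g l t : wave e s 1 g l t = e g 1 (t g) * scatter e s g l t.
Proof. by rewrite /wave /= mul0r oppr0 mul0rn add0r. Qed.

(** T T^-1 = 1 says that E(0) T^-1 and R B(0) E(1) T^-1 differ by the identity,
    which the term - P(0) = - 1 of U(0) compensates; and P(1) = 0. *)
Lemma wave_gate s l t g : gate_mx e l t \in unitmx ->
  wave e s 0 g l t = \sum_h resolvent (chan g 0%N) (chan h 0%N) l *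
    (fb h 0%N)%:C * wave e s 1 h l t.
Proof.
move=> Tu; have := congr1 (fun A : 'M[R[i]]_n => A g s) (mulmxV Tu).
rewrite !mxE /= => h; rewrite {1}/wave /= mul1r mulNrn.
have {}h : \sum_j e g 0%N (t g) *+ (g == j) * invmx (gate_mx e l t) j s -
    \sum_j resolvent (chan g 0%N) (chan j 0%N) l * (fb j 0)%:C * e j 1%N (t j) *
      invmx (gate_mx e l t) j s = (g == s)%:R.
  rewrite -h -sumrB; apply: eq_bigr => j _.
  by rewrite gate_mxE mulrBl.
have d0 : \sum_j e g 0%N (t g) *+ (g == j) * invmx (gate_mx e l t) j s =
    e g 0%N (t g) * invmx (gate_mx e l t) g s.
  rewrite (bigD1 g) //= eqxx mulr1n big1 ?addr0 // => j jg.
  by rewrite eq_sym (negbTE jg) mulr0n mul0r.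
rewrite d0 in h.
have -> : e g 0%N (t g) * scatter e s g l t =
    source e s t * (e g 0%N (t g) * invmx (gate_mx e l t) g s).
  by rewrite /scatter; ring.
move/eqP: h; rewrite subr_eq => /eqP ->; rewrite mulrDr mulr_natr addKr.
rewrite mulr_sumr; apply: eq_bigr => j _.
by rewrite wave1 /scatter; ring.
Qed.

Lemma wave_solution s g l t :
  jacobi_solution (fun k => (fa g k)%:C : C) (fun k => (fb g k)%:C : C) l
    (fun k => e g k (t g)) ->
  jacobi_solution (fun k => (fa g k)%:C : C) (fun k => (fb g k)%:C : C) l
    (fun k => wave e s k g l t).
Proof.
move=> eg; have [gs|gs] := eqVneq g s; last first.
  have := jacobi_solution_comb (scatter e s g l t) 0 eg eg.
  congr jacobi_solution; apply/funext => k; rewrite /wave (negbTE gs) mulr0n.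
  by rewrite mul0r addr0 add0r mulrC.
have := jacobi_solution_comb (scatter e s g l t) (- source e s t) eg
  (dirichlet_solution g l).
congr jacobi_solution; apply/funext => k; rewrite /wave gs eqxx mulr1n.
by ring.
Qed.

End WaveIdentities.

Section GoodWaves.
Context {R : realType} (S : multichannel_system R).
Local Notation C := (R[i]^o).
Local Notation n := (nchan S).
Local Notation fa := (@jacobi_a R S).
Local Notation fb := (@jacobi_b R S).
Variables (th : 'I_n -> C -> C) (e : 'I_n -> nat -> C -> C).
Hypothesis th_theta : is_theta th.
Hypothesis e_jost : is_jost e.

Lemma cvgC_sum (T I : Type) (F : set_system T) {FF : Filter F} (r : seq I)
  (f : I -> T -> C) (a : I -> C) : (forall i, f i @ F --> a i) ->
  (fun x => \sum_(i <- r) f i x) @ F --> \sum_(i <- r) a i.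
Proof.
move=> fa; elim: r => [|i r IH].
  rewrite big_nil (_ : (fun x => _) = fun=> 0); first exact: cvg_cst.
  by apply/funext => x; rewrite big_nil.
rewrite big_cons (_ : (fun x => _) = fun x => f i x + \sum_(j <- r) f j x).
  exact: (cvgCD (fa i) IH).
by apply/funext => x; rewrite big_cons.
Qed.

Lemma cvg_withinCE (A : set C) (f : C -> C) (z l : C) :
  f @ within A (nbhs z) --> l <->
  forall d : R, 0 < d -> exists2 r : R, 0 < r &
    forall x, A x -> cabs (x - z) < r -> cabs (f x - l) < d.
Proof.
split=> [/cvgC h d /h /nbhsC[r r0 rP]|h].
  by exists r => // x xA xr; exact: rP.
apply/cvgC => d /h[r r0 rP]; apply/nbhsC; exists r => // x xr xA; exact: rP.
Qed.

Lemma cvg_withinC (A : set C) (f : C -> C) (z l : C) : f @ z --> l ->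
  f @ within A (nbhs z) --> l.
Proof.
move=> /cvg_nbhsC h; apply/cvg_withinCE => d d0; have [r r0 rP] := h d d0.
by exists r => // x _; exact: rP.
Qed.

Lemma cvg_withinC_eq (A : set C) (f g : C -> C) (z l : C) :
  (forall x, A x -> f x = g x) -> f @ within A (nbhs z) --> l ->
  g @ within A (nbhs z) --> l.
Proof.
move=> fg /cvg_withinCE h; apply/cvg_withinCE => d /h[r r0 rP].
by exists r => // x xA xr; rewrite -fg //; exact: rP.
Qed.

Lemma derivable_near_neq0 (f : C -> C) (z : C) : derivable f z 1 -> f z != 0 ->
  \forall x \near z, f x != 0.
Proof.
move=> fd f0; have /cvg_nbhsC h := derivable_continuousC fd.
have [|d d0 dP] := h (cabs (f z)); first by rewrite cabs_gt0.
apply/nbhsC; exists d => // x /dP; apply: contraTneq => ->.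
by rewrite sub0r cabsN ltxx.
Qed.

Lemma near_core_regular (z : C) : z != 0 -> core_regular S (lambda S z) ->
  \forall x \near z, core_regular S (lambda S x).
Proof.
move=> z0 cr.
pose f (x : C) : C := \det (core_mx S - (lambda S x)%:M).
have fd : derivable f z 1.
  apply: (la_det (derivable_local z)) => i j.
  exact: (la_core_mx (derivable_local z) (lambda_derivable z0)).
have : \forall x \near z, f x != 0.
  by apply: derivable_near_neq0 fd _; move: cr; rewrite /core_regular unitmxE unitfE.
by apply: filterS => x; rewrite /core_regular unitmxE unitfE.
Qed.

Lemma resolvent_derivable (al be : S) (z : C) : z != 0 ->
  core_regular S (lambda S z) ->
  derivable (fun x : C => resolvent al be (lambda S x) : C) z 1.
Proof.
move=> z0 cr; exact: (la_resolvent (derivable_local z) (lambda_derivable z0)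
  al be (near_core_regular z0 cr)).
Qed.

Section AtGood.
Variable z : C.
Hypothesis gz : good th e z.

Lemma good_theta_derivable g : derivable (theta_ext th g) z 1.
Proof.
have [z1 z0 _ _ /(_ g)[_ t2]] := gz.
have rz : cabs z = 1 -> regular_point th g z by left.
have [d d0 dP] := theta_ext_cont th_theta z1 rz.
apply: theta_ext_derivable => //; last by rewrite theta_ext_disk.
by apply: dP; rewrite subrr cabs0.
Qed.

Lemma good_jost_derivable g k : derivable (fun x => e g k (theta_ext th g x)) z 1.
Proof.
have [z1 z0 _ _ _] := gz; have [t1 _ _] := th_closed th_theta g z1 z0.
apply: (@derivable_compC _ (theta_ext th g) (e g k)); first exact: good_theta_derivable.
rewrite theta_ext_disk //.
exact: nbhs_singleton (jost_derivable e_jost g k t1).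
Qed.

Lemma theta_ext_diskE : (fun g => theta_ext th g z) = (th^~ z).
Proof. by have [z1 _ _ _ _] := gz; apply/funext => g; exact: theta_ext_disk. Qed.

Lemma good_near_gate : \forall x \near z,
  gate_mx e (lambda S x) (fun g => theta_ext th g x) \in unitmx.
Proof.
have [z1 z0 cr Tu _] := gz.
pose f (x : C) : C := \det (gate_mx e (lambda S x) (fun g => theta_ext th g x)).
have fd : derivable f z 1.
  apply: (la_det (derivable_local z)) => i j.
  exact: (la_gate_mx (derivable_local z) (lambda_derivable z0) good_jost_derivable
    (near_core_regular z0 cr)).
have : \forall x \near z, f x != 0.
  apply: derivable_near_neq0 fd _; rewrite /f theta_ext_diskE -TmxE.
  by move: Tu; rewrite unitmxE unitfE.
by apply: filterS => x; rewrite unitmxE unitfE.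
Qed.

Lemma good_near_theta g : \forall x \near z, theta_ext th g x != 0.
Proof.
have [z1 z0 _ _ _] := gz.
apply: derivable_near_neq0; first exact: good_theta_derivable.
by rewrite theta_ext_disk //; have [] := th_closed th_theta g z1 z0.
Qed.

Lemma good_near_jost g : \forall x \near z, e g 1%N (theta_ext th g x) != 0.
Proof.
apply: derivable_near_neq0; first exact: good_jost_derivable.
by have [z1 _ _ _ /(_ g)[e0 _]] := gz; rewrite theta_ext_disk.
Qed.

Lemma good_wave_derivable s k g : derivable
  (fun x => wave e s k g (lambda S x) (fun h => theta_ext th h x)) z 1.
Proof.
have [z1 z0 cr _ _] := gz.
exact: (la_wave (derivable_local z) (lambda_derivable z0) good_jost_derivable
  good_theta_derivable (near_core_regular z0 cr) good_near_gate
  (good_near_theta s) (good_near_jost s)).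
Qed.

Lemma good_scatter_derivable s g : derivable
  (fun x => scatter e s g (lambda S x) (fun h => theta_ext th h x)) z 1.
Proof.
have [z1 z0 cr _ _] := gz.
exact: (la_scatter (derivable_local z) (lambda_derivable z0) good_jost_derivable
  good_theta_derivable (near_core_regular z0 cr) good_near_gate
  (good_near_theta s) (good_near_jost s)).
Qed.

End AtGood.

Hypothesis T_inv : finite_set [set om : C |
  closed_disk om /\ Tmx th e om \notin unitmx].
Variable s : 'I_n.

Lemma goodP (z : C) : closed_disk z -> ~ bad_set th e z -> good th e z.
Proof. by move=> z1 nb; apply: contrapT => ng; apply: nb. Qed.

(** For a function given by a formula Phi in lambda and the theta_g: off the edges
    the extension of theta_g gives a meromorphic extension of f, and at the
    edges the chart gives the two-valued one. *)
Lemma mero_disk (Phi : C -> ('I_n -> C) -> C) (f : C -> C) :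
  (forall z0 x0 om t D, cabs z0 <= 1 -> chart th z0 x0 om t D ->
     meromorphic_at (fun x => Phi (lambda S (om x)) (t^~ x)) x0) ->
  (forall z, good th e z ->
     derivable (fun x => Phi (lambda S x) (fun g => theta_ext th g x)) z 1) ->
  (forall z, good th e z -> f z = Phi (lambda S z) (th^~ z)) ->
  meromorphic_near_disk (inner_edges th) (bad_set th e) f.
Proof.
move=> Phi_mero Phi_good fE.
pose F x := Phi (lambda S x) (fun g => theta_ext th g x).
have Fm z : closed_disk z -> ~ inner_edges th z -> meromorphic_at F z.
  move=> /closed_diskE z1 nE; apply: Phi_mero z1 (chart_id th_theta z1 _).
  move=> zu g; have [t2|] := eqVneq (th g z ^+ 2) 1; last by left.
  right; apply: contrapT => npm; apply: nE; split.
  - exact/unit_circleE.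
  - by apply/eqP => h; apply: npm; left.
  - by apply/eqP => h; apply: npm; right.
  - by exists g; exact: sqr_eq1.
pose A : set C := [set y | ~ bad_set th e y -> derivable F y 1].
split.
  exists (interior A), F; split.
  - exact: open_interior.
  - move=> z [z1 nE]; have [Fd _] := Fm z z1 nE.
    rewrite /interior /=; have /dnbhsC[d d0 dP] := Fd.
    apply/nbhsC; exists d => // y yd nb; have [yz|yz] := eqVneq y z.
      by rewrite yz; apply: Phi_good; apply: goodP => //; rewrite -yz.
    exact: dP.
  - by move=> z [/interior_subset h nb]; exact: h.
  - by move=> z [[z1 _] nE]; exact: Fm.
  - move=> z [z1 nO]; have gz : good th e z by apply: goodP => // h; apply: nO; left.
    by rewrite fE // /F theta_ext_diskE.
move=> z0 [/unit_circleE zu zp zm _]; have zl : cabs z0 <= 1 by rewrite zu.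
have [t ch] := chart_edge th_theta zu zp zm.
exists (fun x => Phi (lambda S (edge_param z0 x)) (t^~ x)); split.
  exact: Phi_mero zl ch.
have [d d0 dP] := good_isolated th_theta e_jost T_inv s zl.
have near_d := chart_near_good th_theta e_jost T_inv s zl ch.
apply: filterS2 (chart_sub ch) near_d => x xs xg Rx /closed_diskE x1.
have Dx : 0 < complex.Re x /\ cabs (edge_param z0 x) <= 1 by [].
have [_ _ tx] := xs Dx; rewrite -/(edge_param z0 x) (fE _ (xg Dx)).
by congr Phi; apply/funext => g; exact: tx.
Qed.

Lemma U_domain_proper (z : C) : cabs z <= 1 ->
  ProperFilter (within (U_domain th e) (nbhs z)).
Proof.
move=> z1; apply: Build_ProperFilter_ex => P /nbhsC[d d0 dP].
have [y [yz yd _ gy]] := good_near_nonreal th_theta e_jost T_inv s z1 d0.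
by exists y; apply: dP yd _; exact: good_U.
Qed.

(** The points of [U_domain] are dense in the closed disk, so that the limits
    defining [psiU] are unique. *)
Lemma U_lim (f : C -> C) (z l : C) : cabs z <= 1 ->
  f @ within (U_domain th e) (nbhs z) --> l ->
  lim (f @ within (U_domain th e) (nbhs z)) = l.
Proof.
move=> z1 fl; have PF := U_domain_proper z1.
exact: (@cvg_lim _ (@norm_hausdorff _ C) _ _ PF _ _ fl).
Qed.

Lemma good_Ucol_cvg (z : C) k g : good th e z ->
  Ucol th e s k g @ within (U_domain th e) (nbhs z) -->
    wave e s k g (lambda S z) (th^~ z).
Proof.
move=> gz; have := derivable_continuousC (@good_wave_derivable z gz s k g).
rewrite theta_ext_diskE // => /(@cvg_withinC (U_domain th e) _ _ _).
apply: cvg_withinC_eq => x xU; rewrite UcolE //; congr wave.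
by apply/funext => j; apply: theta_ext_disk; have [/closed_diskE] := xU.
Qed.

Lemma good_psiU (z : C) k g : good th e z ->
  psiU th e s k g z = wave e s k g (lambda S z) (th^~ z).
Proof.
move=> gz; apply: U_lim; last exact: good_Ucol_cvg.
by have [] := gz.
Qed.

Lemma good_nonsingular (z : C) k : good th e z -> nonsingular th e s k z.
Proof.
by move=> gz g; apply/cvg_ex; eexists; exact: good_Ucol_cvg.
Qed.

Lemma nonsingular_cvg (z : C) k g : nonsingular th e s k z ->
  Ucol th e s k g @ within (U_domain th e) (nbhs z) --> psiU th e s k g z.
Proof. by move=> /(_ g). Qed.

(** [wave_gate] holds on [U_domain], and the resolvent is continuous at z. *)
Lemma psiU_boundary (z : C) g : cabs z <= 1 -> z != 0 ->
  core_regular S (lambda S z) ->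
  nonsingular th e s 0 z -> nonsingular th e s 1 z ->
  psiU th e s 0 g z = \sum_h resolvent (chan g 0%N) (chan h 0%N) (lambda S z) *
    (fb h 0%N)%:C * psiU th e s 1 h z.
Proof.
move=> z1 z0 cr n0 n1; apply: (U_lim z1).
have FF : Filter (within (U_domain th e) (nbhs z)) by exact: within_filter.
pose G (x : C) : C := \sum_h resolvent (chan g 0%N) (chan h 0%N) (lambda S x) *
    (fb h 0%N)%:C * Ucol th e s 1 h x.
have Gc : G @ within (U_domain th e) (nbhs z) --> (\sum_h
    resolvent (chan g 0%N) (chan h 0%N) (lambda S z) *
    (fb h 0%N)%:C * psiU th e s 1 h z : C).
  apply: cvgC_sum => h.
  apply: cvgCM; last exact: nonsingular_cvg.
  apply: cvgCM; last exact: cvg_cst.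
  have rd := @resolvent_derivable (chan g 0%N) (chan h 0%N) z z0 cr.
  exact: (@cvg_withinC (U_domain th e) _ _ _ (derivable_continuousC rd)).
apply: cvg_withinC_eq Gc => x xU; rewrite /G UcolE // wave_gate.
  by apply: eq_bigr => h _; rewrite UcolE.
by have [_ _ _ Tu _] := xU.
Qed.

End GoodWaves.

(** * Amplitudes along the channels and conservation of the flux *)

Section Proportional.
Context {F : fieldType}.
Variables (a b : nat -> F).
Hypothesis b0 : forall k, b k != 0.

Lemma wronskian_comb u u' v x y k :
  wronskian b (fun k => x * u k + y * u' k) v k =
  x * wronskian b u v k + y * wronskian b u' v k.
Proof. by rewrite /wronskian; ring. Qed.

(** A multiple of v is adjusted to u at one of the indices 0 and 1 where v does not
    vanish; the Wronskian takes care of the other. *)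
Lemma jacobi_proportional l u v : jacobi_solution a b l u ->
  jacobi_solution a b l v -> (exists k, v k != 0) -> wronskian b u v 0 = 0 ->
  exists c, forall k, u k = c * v k.
Proof.
move=> us vs [k vk]; rewrite /wronskian => /eqP; rewrite mulf_eq0 (negbTE (b0 0)) /=.
rewrite subr_eq0 => /eqP w.
have fit c : u 0%N = c * v 0%N -> u 1%N = c * v 1%N -> forall k, u k = c * v k.
  move=> e0 e1 j; apply/eqP; rewrite -subr_eq0.
  have ws := jacobi_solution_comb 1 (- c) us vs.
  have := jacobi_solution_eq0 b0 ws; rewrite e0 e1 !mul1r !mulNr !subrr => /(_ erefl erefl j).
  by rewrite mul1r mulNr => ->.
have [v0|v0] := eqVneq (v 0%N) 0; last first.
  exists (u 0%N / v 0%N); apply: fit; first by rewrite divfK.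
  by rewrite mulrAC w mulfK.
have v1 : v 1%N != 0.
  by apply: contraNneq vk => v1; rewrite (jacobi_solution_eq0 b0 vs v0 v1).
exists (u 1%N / v 1%N); apply: fit; last by rewrite divfK.
by move: w; rewrite v0 mulr0 => /eqP; rewrite mulf_eq0 (negbTE v1) orbF => /eqP ->; rewrite mulr0.
Qed.

End Proportional.

Section Conjugation.
Context {R : realType}.
Local Notation C := (R[i]^o).

Lemma conjCM (x y : C) : ((x * y)^*%C : C) = x^*%C * y^*%C.
Proof. exact: rmorphM. Qed.

Lemma conjCD (x y : C) : ((x + y)^*%C : C) = x^*%C + y^*%C.
Proof. exact: rmorphD. Qed.

Lemma conjCB (x y : C) : ((x - y)^*%C : C) = x^*%C - y^*%C.
Proof. exact: rmorphB. Qed.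

Lemma conjCr (x : R) : ((x%:C)^*%C : C) = x%:C.
Proof. exact: conjc_real. Qed.

End Conjugation.

Section Representation.
Context {R : realType} (S : multichannel_system R).
Local Notation C := (R[i]^o).
Local Notation n := (nchan S).
Local Notation fa := (@jacobi_a R S).
Local Notation fb := (@jacobi_b R S).
Local Notation aC g := (fun k => (fa g k)%:C : C).
Local Notation bC g := (fun k => (fb g k)%:C : C).
Variables (th : 'I_n -> C -> C) (e : 'I_n -> nat -> C -> C).
Hypothesis th_theta : is_theta th.
Hypothesis e_jost : is_jost e.
Hypothesis T_inv : finite_set [set om : C |
  closed_disk om /\ Tmx th e om \notin unitmx].
Variable s : 'I_n.

(** This is what the factor B B(0)^-1 D E(1)^-1 of U is made for: the Wronskian of
    the diagonal wave with e(t) is that of e(t^-1) with e(t). *)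
Lemma wave_wronskian g (l : C) (t : 'I_n -> C) : e s 1%N (t s) != 0 ->
  wronskian (bC g) (fun k => wave e s k g l t) (fun k => e g k (t g)) 0 =
  - ((chan_b s)%:C * ((t s)^-1 - t s)) *+ (g == s).
Proof.
move=> e0; rewrite /wronskian wave1 /wave /= mul1r.
case: eqP => [->|_]; rewrite ?mulr0n ?mulr1n; last by ring.
have srcE : (fb s 0%N)%:C * source e s t * e s 1%N (t s) =
    (chan_b s)%:C * ((t s)^-1 - t s).
  rewrite /source -[LHS]mulrA divfK // mulrA [_ * (_ / _)]mulrC divfK //.
  exact: fbC_neq0.
by rewrite -srcE; ring.
Qed.

Lemma theta_cvg g (z : C) : cabs z <= 1 ->
  th g @ within (U_domain th e) (nbhs z) --> th g z.
Proof.
move=> z1; apply/cvg_withinCE => d d0; have [r r0 rP] := th_cont th_theta g z1 d0.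
by exists r => // x [/closed_diskE x1 _ _ _ _]; exact: rP.
Qed.

Lemma jost_theta_cvg g k (z : C) : cabs z <= 1 -> z != 0 ->
  (fun x => e g k (th g x)) @ within (U_domain th e) (nbhs z) --> e g k (th g z).
Proof.
move=> z1 z0; have [t1 _ _] := th_closed th_theta g z1 z0.
have ed := nbhs_singleton (jost_derivable e_jost g k t1).
exact: (@cvg_compC _ _ (e g k) (th g) _ (@theta_cvg g z z1) ed).
Qed.

Lemma U_cvg_unique (f : C -> C) (z l l' : C) : cabs z <= 1 ->
  f @ within (U_domain th e) (nbhs z) --> l ->
  f @ within (U_domain th e) (nbhs z) --> l' -> l = l'.
Proof.
move=> z1 h h'; rewrite -(U_lim th_theta e_jost T_inv s z1 h).
exact: (U_lim th_theta e_jost T_inv s z1 h').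
Qed.

Section Limits.
Variable z : C.
Hypotheses (z1 : cabs z <= 1) (z0 : z != 0).
Hypothesis nz : forall k, nonsingular th e s k z.

Definition U_limit (f : C -> C) (l : C) : Prop :=
  f @ within (U_domain th e) (nbhs z) --> l.

Let Uc k g : U_limit (Ucol th e s k g) (psiU th e s k g z).
Proof. exact: nz. Qed.

Let FF : Filter (within (U_domain th e) (nbhs z)).
Proof. exact: within_filter. Qed.

Lemma U_limitD f g a b : U_limit f a -> U_limit g b ->
  U_limit (fun x => f x + g x) (a + b).
Proof. exact: cvgCD. Qed.

Lemma U_limitB f g a b : U_limit f a -> U_limit g b ->
  U_limit (fun x => f x - g x) (a - b).
Proof. exact: cvgCB. Qed.

Lemma U_limitM f g a b : U_limit f a -> U_limit g b ->
  U_limit (fun x => f x * g x) (a * b).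
Proof. exact: cvgCM. Qed.

Lemma U_limitc a : U_limit (fun=> a) a.
Proof. exact: cvg_cst. Qed.

Lemma U_limit_eq f g a b : U_limit f a -> U_limit g b ->
  (forall x, U_domain th e x -> f x = g x) -> a = b.
Proof.
move=> fa gb fg; apply: (@U_cvg_unique g z _ _ z1) gb.
exact: cvg_withinC_eq fg fa.
Qed.

Lemma psiU_solution g :
  jacobi_solution (aC g) (bC g) (lambda S z) (fun k => psiU th e s k g z).
Proof.
move=> k; have lc : U_limit (lambda S) (lambda S z).
  exact: cvg_withinC (derivable_continuousC (@lambda_derivable R S z z0)).
have rhs := U_limitM lc (@Uc k.+1 g).
have lhs := U_limitB (U_limitD (U_limitM (@U_limitc (- (fb g k)%:C)) (@Uc k g))
  (U_limitM (@U_limitc (fa g k.+1)%:C) (@Uc k.+1 g)))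
  (U_limitM (@U_limitc (fb g k.+1)%:C) (@Uc k.+2 g)).
apply: (U_limit_eq lhs rhs) => x xU; rewrite !UcolE //.
have [/closed_diskE x1 x0 _ _ _] := xU.
exact: (wave_solution s (jost_theta_solution th_theta e_jost g x1 x0) k).
Qed.

(** The Wronskian only involves the components 0 and 1 of the wave, so that its
    limit exists also where the coefficients of the wave could be singular. *)
Lemma psiU_wronskian g :
  wronskian (bC g) (fun k => psiU th e s k g z) (fun k => e g k (th g z)) 0 =
  - ((chan_b s)%:C * ((th s z)^-1 - th s z)) *+ (g == s).
Proof.
have [_ t0 _] := th_closed th_theta s z1 z0.
have tc : U_limit (th s) (th s z) := @theta_cvg s z z1.
have tVc : U_limit (fun x => (th s x)^-1) (th s z)^-1 by exact: cvgCV t0 tc.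
have rhs := U_limitM (U_limitB (@U_limitc 0)
  (U_limitM (@U_limitc (chan_b s)%:C) (U_limitB tVc tc))) (@U_limitc (g == s)%:R).
have ec k : U_limit (fun x => e g k (th g x)) (e g k (th g z)).
  exact: jost_theta_cvg.
have lhs := U_limitM (@U_limitc (fb g 0)%:C) (U_limitB (U_limitM (@Uc 0 g) (ec 1%N))
  (U_limitM (@Uc 1 g) (ec 0%N))).
rewrite -mulr_natr -sub0r; apply: (U_limit_eq lhs rhs) => x xU; rewrite !UcolE //.
have [_ _ _ _ e0] := (U_domainP e th x).1 xU.
by rewrite -[LHS]/(wronskian (bC g) (fun k => wave e s k g (lambda S x) (th^~ x))
  (fun k => e g k (th g x)) 0) wave_wronskian // sub0r mulr_natr.
Qed.

Lemma jost_theta_neq0 g : exists k, e g k (th g z) != 0.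
Proof.
have [t1 t0 _] := th_closed th_theta g z1 z0.
have [N NP] := jost_neq0 t0 (jost_asymptotics e_jost g t1 t0).
by exists N; exact: NP.
Qed.

Lemma psiU_transmitted g : g != s ->
  exists c, forall k, psiU th e s k g z = c * e g k (th g z).
Proof.
move=> gs; apply: (jacobi_proportional (fun k => fbC_neq0 g k) (psiU_solution g)
  (jost_theta_solution th_theta e_jost g z1 z0) (jost_theta_neq0 g)).
by rewrite psiU_wronskian (negbTE gs).
Qed.

(** psi - e(theta^-1) has vanishing Wronskian with e(theta); at theta = 1 or -1 the
    two Jost solutions coincide and the argument is still valid. *)
Lemma psiU_reflected : cabs (th s z) = 1 -> exists c, forall k,
  psiU th e s k s z = e s k (th s z)^-1 + c * e s k (th s z).
Proof.
move=> t1; have [tl t0 tE] := th_closed th_theta s z1 z0.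
have it1 : cabs (th s z)^-1 <= 1 by rewrite cabsV t1 invr1.
have it0 : (th s z)^-1 != 0 by rewrite invr_eq0.
have Es := jost_theta_solution th_theta e_jost s z1 z0.
have Fs := jost_solution e_jost s it1 it0; rewrite zhukovsky_inv tE in Fs.
have us := jacobi_solution_comb 1 (- 1) (psiU_solution s) Fs.
have w0 : wronskian (bC s) (fun k => 1 * psiU th e s k s z + - 1 * e s k (th s z)^-1)
    (fun k => e s k (th s z)) 0 = 0.
  have := psiU_wronskian s; rewrite eqxx mulr1n.
  have := jost_wronskian_inv (@jacobi_b_cvg R S s) (mulVf t0)
    (jost_asymptotics e_jost s it1 it0) (jost_asymptotics e_jost s tl t0) Fs Es.
  rewrite wronskian_comb => -> ->; ring.
have [c cP] := jacobi_proportional (fun k => fbC_neq0 s k) us Es (jost_theta_neq0 s) w0.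
exists c => k; rewrite -(cP k); ring.
Qed.

End Limits.

Lemma tplusP (z : C) : Tplus th s z <-> cabs z = 1 /\ cabs (th s z) = 1.
Proof. by split=> -[/unit_circleE h1 /unit_circleE h2]. Qed.

Section Flux.
Variable z : C.
Hypothesis gz : good th e z.
Hypothesis z1 : cabs z = 1.
Local Notation l := (lambda S z).
Local Notation t := (th^~ z).

Lemma good_reflection k : cabs (th s z) = 1 -> wave e s k s l t =
  e s k (th s z)^-1 + reflection e s l t * e s k (th s z).
Proof.
move=> t1; have [zl z0 _ _ /(_ s)[e0 _]] := gz.
have [c cP] := psiU_reflected zl z0
  (fun k => @good_nonsingular R S th e th_theta e_jost s z k gz) t1.
suff -> : reflection e s l t = c by rewrite -cP (good_psiU th_theta e_jost T_inv).
have := cP 1%N; rewrite (good_psiU th_theta e_jost T_inv) // wave1 => h.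
apply: (mulIf e0); rewrite /reflection mulrBl divfK // [_ * e s 1%N _]mulrC h.
by rewrite addrC addKr.
Qed.

Lemma wave_transmitted k g : g != s ->
  wave e s k g l t = scatter e s g l t * e g k (th g z).
Proof. by move=> /negbTE gs; rewrite /wave gs mulr0n add0r mulrC. Qed.

Lemma lambda_circle_real : l^*%C = l.
Proof.
have := Im_lambda_circle S z1; case: (lambda S z) => x y /= ->.
by rewrite oppr0.
Qed.

(** Inside the band conj e(theta) is e(theta^-1); outside, theta and e(theta) are
    real and both sides vanish. *)
Lemma jost_flux g : wronskian (bC g) (fun k => (e g k (th g z))^*%C : C)
  (fun k => e g k (th g z)) 0 = (chan_b g)%:C * (th g z - (th g z)^*%C).
Proof.
have [zl z0 _ _ _] := gz; have [tl t0 _] := th_closed th_theta g zl z0.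
have Es := jost_theta_solution th_theta e_jost g zl z0.
have Ej := jost_asymptotics e_jost g tl t0.
have Cs := jacobi_solution_conj Es; rewrite lambda_circle_real in Cs.
have Cj := jost_conj Ej.
have [t1|It] := th_circle th_theta g z1.
  have tt : ((th g z)^*%C : C) * th g z = 1 by rewrite (conj_unit t1) mulVf.
  exact: (jost_wronskian_inv (@jacobi_b_cvg R S g) tt Cj Ej Cs Es).
have tr : ((th g z)^*%C : C) = th g z.
  by move: It; case: (th g z) => x y /= ->; rewrite oppr0.
rewrite tr in Cj *.
have eE := jost_unique (@jacobi_b_gt0 R S g) (@jacobi_b_cvg R S g) t0 tl Cj Ej Cs Es.
by rewrite /wronskian !eE [X in X - _]mulrC !subrr !mulr0.
Qed.

(** Pair the equation of the core with the conjugate of the wave on the core. The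
    matrix is real symmetric and lambda is real on the circle, so that only the
    fluxes into the channels contribute to the imaginary part. *)
Lemma flux_conservation : \sum_g wronskian (bC g)
  (fun k => (wave e s k g l t)^*%C : C) (fun k => wave e s k g l t) 0 = 0.
Proof.
have [zl z0 cr Tu _] := gz.
pose v (al : S) : C := \sum_h resolvent al (chan h 0%N) l * (fb h 0%N)%:C *
  wave e s 1 h l t.
have vE g : v (chan g 0%N) = wave e s 0 g l t by rewrite (wave_gate s g Tu).
have res := resolvent_equation cr (y := fun h => wave e s 1 h l t) (u := v)
  (fun al _ => erefl).
pose Q : C := \sum_(x : core S) \sum_(x' : core S)
  (interaction (fsval x) (fsval x'))%:C * v (fsval x') * (v (fsval x))^*%C.
have Qc : Q^*%C = Q.
  rewrite /Q rmorph_sum exchange_big /=; apply: eq_bigr => x _.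
  rewrite rmorph_sum /=; apply: eq_bigr => x' _.
  by rewrite !conjCM conjcK conjCr interaction_sym; ring.
pose N : C := \sum_(x : core S) v (fsval x) * (v (fsval x))^*%C.
have Nc : N^*%C = N.
  rewrite /N rmorph_sum /=; apply: eq_bigr => x _.
  by rewrite conjCM conjcK mulrC.
pose J : C := \sum_g (fb g 0%N)%:C * wave e s 1 g l t * (wave e s 0 g l t)^*%C.
have QE : Q = l * N + J.
  rewrite /Q /N mulr_sumr.
  have -> : J = \sum_(x : core S) \sum_(g < n | fsval x == chan g 0%N)
      (fb g 0%N)%:C * wave e s 1 g l t * (v (fsval x))^*%C.
    rewrite (exchange_big_dep xpredT) //=; apply: eq_bigr => g _.
    have gateP (x : core S) : (fsval x == chan g 0%N) = (x == gate g).
      by apply/eqP/eqP => [h|-> //]; exact: val_inj.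
    by rewrite (big_pred1 (gate g) gateP) /= vE.
  rewrite -big_split /=; apply: eq_bigr => x _.
  by rewrite -!mulr_suml res mulrDl mulrA.
have Jc : J^*%C = J.
  have -> : J = Q - l * N by rewrite QE addrC addKr.
  by rewrite conjCB conjCM Qc Nc lambda_circle_real.
transitivity (J - J^*%C); last by rewrite Jc subrr.
rewrite /J rmorph_sum -sumrB /=; apply: eq_bigr => g _.
by rewrite /wronskian !conjCM conjcK conjCr; ring.
Qed.

Lemma wave_flux g : cabs (th s z) = 1 -> wronskian (bC g)
  (fun k => (wave e s k g l t)^*%C : C) (fun k => wave e s k g l t) 0 =
  (if g == s then cabs (reflection e s l t) ^+ 2 - 1
   else cabs (scatter e s g l t) ^+ 2)%:C *
  ((chan_b g)%:C * (th g z - (th g z)^*%C)).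
Proof.
move=> t1; have [zl z0 _ _ _] := gz; rewrite -jost_flux /wronskian.
have sq (x : C) : (cabs x ^+ 2)%:C = x * x^*%C.
  by rewrite -[x * _]sqr_normc norm_cabs rmorphXn.
case: eqP => [->|/eqP gs]; last first.
  by rewrite !wave_transmitted // sq !conjCM; ring.
have FE k : ((e s k (th s z))^*%C : C) = e s k (th s z)^-1.
  have [tl t0 tE] := th_closed th_theta s zl z0.
  have it1 : cabs (th s z)^-1 <= 1 by rewrite cabsV t1 invr1.
  have it0 : (th s z)^-1 != 0 by rewrite invr_eq0.
  have Es := jacobi_solution_conj (jost_theta_solution th_theta e_jost s zl z0).
  have Fs := jost_solution e_jost s it1 it0; rewrite zhukovsky_inv tE in Fs.
  rewrite lambda_circle_real in Es.
  have Ej := jost_conj (jost_asymptotics e_jost s tl t0).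
  rewrite (conj_unit t1) in Ej.
  exact: (jost_unique (@jacobi_b_gt0 R S s) (@jacobi_b_cvg R S s) it0 it1 Ej
    (jost_asymptotics e_jost s it1 it0) Es Fs).
have EF k : ((e s k (th s z)^-1)^*%C : C) = e s k (th s z) by rewrite -FE conjcK.
have -> : ((cabs (reflection e s l t) ^+ 2 - 1)%:C : C) =
    reflection e s l t * (reflection e s l t)^*%C - 1.
  by rewrite rmorphB rmorph1 -sq.
rewrite !good_reflection //; move: (reflection e s l t) => rho.
rewrite !conjCD !conjCM !EF !FE.
ring.
Qed.

(** The sum over g of the fluxes b_g |c_g|^2 Im theta_g, with |rho|^2 - 1 in place
    of |c_s|^2, vanishes; by [th_Im_sign] the Im theta_g all have the same sign,
    so that |rho|^2 - 1 cannot be positive. *)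
Lemma reflection_le1 : cabs (th s z) = 1 -> cabs (reflection e s l t) <= 1.
Proof.
move=> t1; have [zl z0 _ _ /(_ s)[_ t2]] := gz.
have := flux_conservation.
under eq_bigr do rewrite (wave_flux _ t1).
move/(congr1 (@complex.Im R)).
rewrite (big_morph (@complex.Im R) (@raddfD _ _ (@complex.Im R : {additive R[i] -> R})) (raddf0 _)).
have term (x b : R) (y : C) : complex.Im (x%:C * (b%:C * (y - y^*%C)) : C) =
    2 * x * b * complex.Im y by case: y => y1 y2 /=; ring.
under eq_bigr do rewrite term.
rewrite (bigD1 s) //= eqxx => flux.
have Is : complex.Im (th s z) != 0.
  apply: circle_Im_neq0 t1 _ _; apply: contra_neq t2 => ->.
    by rewrite expr1n.
  by rewrite sqrrN expr1n.
have I2 : 0 < complex.Im (th s z) ^+ 2 by rewrite lt_neqAle sqr_ge0 andbT eq_sym sqrf_eq0.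
have others : 0 <= complex.Im (th s z) * \sum_(i | i != s)
    2 * (if i == s then cabs (reflection e s l t) ^+ 2 - 1
         else cabs (scatter e s i l t) ^+ 2) * chan_b i * complex.Im (th i z).
  rewrite mulr_sumr; apply: sumr_ge0 => i /negbTE ->.
  have [h _] := th_Im_sign th_theta s i zl z0.
  have b0 := chan_b_gt0 i.
  have -> : complex.Im (th s z) * (2 * cabs (scatter e s i l t) ^+ 2 * chan_b i *
    complex.Im (th i z)) = 2 * cabs (scatter e s i l t) ^+ 2 * chan_b i *
    (complex.Im (th s z) * complex.Im (th i z)) by ring.
  by rewrite mulr_ge0 // mulr_ge0 ?(ltW b0) // mulr_ge0 // sqr_ge0.
have key : 2 * chan_b s * complex.Im (th s z) ^+ 2 *
    (cabs (reflection e s l t) ^+ 2 - 1) <= 0.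
  have := congr1 (fun x => complex.Im (th s z) * x) flux; rewrite mulr0 mulrDr.
  move/eqP; rewrite addr_eq0 => /eqP h.
  have -> : 2 * chan_b s * complex.Im (th s z) ^+ 2 *
      (cabs (reflection e s l t) ^+ 2 - 1) = complex.Im (th s z) *
      (2 * (cabs (reflection e s l t) ^+ 2 - 1) * chan_b s * complex.Im (th s z)).
    by ring.
  by rewrite h oppr_le0.
have bs := chan_b_gt0 s.
have p : 0 < 2 * chan_b s * complex.Im (th s z) ^+ 2.
  by apply: mulr_gt0 I2; apply: mulr_gt0 bs.
move: key; rewrite pmulr_rle0 // subr_le0 => h.
by rewrite -(@expr_le1 _ 2) ?cabs_ge0.
Qed.

End Flux.
End Representation.

(** * The special solution *)

Section SpecialSolution.
Context {R : realType} (S : multichannel_system R).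
Local Notation C := (R[i]^o).
Local Notation n := (nchan S).
Local Notation fa := (@jacobi_a R S).
Local Notation fb := (@jacobi_b R S).
Variables (th : 'I_n -> C -> C) (e : 'I_n -> nat -> C -> C).
Hypothesis th_theta : is_theta th.
Hypothesis e_jost : is_jost e.
Hypothesis T_inv : finite_set [set om : C |
  closed_disk om /\ Tmx th e om \notin unitmx].
Variable s : 'I_n.

Definition reflection_at (z : C) : C := reflection e s (lambda S z) (th^~ z).

Lemma chart_reflection_mero (z0 x0 : C) om t D : cabs (th s z0) = 1 ->
  cabs z0 <= 1 -> chart th z0 x0 om t D ->
  meromorphic_at (fun x => reflection e s (lambda S (om x)) (t^~ x)) x0.
Proof.
move=> t1 z1 ch; have A := mero_local x0.
have t0 : th s z0 != 0 by exact: cabs1_neq0.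
have it1 : cabs (th s z0)^-1 <= 1 by rewrite cabsV t1 invr1.
have tc := chart_theta_cvg ch s.
have itc : (fun x => (t s x)^-1) @ x0^' --> (th s z0)^-1 by exact: cvgCV t0 tc.
have ed := jost_derivable e_jost s 1 it1.
have near_ed : \forall x \near x0^', derivable (e s 1%N) ((t s x)^-1) 1.
  exact: (@near_cvg _ (fun y => derivable (e s 1%N) y 1) x0^' (fun x => (t s x)^-1) _ itc ed).
have near_t := chart_near_theta th_theta e_jost T_inv s z1 ch s.
apply: (la_sub A); first exact: (chart_scatter_mero th_theta e_jost T_inv s z1 ch s).
apply: (la_mul A); last first.
  apply: (la_inv A); first exact: (chart_jost_mero th_theta e_jost z1 ch s 1).
  exact: (chart_near_jost th_theta e_jost T_inv s z1 ch s).
apply: (@mero_cvg _ _ _ (e s 1%N (th s z0)^-1)).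
  have td := chart_theta_derivable ch s.
  apply: filterS3 near_ed near_t td => x xe [xt _] xd.
  apply: (@derivable_compC _ (fun x => (t s x)^-1) (e s 1%N)); last exact: xe.
  exact: derivableCV xt xd.
exact: (@cvg_compC _ _ (e s 1%N) (fun x => (t s x)^-1) _ itc (nbhs_singleton ed)).
Qed.

(** In a chart the reflection coefficient is a meromorphic germ which is bounded
    by 1 at the points of [Tplus], so that it has a limit if these accumulate
    at z; if z is isolated in [Tplus] there is nothing to prove. *)
Lemma reflection_limit (z : C) : Tplus th s z -> exists v : C,
  forall d : R, 0 < d -> exists2 r : R, 0 < r & forall y, Tplus th s y ->
    y != z -> cabs (y - z) < r -> cabs (reflection_at y - v) < d.
Proof.
move=> /tplusP[zu t1]; have z1 : cabs z <= 1 by rewrite zu.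
have [acc|nacc] := EM (forall r : R, 0 < r ->
    exists y, [/\ Tplus th s y, y != z & cabs (y - z) < r]); last first.
  exists 0 => d d0; have [r /not_implyP[r0 rP]] : exists r : R, ~ (0 < r ->
      exists y, [/\ Tplus th s y, y != z & cabs (y - z) < r]).
    by apply: contrapT => h; apply: nacc => r; apply: contrapT => hr; apply: h; exists r.
  by exists r => // y yT yz yr; case: rP; exists y.
have [x0 [om [t [D ch]]]] := chart_exists th_theta z1.
have Hm := chart_reflection_mero t1 z1 ch.
set H := (fun x : C => _) in Hm.
have near_g := chart_near_good th_theta e_jost T_inv s z1 ch.
have [r0 r00 r0P] := dnbhs_and (chart_sub ch) near_g.
have HE x : x != x0 -> cabs (x - x0) < r0 -> D x ->
    good th e (om x) /\ H x = reflection_at (om x).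
  move=> xx xr Dx; have [h1 h2] := r0P x xx xr; split; first exact: h2.
  have [_ _ tx] := h1 Dx; rewrite /H /reflection_at.
  by congr reflection; apply/funext => g.
have [l Hl] : exists l : C, H @ x0^' --> l.
  apply: (mero_bounded_cvg (M := 1) Hm) => d d0.
  have dm : 0 < Num.min d r0 by rewrite lt_min d0.
  have [q q0 qP] := chart_onto ch dm.
  have [y [yT yz yq]] := acc q q0; have [y1 ty1] := (tplusP th s y).1 yT.
  have yl : cabs y <= 1 by rewrite y1.
  have [x [Dx xx + xy]] := qP y yl yz yq; rewrite lt_min => /andP[xd xr].
  have [gx Hx] := HE x xx xr Dx; exists x; split=> //.
  rewrite Hx xy; apply: (reflection_le1 th_theta e_jost T_inv); rewrite -?xy //.
    by rewrite xy.
  by rewrite xy.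
exists l => d d0; have [p p0 pP] := (cvg_dnbhsC _ _ _).1 Hl d d0.
have pm : 0 < Num.min p r0 by rewrite lt_min p0.
have [q q0 qP] := chart_onto ch pm; exists q => // y yT yz yq.
have [y1 _] := (tplusP th s y).1 yT; have yl : cabs y <= 1 by rewrite y1.
have [x [Dx xx + xy]] := qP y yl yz yq; rewrite lt_min => /andP[xp xr].
by have [_ Hx] := HE x xx xr Dx; rewrite -xy -Hx; exact: pP.
Qed.

Lemma good_reflection_cvg (z : C) : good th e z -> cabs (th s z) = 1 ->
  forall d : R, 0 < d -> exists2 r : R, 0 < r & forall y, cabs y <= 1 ->
    cabs (y - z) < r -> cabs (reflection_at y - reflection_at z) < d.
Proof.
move=> gz t1; have [z1 z0 _ _ _] := gz; have A := derivable_local z.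
have it1 : cabs (th s z)^-1 <= 1 by rewrite cabsV t1 invr1.
pose F x := reflection e s (lambda S x) (fun g => theta_ext th g x).
have Fd : derivable F z 1.
  apply: (la_sub A); first exact: (@good_scatter_derivable R S th e th_theta e_jost z gz s s).
  apply: (la_mul A); last first.
    apply: (la_inv A); first exact: (@good_jost_derivable R S th e th_theta e_jost z gz s 1).
    exact: (good_near_jost th_theta e_jost gz s).
  apply: (@derivable_compC _ (fun x => (theta_ext th s x)^-1) (e s 1%N)).
    apply: (la_inv A); first exact: (@good_theta_derivable R S th e th_theta z gz s).
    exact: (good_near_theta th_theta gz s).
  by rewrite theta_ext_disk //; exact: nbhs_singleton (jost_derivable e_jost s 1 it1).
have FE y : cabs y <= 1 -> F y = reflection_at y.
  by move=> y1; congr reflection; apply/funext => g; exact: theta_ext_disk.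
have /cvg_nbhsC h := derivable_continuousC Fd.
move=> d /h[r r0 rP]; exists r => // y y1 yr.
by rewrite -!FE //; exact: rP.
Qed.

Lemma reflection_extension : exists rho : C -> C,
  {within Tplus th s, continuous rho} /\
  forall z, good th e z -> rho z = reflection_at z.
Proof.
have /choice[v vP] : forall z, exists v : C, Tplus th s z ->
    forall d : R, 0 < d -> exists2 r : R, 0 < r & forall y, Tplus th s y ->
      y != z -> cabs (y - z) < r -> cabs (reflection_at y - v) < d.
  move=> z; have [zT|nT] := EM (Tplus th s z); last by exists 0.
  by have [v vP] := reflection_limit zT; exists v.
exists (fun z => if `[< good th e z >] then reflection_at z else v z).
split; last by move=> z gz; rewrite asboolT.
apply/subspace_continuousP => z zT; have [zu t1] := (tplusP th s z).1 zT.
have z1 : cabs z <= 1 by rewrite zu.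
have [d0 d00 d0P] := good_isolated th_theta e_jost T_inv s z1.
apply/cvg_withinCE => d d_gt0.
have [r r0 rP] : exists2 r : R, 0 < r & forall y, Tplus th s y -> y != z ->
    cabs (y - z) < r -> cabs (reflection_at y -
      (if `[< good th e z >] then reflection_at z else v z)) < d.
  have [gz|ngz] := asboolP (good th e z); last exact: vP.
  have [r r0 rP] := good_reflection_cvg gz t1 d_gt0; exists r => // y yT _.
  by apply: rP; have [-> _] := (tplusP th s y).1 yT.
exists (Num.min r d0) => [|y yT]; first by rewrite lt_min r0.
rewrite lt_min => /andP[yr yd]; have [->|yz] := eqVneq y z.
  by rewrite subrr cabs0.
have yl : cabs y <= 1 by have [-> _] := (tplusP th s y).1 yT.
by rewrite /from_subspace /= (asboolT (d0P y yl yz yd)); exact: rP.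
Qed.

(** The amplitude of the growing solution p in [growing_solution_cvg] is exactly
    compensated by [source], and the Jost term decays. *)
Lemma incident_asymptotics (z : C) : good th e z -> cabs (th s z) < 1 ->
  (fun k => wave e s k s (lambda S z) (th^~ z) * th s z ^+ k : C) @ \oo --> (1 : C).
Proof.
move=> gz t1; have [z1 z0 _ _ /(_ s)[e0 t2]] := gz.
have [tl t0 _] := th_closed th_theta s z1 z0.
have Es := jost_theta_solution th_theta e_jost s z1 z0.
have Ej := jost_asymptotics e_jost s tl t0.
have grow := growing_solution_cvg (@jacobi_b_gt0 R S s) (chan_b_gt0 s)
  (@jacobi_b_cvg R S s) t0 t1 Ej Es (dirichlet_solution s (lambda S z)) erefl erefl.
have bn := fbC_neq0 s 0; have cbn := realC_neq0 (chan_b_gt0 s).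
have tt1 : 1 - th s z * th s z != 0 by rewrite subr_eq0 eq_sym -expr2.
have pow0 : (fun k => (th s z * th s z) ^+ k : C) @ \oo --> (0 : C).
  apply: cvg_seq_pow0; rewrite cabsM; apply: le_lt_trans t1.
  by rewrite ler_piMl ?cabs_ge0.
set src := source e s (th^~ z); set c := scatter e s s (lambda S z) (th^~ z).
have lim : (fun k => - src * (dirichlet s k (lambda S z) * th s z ^+ k) +
    c * ((e s k (th s z) / th s z ^+ k) * (th s z * th s z) ^+ k) : C) @ \oo -->
    (- src * - ((fb s 0)%:C * e s 1%N (th s z) * th s z / (chan_b s)%:C /
      (1 - th s z * th s z)) + c * (1 * 0) : C).
  apply: cvgCD; apply: cvgCM; [exact: cvg_cst|exact: grow|exact: cvg_cst|].
  exact: cvgCM Ej pow0.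
have -> : (1 : C) = - src * - ((fb s 0)%:C * e s 1%N (th s z) * th s z /
    (chan_b s)%:C / (1 - th s z * th s z)) + c * (1 * 0).
  by rewrite /src /source; field; rewrite bn cbn e0 t0 tt1.
apply: (cvg_seq_eq (N := 0%N) _ lim) => k _; rewrite /wave eqxx mulr1n -/src -/c.
have -> : (th s z * th s z) ^+ k = th s z ^+ k * th s z ^+ k by exact: exprMn.
have tk : th s z ^+ k != 0 by rewrite expf_neq0.
by rewrite mulrDl [_ / _ * _]mulrA divfK //; ring.
Qed.

(** At an attachment point the two prescriptions agree by [psiU_boundary] when
    both apply, but each of them may apply alone. *)
Lemma prolongation_exists : exists psi : S -> C -> C,
  (forall (om : C) k g, closed_disk om -> nonsingular th e s k om ->
     psi (chan g k) om = psiU th e s k g om) /\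
  (forall (om : C) al, closed_disk om -> om != 0 ->
     core_regular S (lambda S om) -> nonsingular th e s 1 om ->
     al \in core S ->
     psi al om = \sum_(v < n) resolvent al (chan v 0%N) (lambda S om)
       * (fb v 0)%:C * psi (chan v 1%N) om).
Proof.
(* The position of a particle in the channels, attachment points included. *)
have /choice[idx idxP] : forall al : S, exists o : option ('I_n * nat),
    if o is Some gk then al = chan gk.1 gk.2
    else al \in core S /\ forall g k, al <> chan g k.
  move=> al; have [[g [k alE]]|no] := EM (exists g k, al = chan g k).
    by exists (Some (g, k)).
  exists None; split=> [|g k alE]; last by apply: no; exists g, k.
  by have [//|[g [k alE]]] := core_chanP al; case: no; exists g, k.+1.
pose ok om := [/\ om != 0, core_regular S (lambda S om) & nonsingular th e s 1 om].
pose formula al om : C := \sum_(v < n) resolvent al (chan v 0%N) (lambda S om)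
  * (fb v 0)%:C * psiU th e s 1 v om.
pose psi al om : C := match idx al with
  | Some (g, k.+1) => psiU th e s k.+1 g om
  | Some (g, 0) => if `[< ok om >] then formula al om else psiU th e s 0 g om
  | None => formula al om end.
have idx_chan g k : idx (chan g k) = Some (g, k).
  have := idxP (chan g k); case: (idx _) => [[g' k'] /= /chan_inj[-> ->] //|].
  by case=> _ /(_ g k).
have psiS g k om : psi (chan g k.+1) om = psiU th e s k.+1 g om.
  by rewrite /psi idx_chan.
exists psi; split=> [om [|k] g omd ns|om al omd om0 cr n1 alc].
- rewrite /psi idx_chan; case: asboolP => // -[om0 cr n1].
  rewrite (psiU_boundary th_theta e_jost T_inv) //; exact/closed_diskE.
- exact: psiS.
under eq_bigr do rewrite psiS.
rewrite /psi; have := idxP al; case: (idx al) => [[g [|k]]|] //=.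
  by move=> _; rewrite asboolT.
by move=> alE; move: alc; rewrite alE (negbTE (chan_notin_core _ _)).
Qed.

(** All the requirements are checked at the good points, the finite set of the
    others being put into the exceptional set. *)
Lemma prolongation_special (psi : S -> C -> C) :
  (forall (om : C) k g, closed_disk om -> nonsingular th e s k om ->
     psi (chan g k) om = psiU th e s k g om) ->
  (forall (om : C) al, closed_disk om -> om != 0 ->
     core_regular S (lambda S om) -> nonsingular th e s 1 om ->
     al \in core S ->
     psi al om = \sum_(v < n) resolvent al (chan v 0%N) (lambda S om)
       * (fb v 0)%:C * psi (chan v 1%N) om) ->
  special_solution th e s psi.
Proof.
move=> psi_chan psi_core.
have psi_wave z k g : good th e z ->
    psi (chan g k) z = wave e s k g (lambda S z) (th^~ z).
  move=> gz; have [/closed_diskE z1 _ _ _ _] := gz.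
  rewrite psi_chan // ?(good_psiU th_theta e_jost T_inv) //.
  exact: (@good_nonsingular R S th e th_theta e_jost s z k gz).
have mero := mero_disk th_theta e_jost T_inv s.
have goodO z O' : (closed_disk `\` (O' `|` bad_set th e)) z -> good th e z.
  by move=> [z1 nO]; apply: goodP => // h; apply: nO; right.
exists (bad_set th e); split.
- exact: (bad_finite th_theta e_jost T_inv s).
- by move=> z [].
- move=> g k; apply: (mero (wave e s k.+1 g)).
  + by move=> z0 x0 om t D z1 ch; exact: (chart_wave_mero th_theta e_jost T_inv s z1 ch).
  + by move=> z gz; exact: (@good_wave_derivable R S th e th_theta e_jost z gz s k.+1 g).
  + by move=> z gz; exact: psi_wave.
- move=> z [zd nb] al; have gz := goodP zd nb; have [z1 z0 cr Tu _] := gz.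
  have [alc|[g [k ->]]] := core_chanP al.
    apply: core_equation alc => // al' alc'; apply: psi_core => //.
    exact: (@good_nonsingular R S th e th_theta e_jost s z 1 gz).
  rewrite apply_matrix_chan !psi_wave //.
  exact: (wave_solution s (jost_theta_solution th_theta e_jost g z1 z0) k).
have [rho [rho_cont rhoE]] := reflection_extension.
exists (fun g z => if g == s then rho z else scatter e s g (lambda S z) (th^~ z)).
split.
- move=> g gs; exists (bad_set th e).
    by split; [exact: (bad_finite th_theta e_jost T_inv s)|move=> z []].
  rewrite (negbTE gs); apply: (mero (scatter e s g)) => //.
  + by move=> z0 x0 om t D z1 ch; exact: (chart_scatter_mero th_theta e_jost T_inv s z1 ch).
  + by move=> z gz; exact: (@good_scatter_derivable R S th e th_theta e_jost z gz s g).
- by rewrite eqxx.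
- move=> z [zT nb] k g; have [zu t1] := (tplusP th s z).1 zT.
  have gz : good th e z by apply: goodP => //; apply/closed_diskE; rewrite zu.
  rewrite psi_wave //; case: eqP => [->|/eqP gs]; last exact: wave_transmitted.
  by rewrite eqxx rhoE // (good_reflection th_theta e_jost T_inv gz).
- move=> z [zd nT]; have gz := goodO z _ (conj zd nT).
  have [z1 z0 _ _ _] := gz; have [tl _ _] := th_closed th_theta s z1 z0.
  have t1 : cabs (th s z) < 1.
    rewrite lt_neqAle tl andbT; apply/eqP => t1; apply: nT; left; apply/tplusP.
    split=> //; apply/eqP; rewrite eq_le z1 leNgt; apply/negP => zlt.
    by have [h _ _] := th_open th_theta s zlt z0; rewrite t1 ltxx in h.
  have lim := incident_asymptotics gz t1.
  by apply: (cvg_seq_eq (N := 0%N) _ lim) => k _; rewrite psi_wave.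
- move=> z zO g k gs; have gz := goodO z _ zO.
  by rewrite psi_wave // (negbTE gs) wave_transmitted.
Qed.

End SpecialSolution.

Theorem lemma5p2 (R : realType) (S : multichannel_system R)
    (th : 'I_(nchan S) -> R[i]^o -> R[i]^o)
    (e : 'I_(nchan S) -> nat -> R[i]^o -> R[i]^o)
    (th_theta : is_theta th) (e_jost : is_jost e)
    (T_inv : finite_set [set om : R[i]^o |
       closed_disk om /\ Tmx th e om \notin unitmx])
    (s : 'I_(nchan S)) :
  [/\ forall om : R[i]^o, closed_disk om -> om != 0 ->
        core_regular S (lambda S om) ->
        nonsingular th e s 0 om -> nonsingular th e s 1 om ->
        psiU_vec th e s 0 om
        = Rmx S (lambda S om) *m B0mx S *m psiU_vec th e s 1 om,
      exists sc : 'I_(nchan S) -> R[i]^o -> R[i]^o,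
        forall om : R[i]^o, Tplus th s om ->
          (forall k, nonsingular th e s k om) ->
          forall k, channel_representation th e s sc om
            (fun g => psiU th e s k g om) k &
      exists psi : S -> R[i]^o -> R[i]^o,
        [/\ forall (om : R[i]^o) k g, closed_disk om ->
              nonsingular th e s k om ->
              psi (chan g k) om = psiU th e s k g om,
            forall (om : R[i]^o) al, closed_disk om -> om != 0 ->
              core_regular S (lambda S om) -> nonsingular th e s 1 om ->
              al \in core S ->
              psi al om = \sum_(v < nchan S)
                resolvent al (chan v 0%N) (lambda S om)
                  * (jacobi_b v 0)%:C * psi (chan v 1%N) om &
            special_solution th e s psi]].
Proof.
split.
- move=> om /closed_diskE om1 om0 cr n0 n1; apply/colP => g.
  rewrite /B0mx mul_mx_diag !mxE.
  rewrite (psiU_boundary th_theta e_jost T_inv g om1 om0 cr n0 n1).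
  by apply: eq_bigr => h _; rewrite !mxE.
- have /choice[c cP] : forall om : R[i]^o, exists c : 'I_(nchan S) -> R[i]^o,
      Tplus th s om -> (forall k, nonsingular th e s k om) ->
      forall g k, psiU th e s k g om = if g == s
        then e s k (th s om)^-1 + c s * e s k (th s om)
        else c g * e g k (th g om).
    move=> om; have [[/tplusP[om1 t1] ns]|no] :=
      EM (Tplus th s om /\ forall k, nonsingular th e s k om); last first.
      by exists (fun=> 0) => h1 h2; case: no.
    have oml : cabs om <= 1 by rewrite om1.
    have om0 := cabs1_neq0 om1.
    have /choice[c cP] : forall g, exists c : R[i]^o, forall k,
        psiU th e s k g om = if g == s
          then e s k (th s om)^-1 + c * e s k (th s om) else c * e g k (th g om).
      move=> g; have [->|gs] := eqVneq g s.
        exact: (psiU_reflected th_theta e_jost T_inv oml om0 ns t1).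
      exact: (psiU_transmitted th_theta e_jost T_inv oml om0 ns gs).
    by exists c => _ _ g k; rewrite cP; case: eqP => [->|].
  by exists (fun g om => c om g) => om oT ns k g; exact: cP.
have [psi [psi_chan psi_core]] := prolongation_exists th_theta e_jost T_inv s.
exists psi; split.
- exact: psi_chan.
- exact: psi_core.
- exact: (prolongation_special th_theta e_jost T_inv psi_chan psi_core).
Qed.
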